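(* For every $k\ge 3$ and every $n\ge 3$, every connected $n$-vertex (not necessarily non-homotopic) $k^+$-real face graph has at most $\frac{k}{k-2}(n-2)$ edges.
   Context: Graphs are finite and have no loops, but may have parallel edges. A drawing on the sphere $\mathbb{S}^2$ maps vertices to pairwise distinct points and each edge to a simple Jordan arc joining its endpoints, such that no edge passes through a vertex, any two edges have finitely many common points, every common interior point of two edges is a proper crossing, and no three edges pass through the same crossing. Cells are the connected components of $\mathbb{S}^2$ minus the drawing; a vertex-incidence of a cell is an appearance of a vertex on its boundary (counted with repetitions). A drawing is $k^+$-real face if every cell has at least $k$ vertex-incidences, and a $k^+$-real face graph is a graph admitting such a drawing. *)

(* Defs.v *)
From HB Require Import structures.
From mathcomp Require Import all_boot all_order all_algebra.
From mathcomp Require Import all_classical all_reals all_analysis.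
Set Implicit Arguments. Unset Strict Implicit. Unset Printing Implicit Defensive.
Import Order.TTheory GRing.Theory Num.Theory.
Import numFieldNormedType.Exports.
Local Open Scope classical_set_scope.
Local Open Scope ring_scope.

Section Drawings.
Variable R : realType.

Local Notation point := (R * R * R)%type.

Definition sphere : set point :=
  [set p | p.1.1 ^+ 2 + p.1.2 ^+ 2 + p.2 ^+ 2 = 1].

Definition I01 : set R := [set t | 0 <= t <= 1].
Definition I01o : set R := [set t | 0 < t < 1].
Definition square01 : set (R * R) := [set st | st.1 \in `[0, 1] /\ st.2 \in `[0, 1]].
Definition squareM : set (R * R) := [set xy | -1 <= xy.1 <= 1 /\ -1 <= xy.2 <= 1].

Record multigraph := MultiGraph {
  gV : finType;
  gE : finType;
  ends : gE -> gV * gV;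
  noloop : forall e, (ends e).1 != (ends e).2 }.

Definition adjacent (G : multigraph) : rel (gV G) :=
  fun u w => [exists e, (ends e == (u, w)) || (ends e == (w, u))].

Definition connected_graph (G : multigraph) : Prop :=
  forall u w : gV G, connect (@adjacent G) u w.

Record gmap (G : multigraph) := GMap {
  pos : gV G -> point;
  arc : gE G -> R -> point }.

Definition edge_set (G : multigraph) (D : gmap G) (e : gE G) : set point :=
  arc D e @` I01.
Definition edge_int (G : multigraph) (D : gmap G) (e : gE G) : set point :=
  arc D e @` I01o.

Definition drawing_set (G : multigraph) (D : gmap G) : set point :=
  range (pos D) `|` \bigcup_(e in [set: gE G]) edge_set D e.

(* p is a proper crossing of (the images of) e and f: a neighbourhood of p on
   the sphere is a topological disc (image of the square [-1,1]^2 under an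
   embedding phi with phi(0,0) = p) in which e and f are exactly the two
   coordinate axes. *)
Definition proper_crossing (G : multigraph) (D : gmap G) (e f : gE G) (p : point) :=
  exists phi : R * R -> point,
    [/\ {within squareM, continuous phi},
        (forall x y, x \in squareM -> y \in squareM -> phi x = phi y -> x = y),
        phi (0, 0) = p,
        phi @` squareM `<=` sphere &
      [/\ (exists U : set point, [/\ open U, U p & U `&` sphere `<=` phi @` squareM]),
        squareM `&` (phi @^-1` edge_set D e) = [set xy | -1 <= xy.1 <= 1 /\ xy.2 = 0]
      & squareM `&` (phi @^-1` edge_set D f) = [set xy | xy.1 = 0 /\ -1 <= xy.2 <= 1]]].

Definition is_drawing (G : multigraph) (D : gmap G) : Prop :=
  [/\ (forall v, sphere (pos D v)),
      injective (pos D),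
      (forall e, [/\ {within I01, continuous (arc D e)},
                    (forall s t, I01 s -> I01 t -> arc D e s = arc D e t -> s = t),
                    edge_set D e `<=` sphere,
                    arc D e 0 = pos D (ends e).1
                  & arc D e 1 = pos D (ends e).2]),
      (forall e v, ~ edge_int D e (pos D v)) &
     [/\
      (forall e f, e != f -> finite_set (edge_set D e `&` edge_set D f)),
      (forall e f p, e != f -> edge_int D e p -> edge_int D f p ->
                     proper_crossing D e f p)
    &
      (forall e f g p, e != f -> f != g -> e != g ->
         ~ [/\ edge_int D e p, edge_int D f p & edge_int D g p])]].

Definition free_set (G : multigraph) (D : gmap G) : set point :=
  sphere `\` drawing_set D.

Definition is_cell (G : multigraph) (D : gmap G) (C : set point) : Prop :=
  exists x, free_set D x /\ C = connected_component (free_set D) x.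

Definition access (G : multigraph) (D : gmap G) (C : set point)
    (v : gV G) (g : R -> point) : Prop :=
  [/\ {within I01, continuous g}, g 1 = pos D v
    & forall t, 0 <= t < 1 -> C (g t)].

Definition equiv_access (G : multigraph) (D : gmap G) (C : set point)
    (v : gV G) (g1 g2 : R -> point) : Prop :=
  exists H : R * R -> point,
    [/\ {within square01, continuous H},
        (forall s, 0 <= s <= 1 -> H (s, 1) = pos D v),
        (forall s t, 0 <= s <= 1 -> 0 <= t < 1 -> C (H (s, t))),
        (forall t, 0 <= t <= 1 -> H (0, t) = g1 t)
      & (forall t, 0 <= t <= 1 -> H (1, t) = g2 t)].

(* the cell C has at least k vertex-incidences (counted with repetitions):
   there are k pairwise inequivalent accesses from C to vertices *)
Definition at_least_incidences (G : multigraph) (D : gmap G) (C : set point)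
    (k : nat) : Prop :=
  exists a : 'I_k -> gV G * (R -> point),
    (forall i, access D C (a i).1 (a i).2) /\
    (forall i j, i != j ->
       ~ ((a i).1 = (a j).1 /\ equiv_access D C (a i).1 (a i).2 (a j).2)).

Definition kplus_real_face_drawing (k : nat) (G : multigraph) (D : gmap G) : Prop :=
  is_drawing D /\ forall C, is_cell D C -> at_least_incidences D C k.

End Drawings.

Definition kplus_real_face_graph (k : nat) (G : multigraph) : Prop :=
  exists (R : realType) (D : gmap R G), kplus_real_face_drawing k D.

(* Main.v *)
(* Every cell has at least k vertex-incidences, while at a vertex of degree d at
   most d pairwise inequivalent accesses can end; so N distinct cells give
   k N <= 2 m. With N = m - n + 2 cells this is the announced bound.

   Cells: after stereographic projection from a point off the drawing, an
   integral cycle of the graph has a winding number around every point off the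
   drawing, constant on cells. A real combination of cycles whose winding number
   is constant vanishes, because the variation of the argument along an arc jumps
   across each interior point of the arc. So m - n + 1 independent cycles
   separate at least m - n + 2 cells.

   Accesses: if the tails of d + 1 accesses start in different components of a
   disc around v minus the drawing, then along each of the d arcs at v their
   argument variations differ from local branches by integers, and a nontrivial
   integral combination has the same integer on all arcs. This combination is
   continuous at v, extends continuously over one of the components (Tietze), and
   yields a map from the plane to the circle with nonzero degree at infinity,
   which is impossible. Conversely, two accesses whose tails can be joined in
   every small disc minus the drawing are homotopic: as the drawing is connected,
   a component of such a set is simply connected, so the joining paths in a
   shrinking sequence of discs bound squares that glue to a homotopy. *)
From mathcomp Require Import all_boot all_order all_algebra.
From mathcomp Require Import all_classical all_reals all_analysis.
From mathcomp Require Import lra ring zify.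
Require Import Defs.
Set Implicit Arguments. Unset Strict Implicit. Unset Printing Implicit Defensive.
Import Order.TTheory GRing.Theory Num.Theory.
Import numFieldNormedType.Exports.
Local Open Scope classical_set_scope.
Local Open Scope ring_scope.

(** * Arguments modulo 2 pi *)

Section Angles.
Variable R : realType.
Implicit Types (a b c t : R).

(** No tameness of the arcs at a vertex is available, so all plane topology is drawn from one fact:
    a circle-valued map on the plane has degree 0 at infinity ([no_winding_extension]). Such maps
    are pasted along the boundary of an open set, where agreement modulo [tau] is enough, after a
    real branch has been extended inside by Tietze; this is how both [jump] and [too_many_accesses]
    reach a contradiction. Relations among cycles are sought over the reals, but the cycles
    themselves are integral, because integrality forces their winding into a discrete set. Simple
    connectedness is made combinatorial: paths become walks in a fine grid, and closed walks are
    contracted across grid squares, a winding argument showing that the square at an extremal corner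
    has no hole. The connectedness of the drawing is what lets every removed point escape from a
    small disc, so that the components have no holes. Paths and homotopies are glued by adding them
    with the common value subtracted, so that continuity of the result needs no case analysis. *)

Definition tau : R := pi *+ 2.

Lemma tau_gt0 : 0 < tau.
Proof. by rewrite /tau pmulrn_lgt0// pi_gt0. Qed.

Definition eqm a b := exists k : int, a = b + k%:~R * tau.

Lemma eqm_refl a : eqm a a.
Proof. by exists 0; rewrite mul0r addr0. Qed.

Lemma eqm_sym a b : eqm a b -> eqm b a.
Proof. by case=> k ->; exists (- k); rewrite intrN; ring. Qed.

Lemma eqm_trans b a c : eqm a b -> eqm b c -> eqm a c.
Proof. by case=> k -> [l ->]; exists (l + k); rewrite intrD; ring. Qed.

Lemma eqmD a b c d : eqm a b -> eqm c d -> eqm (a + c) (b + d).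
Proof. by case=> k -> [l ->]; exists (k + l); rewrite intrD; ring. Qed.

Lemma eqmN a b : eqm a b -> eqm (- a) (- b).
Proof. by case=> k ->; exists (- k); rewrite intrN; ring. Qed.

Lemma eqmB a b c d : eqm a b -> eqm c d -> eqm (a - c) (b - d).
Proof. by move=> h h'; apply: eqmD => //; apply: eqmN. Qed.

Lemma eqmZ (m : int) a b : eqm a b -> eqm (m%:~R * a) (m%:~R * b).
Proof. by case=> k ->; exists (m * k); rewrite intrM; ring. Qed.

Lemma eqm_sum (I : Type) (r : seq I) (P : pred I) (F G : I -> R) :
  (forall i, P i -> eqm (F i) (G i)) ->
  eqm (\sum_(i <- r | P i) F i) (\sum_(i <- r | P i) G i).
Proof.
move=> h; apply: (big_ind2 eqm) => //; first exact: eqm_refl.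
by move=> *; exact: eqmD.
Qed.

Lemma cosDnat (n : nat) a : cos (a + n%:R * tau) = cos a.
Proof. by rewrite mulr_natl; apply: periodicn; exact: cosD2pi. Qed.

Lemma sinDnat (n : nat) a : sin (a + n%:R * tau) = sin a.
Proof. by rewrite mulr_natl; apply: periodicn; exact: sinD2pi. Qed.

Lemma eqm_cos a b : eqm a b -> cos a = cos b.
Proof.
case=> k ->; case: k => n; first by rewrite cosDnat.
by rewrite -(cosDnat n.+1) NegzE intrN; congr cos; ring.
Qed.

Lemma eqm_sin a b : eqm a b -> sin a = sin b.
Proof.
case=> k ->; case: k => n; first by rewrite sinDnat.
by rewrite -(sinDnat n.+1) NegzE intrN; congr sin; ring.
Qed.

(** Subtracting [Num.floor (a / tau)] periods leaves [r] in [[0, tau[]; were [r] positive,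
    [sin (r / 2)] would be positive and the half-angle formula would give [cos r < 1]. *)
Lemma cos1_eqm a : cos a = 1 -> eqm a 0.
Proof.
move=> ca; have tg := tau_gt0; exists (Num.floor (a / tau)); rewrite add0r.
set k := Num.floor _; apply/eqP; rewrite -subr_eq0; apply/eqP.
have /andP[h1 h2] : k%:~R <= a / tau < (k + 1)%:~R by exact: floor_itv.
set r := a - _.
have r0 : 0 <= r by rewrite subr_ge0 -ler_pdivlMr.
have r1 : r < tau.
  by move: h2; rewrite ltr_pdivrMr// /r intrD; nra.
have cr : cos r = 1.
  by rewrite -ca; apply: eqm_cos; exists (- k); rewrite /r intrN; ring.
apply/eqP; case: (eqVneq r 0) => // rn0.
have rp : 0 < r by rewrite lt_neqAle eq_sym rn0.
have s0 : 0 < sin (r / 2).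
  by apply: sin_gt0_pi; apply/andP; split; [lra|move: r1; rewrite /tau mulr2n; lra].
have : cos r = 1 - 2 * sin (r / 2) ^+ 2.
  have -> : r = (r / 2) *+ 2 by rewrite -mulr_natr; lra.
  rewrite cos_mulr2n cos2sin2 -[X in sin X]/(_).
  have -> : (r / 2 *+ 2 / 2) = r / 2 by rewrite mulr2n; lra.
  by rewrite mulr2n; ring.
rewrite cr => h; have : sin (r / 2) ^+ 2 > 0 by rewrite exprn_gt0.
by lra.
Qed.

Lemma cossin_eqm a b : cos a = cos b -> sin a = sin b -> eqm a b.
Proof.
move=> h1 h2; have /cos1_eqm [k hk] : cos (a - b) = 1.
  by rewrite cosB h1 h2 -!expr2 cos2Dsin2.
by exists k; move: hk; rewrite add0r => <-; ring.
Qed.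

(** When [cos x > 0], this is the representative of [x] modulo [tau] in []-pi/2, pi/2[]. It depends
    on [x] only through [cos] and [sin], so it turns small circle-valued increments into continuous
    real ones. *)
Definition prin x : R := atan (sin x / cos x).

Lemma prin_eqm x : 0 < cos x -> eqm (prin x) x.
Proof.
move=> c0; have cn0 : cos x != 0 by rewrite gt_eqF.
have h : cos (prin x) = cos x.
  rewrite cos_atan.
  have -> : 1 + (sin x / cos x) ^+ 2 = (cos x)^-1 ^+ 2.
    by rewrite exprMn exprVn sin2cos2; field.
  by rewrite sqrtr_sqr ger0_norm ?invr_ge0 ?ltW// invrK.
apply: cossin_eqm => //.
have : tan (prin x) = sin x / cos x by rewrite /prin atanK.
by rewrite /tan h => /(congr1 (fun z => z * cos x)); rewrite !divfK.
Qed.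

(* A map to the circle is encoded by a real function of which only the class
   modulo [tau] matters; [ccontat f x] is its continuity at [x]. *)
Definition ccontat (T : topologicalType) (f : T -> R) (x : T) :=
  (cos (f z) @[z --> x] --> cos (f x)) /\ (sin (f z) @[z --> x] --> sin (f x)).

Section CCont.
Variable T : topologicalType.
Implicit Types (f g : T -> R).

Lemma ccontat_cont f (x : T) : {for x, continuous f} -> ccontat f x.
Proof.
move=> cf; split; apply: continuous_comp => //.
  exact: continuous_cos.
exact: continuous_sin.
Qed.

Lemma ccontatD f g (x : T) : ccontat f x -> ccontat g x -> ccontat (fun z => f z + g z) x.
Proof.
move=> [cf sf] [cg sg]; split.
  under eq_fun do rewrite cosD.
  by rewrite cosD; apply: cvgB; apply: cvgM.
under eq_fun do rewrite sinD.
by rewrite sinD; apply: cvgD; apply: cvgM.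
Qed.

Lemma ccontatN f (x : T) : ccontat f x -> ccontat (fun z => - f z) x.
Proof.
move=> [cf sf]; split.
  by under eq_fun do rewrite cosN; rewrite cosN.
by under eq_fun do rewrite sinN; rewrite sinN; apply: cvgN.
Qed.

Lemma ccontatB f g (x : T) : ccontat f x -> ccontat g x -> ccontat (fun z => f z - g z) x.
Proof. by move=> h h'; apply: ccontatD => //; exact: ccontatN. Qed.

Lemma ccontat_eqm f g (x : T) : (\near x, eqm (f x) (g x)) -> ccontat f x -> ccontat g x.
Proof.
move=> e [cf sf]; have e0 := nbhs_singleton e.
split.
  rewrite -(eqm_cos e0); apply: cvg_trans cf; apply: near_eq_cvg.
  by apply: filterS e => z /eqm_cos /= ->.
rewrite -(eqm_sin e0); apply: cvg_trans sf; apply: near_eq_cvg.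
by apply: filterS e => z /eqm_sin /= ->.
Qed.

Lemma ccontat_sum (I : Type) (r : seq I) (P : pred I) (F : I -> T -> R) (x : T) :
  (forall i, P i -> ccontat (F i) x) ->
  ccontat (fun z => \sum_(i <- r | P i) F i z) x.
Proof.
move=> h; elim: r => [|i r IH].
  apply: (@ccontat_eqm (fun=> 0)).
    by near=> z; rewrite big_nil; exact: eqm_refl.
  by apply: ccontat_cont; exact: cvg_cst.
case: (boolP (P i)) => Pi.
  apply: (@ccontat_eqm (fun z => F i z + \sum_(i <- r | P i) F i z)).
    by near=> z; rewrite big_cons Pi; exact: eqm_refl.
  by apply: ccontatD => //; exact: h.
apply: ccontat_eqm IH.
by near=> z; rewrite big_cons (negbTE Pi); exact: eqm_refl.
Unshelve. all: by end_near. Qed.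

Lemma ccontatMn (n : nat) f x : ccontat f x -> ccontat (fun z => n%:R * f z) x.
Proof.
move=> h; apply: (@ccontat_eqm (fun z => \sum_(i <- iota 0 n) f z)).
  near=> z; rewrite big_const_seq count_predT size_iota iter_addr_0 mulr_natl.
  exact: eqm_refl.
exact: ccontat_sum.
Unshelve. all: by end_near. Qed.

Lemma ccontatZ (m : int) f x : ccontat f x -> ccontat (fun z => m%:~R * f z) x.
Proof.
move=> h; case: m => n; first exact: ccontatMn.
apply: (@ccontat_eqm (fun z => - (n.+1%:R * f z))).
  by near=> z; rewrite NegzE intrN mulNr; exact: eqm_refl.
exact/ccontatN/ccontatMn.
Unshelve. all: by end_near. Qed.

Lemma prin_continuous f (x : T) : ccontat f x -> 0 < cos (f x) ->
  {for x, continuous (prin \o f)}.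
Proof.
move=> [cf sf] c0; apply: (@continuous_comp _ _ _ (fun z => sin (f z) / cos (f z)) atan).
  rewrite /continuous_at; apply: cvgM => //; apply: cvgV => //.
  by rewrite gt_eqF.
exact: continuous_atan.
Qed.

(** Two distinct values would differ by at least [tau]; the image is an interval, so it would also
    contain a point half a period above a multiple of [tau], which is no multiple of [tau]. *)
Lemma eqm_connected f (A : set T) : connected A -> {within A, continuous f} ->
  (forall x, A x -> eqm (f x) 0) -> forall x y, A x -> A y -> f x = f y.
Proof.
move=> cA cf h.
have ci : connected (f @` A) by exact: connected_continuous_connected.
have := ci; rewrite connected_intervalP => itv x y Ax Ay.
have tg := tau_gt0.
wlog lt : x y Ax Ay / f x < f y.
  move=> H; case: (ltgtP (f x) (f y)) => // hh; first exact: H.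
  by symmetry; exact: H.
exfalso; have [k] := h _ Ax; have [l] := h _ Ay; rewrite !add0r => fy fx.
have kl : (k + 1)%:~R <= l%:~R :> R.
  rewrite ler_int lezD1 -(ltr_int R) -(ltr_pM2r tg); lra.
have tl : tau <= f y - f x by rewrite fx fy; move: kl; rewrite intrD; nra.
have : (f @` A) (f x + tau / 2).
  apply: (itv (f x) (f y)); [by exists x|by exists y|].
  by apply/andP; split; lra.
case=> z Az fz; have [j] := h _ Az; rewrite add0r fz fx => e.
have : (j - k)%:~R * 2 = 1 :> R.
  rewrite intrB; apply: (mulIf (x := tau)); first by rewrite gt_eqF.
  by rewrite mul1r mulrAC mulrBl -e; lra.
move=> e2; have : ((j - k) * 2)%:~R = 1%:~R :> R by rewrite intrM.
move/eqP; rewrite eqr_int => /eqP e3.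
by have := congr1 (fun z : int => (z %% 2)%Z) e3; rewrite modzMl.
Qed.

End CCont.
End Angles.

(** * Lifts of circle-valued maps and the degree at infinity *)

Section Winding.
Variable R : realType.
Local Notation plane := (R * R)%type.

Lemma ccontat_comp (S T : topologicalType) (g : S -> T) (f : T -> R) (x : S) :
  {for x, continuous g} -> ccontat f (g x) -> ccontat (f \o g) x.
Proof.
move=> cg [cf sf]; split.
  exact: (@continuous_comp _ _ _ g (cos \o f)).
exact: (@continuous_comp _ _ _ g (sin \o f)).
Qed.

(** A form of the Lebesgue number lemma: with half of the local radius, a point near [x] and a point
    near that one both lie in the ball where the local hypothesis at [x] applies. *)
Lemma compact_unif (T : pseudoMetricType R) (K : set T) (P : T -> T -> Prop) :
  compact K ->
  (forall x, K x -> exists2 e : R, 0 < e &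
     forall y z, K y -> K z -> ball x e y -> ball x e z -> P y z) ->
  exists2 e : R, 0 < e & forall y z, K y -> K z -> ball y e z -> P y z.
Proof.
move=> /compact_near_coveringP cK h.
have := @cK R 0^'+ (fun e y => forall z, K z -> ball y e z -> P y z \/ ~ K y) _.
case.
  move=> x Kx; have [e e0 he] := h x Kx.
  exists (ball x (e / 2), [set d : R | 0 < d < e / 2]).
    split => /=; first by apply: nbhsx_ballx; rewrite divr_gt0.
    near=> d; apply/andP; split; near: d.
      exact: nbhs_right_gt.
    by apply: nbhs_right_lt; rewrite divr_gt0.
  move=> [y d] [/= xy /andP[d0 dl]] z Kz yz.
  case: (pselect (K y)) => Ky; [left|by right].
  apply: he => //.
    by apply: le_ball xy; rewrite ler_pdivrMr// ler_pMr// ler1n.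
  by rewrite (splitr e); apply: ball_triangle xy _; apply: le_ball yz; apply: ltW.
move=> e /= e0 he.
exists (e / 2); first by rewrite divr_gt0.
move=> y z Ky Kz yz.
have e20 : 0 < e / 2 by rewrite divr_gt0.
have eb : ball_ [eta Num.Def.normr] 0 e (e / 2).
  by rewrite /= sub0r normrN gtr0_norm// ltr_pdivrMr// ltr_pMr// ltr1n.
by have [] := he (e / 2) eb e20 y Ky z Kz yz.
Unshelve. all: by end_near. Qed.

(** Uniform continuity in the form needed for lifting: close points have values less than a quarter
    turn apart, so that [prin] applies to the difference. *)
Lemma ccont_unif (T : pseudoMetricType R) (K : set T) (f : T -> R) :
  compact K -> (forall x, K x -> ccontat f x) ->
  exists2 e : R, 0 < e & forall y z, K y -> K z -> ball y e z ->
    0 < cos (f z - f y).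
Proof.
move=> cK h; apply: compact_unif cK _ => x Kx; have [cf sf] := h x Kx.
(* With cosines and sines within 1/8 of those at [x], the two linear error terms are at least -1/4
   each and the two quadratic ones at least -1/64 each, which leaves a positive rest of 1. *)
have e8 : 0 < 8^-1 :> R by rewrite invr_gt0.
have /nbhs_ballP[d /= d0 hd] : nbhs x
    [set y | ball (cos (f x)) 8^-1 (cos (f y)) /\ ball (sin (f x)) 8^-1 (sin (f y))].
  apply: filterI; [apply: (cf)|apply: (sf)]; exact: nbhsx_ballx.
exists d => // y z _ _ /hd /= [] h1 h2 /hd /= [] h3 h4.
rewrite cosB.
have /andP[c1 c2] : -1 <= cos (f x) <= 1 by rewrite cos_geN1 cos_le1.
have /andP[s1 s2] : -1 <= sin (f x) <= 1 by rewrite sin_geN1 sin_le1.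
have E := cos2Dsin2 (f x).
move: h1 h2 h3 h4; rewrite /ball /=.
rewrite -![`|cos (f x) - _|]distrC -![`|sin (f x) - _|]distrC.
move=> /ltW kb /ltW kb' /ltW ka /ltW ka'.
set c := cos (f x) in E c1 c2 ka kb *; set s := sin (f x) in E s1 s2 ka' kb' *.
set a := cos (f z) - c in ka; set b := cos (f y) - c in kb.
set a' := sin (f z) - s in ka'; set b' := sin (f y) - s in kb'.
have -> : cos (f z) * cos (f y) + sin (f z) * sin (f y) =
  c ^+ 2 + s ^+ 2 + c * (a + b) + s * (a' + b') + a * b + a' * b'.
  by rewrite /a /b /a' /b'; ring.
have bm (u v m n : R) : `|u| <= m -> `|v| <= n -> - (m * n) <= u * v.
  move=> hu hv; have : `|u * v| <= m * n by rewrite normrM ler_pM.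
  by rewrite ler_norml => /andP[].
have m1 : - (1 * (8^-1 + 8^-1)) <= c * (a + b).
  apply: bm; first by rewrite ler_norml c1.
  by apply: le_trans (ler_normD _ _) _; apply: lerD.
have m2 : - (1 * (8^-1 + 8^-1)) <= s * (a' + b').
  apply: bm; first by rewrite ler_norml s1.
  by apply: le_trans (ler_normD _ _) _; apply: lerD.
have m3 := bm _ _ _ _ ka kb; have m4 := bm _ _ _ _ ka' kb'.
rewrite E; clear - m1 m2 m3 m4; lra.
Qed.

Lemma itv01_compact : compact [set t : R | 0 <= t <= 1].
Proof. by rewrite -set_itvcc; exact: segment_compact. Qed.

Lemma itv01_connected : connected [set t : R | 0 <= t <= 1].
Proof. by rewrite -set_itvcc; exact: segment_connected. Qed.

Definition clamp (a b t : R) : R := Num.max a (Num.min b t).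

Lemma clamp_continuous a b : continuous (clamp a b).
Proof.
move=> t; apply: (@continuous_comp _ _ _ (fun t => Num.min b t) (fun s => Num.max a s)).
  by apply: (@continuous_min _ _ (fun=> b) id) => //; exact: cvg_cst.
by apply: (@continuous_max _ _ (fun=> a) id) => //; exact: cvg_cst.
Qed.

Lemma clamp_itv a b t : a <= b -> a <= clamp a b t <= b.
Proof. by move=> ab; rewrite /clamp le_max lexx /= ge_max ab ge_min lexx. Qed.

Lemma clamp_id a b t : a <= t <= b -> clamp a b t = t.
Proof. by move=> /andP[at_ tb]; rewrite /clamp min_r// max_r. Qed.

Lemma clamp_l a b t : t <= a -> clamp a b t = a.
Proof. by move=> ta; rewrite /clamp max_l// ge_min ta orbT. Qed.

Lemma clamp_r a b t : a <= b -> b <= t -> clamp a b t = b.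
Proof. by move=> ab bt; rewrite /clamp min_l// max_r. Qed.

Lemma small_frac (e : R) : 0 < e -> exists N : nat, N.+1%:R^-1 < e.
Proof.
move=> e0; have [N _ /(_ N (leqnn _)) h] := near_infty_natSinv_lt (PosNum e0).
by exists N.
Qed.

Lemma sum_cont (T : topologicalType) (x : T) (I : Type) (r : seq I) (P : pred I) (f : I -> T -> R) :
  (forall i, P i -> {for x, continuous (f i)}) ->
  {for x, continuous (fun z => \sum_(i <- r | P i) f i z)}.
Proof.
move=> h; elim: r => [|i r IH].
  have -> : (fun z => \sum_(i <- [::] | P i) f i z) = (fun=> 0).
    by apply/funext => z; rewrite big_nil.
  exact: cvg_cst.
have -> : (fun z => \sum_(j <- i :: r | P j) f j z) =
    (fun z => (if P i then f i z else 0) + \sum_(j <- r | P j) f j z).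
  by apply/funext => z; rewrite big_cons; case: ifP => // _; rewrite add0r.
apply: cvgD => //; case: ifP => Pi; [exact: h|exact: cvg_cst].
Qed.

Definition lifts (f th : R -> R) :=
  {within [set t | 0 <= t <= 1], continuous th} /\
  forall t, 0 <= t <= 1 -> eqm (th t) (f t).

(** The unit interval is cut into pieces on which [f] turns by less than a quarter; the lift adds up
    the principal values of the increments. *)
Lemma lift_exists (f : R -> R) : (forall t, ccontat f t) -> exists th, lifts f th.
Proof.
move=> cf; have [e e0 he] := ccont_unif itv01_compact (fun t _ => cf t).
have [N hN] := small_frac e0.
pose d : R := N.+1%:R^-1.
have d0 : 0 < d by rewrite invr_gt0.
pose c i t := clamp (i%:R * d) (i.+1%:R * d) t.
have cle (i : nat) : i%:R * d <= i.+1%:R * d by rewrite ler_pM2r// ler_nat.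
have dN : N.+1%:R * d = 1 by rewrite mulfV.
have c01 i t : (i < N.+1)%N -> 0 <= c i t <= 1.
  move=> iN; have /andP[h1 h2] := clamp_itv t (cle i).
  apply/andP; split; first by apply: le_trans h1; rewrite mulr_ge0// ltW.
  by apply: le_trans h2 _; rewrite -[leRHS]dN ler_pM2r ?ler_nat.
have i01 (i : nat) : (i < N.+1)%N -> 0 <= i%:R * d <= 1.
  move=> iN; apply/andP; split; first by rewrite mulr_ge0// ltW.
  by rewrite -[leRHS]dN ler_pM2r ?ler_nat// ltnW.
have cos0 i t : (i < N.+1)%N -> 0 < cos (f (c i t) - f (i%:R * d)).
  move=> iN; apply: he; [exact: i01|exact: c01|].
  have /andP[h1 h2] := clamp_itv t (cle i).
  rewrite /ball /= distrC ger0_norm ?subr_ge0//.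
  apply: le_lt_trans hN; rewrite lerBlDr; apply: le_trans h2 _.
  by rewrite -natr1 mulrDl mul1r addrC.
(* The clamp freezes the [i]-th summand outside the [i]-th piece; modulo [tau] the sum telescopes to
   [f t - f 0]. *)
exists (fun t => f 0 + \sum_(i < N.+1) prin (f (c i t) - f (i%:R * d))); split.
  apply: continuous_subspaceT => t.
  apply: cvgD; first exact: cvg_cst.
  apply: (@sum_cont _ _ _ _ _ (fun (i : 'I_N.+1) t => prin (f (c i t) - f (i%:R * d)))) => i _.
  apply: (@prin_continuous _ _ (fun t => f (c i t) - f (i%:R * d))); last exact: cos0.
  apply: ccontatB; last by apply: ccontat_cont; exact: cvg_cst.
  by apply: (@ccontat_comp _ _ (c i) f) => //; exact: clamp_continuous.
move=> t /andP[t0 t1].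
apply: (@eqm_trans _ (f 0 + \sum_(i < N.+1) (f (c i t) - f (i%:R * d)))).
  apply: eqmD; first exact: eqm_refl.
  by apply: eqm_sum => i _; apply: prin_eqm; exact: cos0.
suff -> : \sum_(i < N.+1) (f (c i t) - f (i%:R * d)) = f t - f 0.
  by rewrite addrC subrK; exact: eqm_refl.
pose g (i : nat) := f (Num.min (i%:R * d) t).
rewrite (eq_bigr (fun i : 'I_N.+1 => g i.+1 - g i)).
  rewrite -(big_mkord xpredT (fun i => g i.+1 - g i)) telescope_sumr//.
  by rewrite /g dN min_r// mul0r min_l.
move=> i _; rewrite /g /c; have [it|ti] := leP (i%:R * d) t.
  congr (f _ - _); rewrite /clamp max_r// le_min it andbT; exact: cle.
rewrite clamp_l ?ltW// subrr min_r ?subrr//.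
by apply: ltW; apply: lt_le_trans ti _; exact: cle.
Qed.

(** Two lifts differ by a constant, so the increment does not depend on the lift ([VarE]); if there
    is no lift, the value is arbitrary. *)
Definition Var (f : R -> R) : R :=
  get [set v | exists2 th, lifts f th & v = th 1 - th 0].

Lemma VarE f th : lifts f th -> Var f = th 1 - th 0.
Proof.
move=> lth; rewrite /Var; case: xgetP; last first.
  by move=> /(_ (th 1 - th 0)) []; exists th.
move=> v _ [th' lth' ->].
have : th' 1 - th 1 = th' 0 - th 0.
  apply: (@eqm_connected _ _ (fun t => th' t - th t) _ itv01_connected).
  - by move=> t; apply: cvgB; [exact: lth'.1|exact: lth.1].
  - move=> t t01; rewrite -(subrr (f t)); apply: eqmB; [exact: lth'.2|exact: lth.2].
  - by rewrite /= ler01 lexx.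
  - by rewrite /= ler01 lexx.
by move=> /=; lra.
Qed.

Lemma Var_eqm f : (forall t, ccontat f t) -> eqm (Var f) (f 1 - f 0).
Proof.
move=> cf; have [th lth] := lift_exists cf; rewrite (VarE lth).
by apply: eqmB; apply: lth.2; rewrite ler01 lexx.
Qed.

(** If [th] lifts [f] and [g] stays within a quarter turn of [f], then [th + prin (g - f)] lifts
    [g]. *)
Lemma Var_pert (f g : R -> R) : (forall t, ccontat f t) -> (forall t, ccontat g t) ->
  (forall t, 0 <= t <= 1 -> 0 < cos (g t - f t)) ->
  Var g = Var f + (prin (g 1 - f 1) - prin (g 0 - f 0)).
Proof.
move=> cf cg h; have [th lth] := lift_exists cf.
rewrite (VarE lth) (@VarE g (fun t => th t + prin (g t - f t))); first by lra.
split.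
  move=> t; apply: cvgD; first exact: lth.1.
  move: t; apply: continuous_in_subspaceT => t; rewrite inE => t01.
  apply: (@prin_continuous _ _ (fun t => g t - f t)); last exact: h.
  exact: ccontatB.
move=> t t01; have E : g t = f t + (g t - f t) by lra.
rewrite {2}E; by apply: eqmD; [exact: lth.2|apply: prin_eqm; exact: h].
Qed.

Definition dot (u v : plane) : R := u.1 * v.1 + u.2 * v.2.
Definition nrm (u : plane) : R := Num.sqrt (dot u u).

Lemma dot_gt0 u : u != 0 -> 0 < dot u u.
Proof.
case: u => a b n0; rewrite /dot /= -!expr2.
have [a0|a0] := eqVneq a 0; last by rewrite ltr_wpDr ?sqr_ge0// exprn_even_gt0.
have [b0|b0] := eqVneq b 0; last by rewrite ltr_wpDl ?sqr_ge0// exprn_even_gt0.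
by move: n0; rewrite a0 b0 eqxx.
Qed.

Lemma nrm_gt0 u : u != 0 -> 0 < nrm u.
Proof. by move=> /dot_gt0 h; rewrite sqrtr_gt0. Qed.

Lemma arg_exists u : exists a : R, u != 0 -> cos a = u.1 / nrm u /\ sin a = u.2 / nrm u.
Proof.
have [->|u0] := eqVneq u 0; first by exists 0.
have n0 := nrm_gt0 u0.
have E : (u.1 / nrm u) ^+ 2 + (u.2 / nrm u) ^+ 2 = 1.
  rewrite !exprMn -mulrDl exprVn /nrm sqr_sqrtr ?ltW ?dot_gt0//.
  by rewrite /dot -!expr2 mulfV// gt_eqF// !expr2 dot_gt0.
have c1 : -1 <= u.1 / nrm u <= 1.
  by rewrite -ler_norml -(@expr_le1 _ 2)// real_normK ?num_real// -E lerDl sqr_ge0.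
have s1 : Num.sqrt (1 - (u.1 / nrm u) ^+ 2) = `|u.2 / nrm u|.
  by rewrite -E addrC addKr sqrtr_sqr.
have [u20|u20] := leP 0 u.2.
  exists (acos (u.1 / nrm u)) => _; rewrite acosK; last by rewrite in_itv.
  by rewrite sin_acos// s1 ger0_norm// divr_ge0// ltW.
exists (- acos (u.1 / nrm u)) => _; rewrite cosN sinN acosK; last by rewrite in_itv.
rewrite sin_acos// s1 ler0_norm ?opprK//.
by rewrite pmulr_lle0 ?invr_gt0// ltW.
Qed.

(** Some polar angle, on no particular branch; nothing is claimed at 0. *)
Definition arg u : R := proj1_sig (cid (arg_exists u)).

Lemma cos_arg u : u != 0 -> cos (arg u) = u.1 / nrm u.
Proof. by rewrite /arg; case: cid => a /= h /h []. Qed.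

Lemma sin_arg u : u != 0 -> sin (arg u) = u.2 / nrm u.
Proof. by rewrite /arg; case: cid => a /= h /h []. Qed.

Lemma arg_eqm u (r a : R) : 0 < r -> u = (r * cos a, r * sin a) -> eqm (arg u) a.
Proof.
move=> r0 ->.
have n0 : (r * cos a, r * sin a) != 0 :> plane.
  apply/eqP => -[h1 h2]; have := cos2Dsin2 a.
  move: h1 h2 => /eqP; rewrite mulf_eq0 gt_eqF//= => /eqP-> /eqP.
  by rewrite mulf_eq0 gt_eqF//= => /eqP->; lra.
have E : nrm (r * cos a, r * sin a) = r.
  rewrite /nrm /dot /= (_ : _ + _ = r ^+ 2 * (cos a ^+ 2 + sin a ^+ 2)); last by ring.
  by rewrite cos2Dsin2 mulr1 sqrtr_sqr gtr0_norm.
apply: cossin_eqm; rewrite ?cos_arg ?sin_arg// E /=.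
  by rewrite mulrC mulKf// gt_eqF.
by rewrite mulrC mulKf// gt_eqF.
Qed.

Lemma nrm_cvg (T : topologicalType) (F : set_system T) (f : T -> plane) u :
  Filter F -> f @ F --> u -> (nrm (f z) @[z --> F] --> nrm u).
Proof.
move=> FF fu; have f1 : ((f z).1 @[z --> F] --> u.1).
  by apply: cvg_comp fu _; exact: cvg_fst.
have f2 : ((f z).2 @[z --> F] --> u.2) by apply: cvg_comp fu _; exact: cvg_snd.
apply: (@cvg_comp _ _ _ (fun z => dot (f z) (f z)) Num.sqrt _ (nbhs (dot u u))).
  by apply: cvgD; apply: cvgM.
exact: sqrt_continuous.
Qed.

Lemma arg_ccontat (T : topologicalType) (f : T -> plane) x :
  {for x, continuous f} -> f x != 0 -> ccontat (arg \o f) x.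
Proof.
move=> cf fx0.
have n0 := nrm_gt0 fx0.
have nr : nrm (f z) @[z --> x] --> nrm (f x) by apply: nrm_cvg.
have nz : \near x, f x != 0.
  have : \near x, 0 < nrm (f x).
    by apply: (cvgr_gt (nrm (f x)) nr); exact: n0.
  apply: filterS => z; apply: contraTneq => ->.
  by rewrite /nrm /dot /= mulr0 addr0 sqrtr0 ltxx.
split => /=.
  rewrite cos_arg//; apply: (@cvg_trans _ ((f z).1 / nrm (f z) @[z --> x])).
    by apply: near_eq_cvg; apply: filterS nz => z /cos_arg ->.
  apply: cvgM; first by apply: (cvg_comp _ _ cf); exact: cvg_fst.
  by apply: cvgV => //; rewrite gt_eqF.
rewrite sin_arg//; apply: (@cvg_trans _ ((f z).2 / nrm (f z) @[z --> x])).
  by apply: near_eq_cvg; apply: filterS nz => z /sin_arg ->.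
apply: cvgM; first by apply: (cvg_comp _ _ cf); exact: cvg_snd.
by apply: cvgV => //; rewrite gt_eqF.
Qed.

Lemma cos_argB u v : u != 0 -> v != 0 ->
  cos (arg u - arg v) = dot u v / (nrm u * nrm v).
Proof.
move=> u0 v0; rewrite cosB !cos_arg// !sin_arg// /dot.
by field; rewrite !gt_eqF ?nrm_gt0.
Qed.

Lemma cos_argB_gt0 u v : 0 < dot u v -> 0 < cos (arg u - arg v).
Proof.
move=> duv; have u0 : u != 0.
  by apply: contraTneq duv => ->; rewrite /dot !mul0r addr0 ltxx.
have v0 : v != 0.
  by apply: contraTneq duv => ->; rewrite /dot !mulr0 addr0 ltxx.
by rewrite cos_argB// divr_gt0// mulr_gt0// nrm_gt0.
Qed.

Lemma pair_cont (T U V : topologicalType) (f : T -> U) (g : T -> V) x :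
  {for x, continuous f} -> {for x, continuous g} ->
  {for x, continuous (fun z => (f z, g z))}.
Proof. by move=> cf cg; exact: cvg_pair. Qed.

Definition circ (b : plane) (r t : R) : plane :=
  (b.1 + r * cos (tau R * t), b.2 + r * sin (tau R * t)).

Lemma circ_cont b r : continuous (circ b r).
Proof.
move=> t; rewrite /circ; apply: (@pair_cont _ _ _ (fun t => b.1 + r * cos (tau R * t)) (fun t => b.2 + r * sin (tau R * t))); apply: cvgD; try exact: cvg_cst.
  apply: cvgM; first exact: cvg_cst.
  apply: continuous_comp; last exact: continuous_cos.
  by apply: cvgM; [exact: cvg_cst|exact: cvg_id].
apply: cvgM; first exact: cvg_cst.
apply: continuous_comp; last exact: continuous_sin.
by apply: cvgM; [exact: cvg_cst|exact: cvg_id].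
Qed.

Lemma norm_mul_le (r c : R) : `|c| <= 1 -> `|r * c| <= `|r|.
Proof. by move=> h; rewrite normrM ler_piMr. Qed.

(* Shrinking the circle of radius 2rho to a point preserves the winding number of f. *)
Lemma no_winding_extension (f : plane -> R) (b : plane) (m : int) (rho : R) :
  (forall w, ccontat f w) -> 0 < rho ->
  (forall w, rho <= `|w.1 - b.1| \/ rho <= `|w.2 - b.2| ->
     eqm (f w) (m%:~R * arg (w - b))) -> m = 0.
Proof.
move=> cf r0 hf.
(* At every angle the cosine or the sine has absolute value at least 1/2, so each point of the
   circle of radius [2 * rho] lies in the region where [f] is prescribed. *)
pose M := 2 * rho; have M0 : 0 < M by rewrite mulr_gt0.
pose K : set plane := `[b.1 - M, b.1 + M]%classic `*` `[b.2 - M, b.2 + M]%classic.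
have cK : compact K by apply: compact_setX; exact: segment_compact.
have [e e0 he] := ccont_unif cK (fun w _ => cf w).
have Kc r t : 0 <= r <= M -> K (circ b r t).
  move=> /andP[r1 r2]; split; rewrite /= in_itv /=.
    have := norm_mul_le r (cos_max (tau R * t)).
    by rewrite (ger0_norm r1) ler_norml => /andP[? ?]; apply/andP; split; lra.
  have := norm_mul_le r (sin_max (tau R * t)).
  by rewrite (ger0_norm r1) ler_norml => /andP[? ?]; apply/andP; split; lra.
have cc r t : ccontat (f \o circ b r) t.
  by apply: ccontat_comp => //; exact: circ_cont.
have per r : circ b r 1 = circ b r 0.
  by rewrite /circ mulr1 mulr0 /tau cos2pi sin2pi cos0 sin0.
have step r r' : 0 <= r <= M -> 0 <= r' <= M -> `|r - r'| < e ->
    Var (f \o circ b r) = Var (f \o circ b r').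
  move=> h h' d; rewrite (Var_pert (cc r) (cc r')).
    by rewrite /= !per subrr addr0.
  move=> t _; apply: he; [exact: Kc|exact: Kc|].
  split; rewrite /ball /= opprD addrACA subrr add0r -mulrBl.
    by apply: le_lt_trans d; apply: norm_mul_le; exact: cos_max.
  by apply: le_lt_trans d; apply: norm_mul_le; exact: sin_max.
have [N hN] := small_frac (divr_gt0 e0 M0).
pose d := M * N.+1%:R^-1.
have d0 : 0 < d by rewrite mulr_gt0// invr_gt0.
have dM : N.+1%:R * d = M by rewrite /d mulrCA mulfV ?mulr1.
have de : d < e by rewrite /d mulrC -ltr_pdivlMr.
have kM k : (k <= N.+1)%N -> 0 <= k%:R * d <= M.
  move=> kN; apply/andP; split; first by rewrite mulr_ge0// ltW.
  by rewrite -[X in _ <= X]dM ler_pM2r// ler_nat.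
have all_eq k : (k <= N.+1)%N -> Var (f \o circ b (k%:R * d)) = Var (f \o circ b 0).
  elim: k => [|k IH] kN; first by rewrite mul0r.
  rewrite -IH ?(ltnW kN)//; apply: step.
  - exact: kM.
  - by apply: kM; exact: ltnW.
  - by rewrite -natr1 mulrDl mul1r addrC addKr gtr0_norm.
have V0 : Var (f \o circ b 0) = 0.
  rewrite (@VarE _ (fun=> f b)); first by rewrite subrr.
  split; first by move=> t; exact: cvg_cst.
  move=> t _; rewrite /circ /= !mul0r !addr0 -surjective_pairing; exact: eqm_refl.
have VM : Var (f \o circ b M) = m%:~R * tau R.
  rewrite (@VarE _ (fun t => m%:~R * (tau R * t))); first by rewrite mulr0 mulr0 subr0 mulr1.
  split.
    apply: continuous_subspaceT => t; apply: cvgM; first exact: cvg_cst.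
    by apply: cvgM; [exact: cvg_cst|exact: cvg_id].
  move=> t _; apply: eqm_sym; set a := tau R * t.
  apply: (@eqm_trans _ (m%:~R * arg (circ b M t - b))).
    apply: hf; rewrite /circ /= -/a (addrC b.1) addrK (addrC b.2) addrK !(normrM M) (gtr0_norm M0).
    have := cos2Dsin2 a; rewrite -[cos a ^+ 2]real_normK ?num_real//.
    rewrite -[sin a ^+ 2]real_normK ?num_real// /M => E.
    have [h|h] := leP (2^-1) `|cos a|; [left; nra|right].
    have : 2^-1 <= `|sin a|; last by nra.
    rewrite leNgt; apply/negP => h2.
    have := normr_ge0 (sin a); have := normr_ge0 (cos a); nra.
  apply: eqmZ; apply: (arg_eqm M0).
  rewrite /circ -/a; congr pair => /=; lra.
move: (all_eq _ (leqnn _)); rewrite dM V0 VM => /eqP.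
by rewrite mulf_eq0 (gt_eqF (tau_gt0 R)) orbF intr_eq0 => /eqP.
Qed.

End Winding.

(** * Arcs in the plane *)

Section Separation.
Variable R : realType.
Local Notation plane := (R * R)%type.
Local Notation I01 := [set t : R | 0 <= t <= 1].

Definition trk (T : Type) (g : R -> T) : set T := g @` I01.

Lemma trk0 T (g : R -> T) : trk g (g 0).
Proof. by exists 0 => //=; rewrite lexx ler01. Qed.

Lemma trk1 T (g : R -> T) : trk g (g 1).
Proof. by exists 1 => //=; rewrite lexx ler01. Qed.

Lemma segment_image_compact (T : topologicalType) (g : R -> T) a b :
  continuous g -> compact (g @` [set t | a <= t <= b]).
Proof.
move=> cg; apply: continuous_compact; first exact: continuous_subspaceT.
by rewrite -set_itvcc; exact: segment_compact.
Qed.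

Lemma trk_compact (T : topologicalType) (g : R -> T) : continuous g -> compact (trk g).
Proof. exact: segment_image_compact. Qed.

Lemma plane_compact_closed (K : set plane) : compact K -> closed K.
Proof. by apply: compact_closed; exact: norm_hausdorff. Qed.

Lemma trk_closed (g : R -> plane) : continuous g -> closed (trk g).
Proof. by move=> /trk_compact /plane_compact_closed. Qed.

Lemma closed_dist (K : set plane) w : closed K -> ~ K w ->
  exists2 e : R, 0 < e & forall z, ball w e z -> ~ K z.
Proof.
move=> cK Kw; have : nbhs w (~` K).
  by apply: open_nbhs_nbhs; split => //; exact: closed_openC.
by move=> /nbhs_ballP[e /= e0 h]; exists e.
Qed.

Lemma planeballE (w : plane) e z :
  ball w e z <-> `|w.1 - z.1| < e /\ `|w.2 - z.2| < e.
Proof. by []. Qed.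

Lemma clamp01_in t : I01 (clamp 0 1 t).
Proof. exact: (clamp_itv t ler01). Qed.

Lemma near_cont (T U : topologicalType) (f g : T -> U) (x : T) :
  (\near x, f x = g x) -> {for x, continuous f} -> {for x, continuous g}.
Proof.
move=> fg cf; have E := nbhs_singleton fg.
have h : g @ x --> f x by exact: cvg_trans (near_eq_cvg fg) cf.
by rewrite E in h.
Qed.

Lemma arg_sub_ccontat (z w : plane) : z <> w -> ccontat (fun x : plane => arg (z - x)) w.
Proof.
move=> zw; apply: (@arg_ccontat _ _ (fun x : plane => z - x)).
  by apply: cvgB; [exact: cvg_cst|exact: cvg_id].
by apply/eqP => /subr0_eq.
Qed.

(* Total variation of the argument seen from [w] along the path [g]. *)
Definition ang (g : R -> plane) (w : plane) : R :=
  Var (fun t => arg (g (clamp 0 1 t) - w)).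

Section Ang.
Variable g : R -> plane.
Hypothesis cg : continuous g.

Lemma clamped_cont : continuous (g \o clamp 0 1).
Proof. by move=> t; apply: continuous_comp; [exact: clamp_continuous|exact: cg]. Qed.

Lemma ang_ccontat w t : ~ trk g w -> ccontat (fun t => arg (g (clamp 0 1 t) - w)) t.
Proof.
move=> gw; apply: (@arg_ccontat _ _ (fun t => g (clamp 0 1 t) - w)).
  by apply: cvgB; [exact: clamped_cont|exact: cvg_cst].
apply/eqP => /subr0_eq h; apply: gw; exists (clamp 0 1 t) => //; exact: clamp01_in.
Qed.

Lemma ang_eqm w : ~ trk g w -> eqm (ang g w) (arg (g 1 - w) - arg (g 0 - w)).
Proof.
move=> gw; apply: eqm_trans (Var_eqm (fun t => @ang_ccontat w t gw)) _.
by rewrite !clamp_id ?lexx ?ler01//; exact: eqm_refl.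
Qed.

(** The path keeps some distance [e] from [w]; displacing [w] by less than [e / 4] turns each vector
    [g t - w] by less than a right angle. By [Var_pert] the variation then changes only by the
    endpoint corrections [D], which are continuous. *)
Lemma ang_cont w : ~ trk g w -> {for w, continuous (ang g)}.
Proof.
move=> gw; have [e e0 he] := closed_dist (trk_closed cg) gw.
have e40 : 0 < e / 4 by rewrite divr_gt0.
pose D (w' : plane) (i : R) := prin (arg (g i - w') - arg (g i - w)).
have Dc i : trk g (g i) -> {for w, continuous (D ^~ i)}.
  move=> gi; apply: (@prin_continuous R plane (fun w' => arg (g i - w') - arg (g i - w))).
    apply: ccontatB; last by apply: ccontat_cont; exact: cvg_cst.
    by apply: arg_sub_ccontat => h; apply: gw; rewrite -h.
  by rewrite subrr cos0 ltr01.
have E : \forall w' \near w, ang g w + (D w' 1 - D w' 0) = ang g w'.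
  apply/nbhs_ballP; exists (e / 4) => //= w' ww'.
  have far t : I01 t -> e <= `|w.1 - (g t).1| \/ e <= `|w.2 - (g t).2|.
    move=> t01; have [h1|h1] := leP e `|w.1 - (g t).1|; first by left.
    have [h2|h2] := leP e `|w.2 - (g t).2|; first by right.
    by exfalso; apply: (he (g t)); [exact/planeballE|exists t].
  have gw' : ~ trk g w'.
    move=> gw'; apply: (he w') => //; apply: le_ball ww'.
    by clear -e0; lra.
  rewrite /ang (@Var_pert _ (fun t => arg (g (clamp 0 1 t) - w))
    (fun t => arg (g (clamp 0 1 t) - w'))).
  - by rewrite /D !clamp_id ?lexx ?ler01.
  - by move=> t; exact: ang_ccontat.
  - by move=> t; exact: ang_ccontat.
  move=> t t01; apply: cos_argB_gt0; rewrite clamp_id// /dot /=.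
  have := far t t01; move: ww' => /planeballE[]; rewrite !ltr_norml.
  move: (g t) w w' {gw gw' he far Dc t01 D} => [p q] [x y] [x' y'] /=.
  move=> /andP[a1 a2] /andP[b1 b2] h.
  have : e ^+ 2 <= (x - p) ^+ 2 + (y - q) ^+ 2.
    case: h => h.
      have : e ^+ 2 <= (x - p) ^+ 2.
        by rewrite -[(x - p) ^+ 2]real_normK ?num_real// lerXn2r// nnegrE ltW.
      by have := sqr_ge0 (y - q); lra.
    have : e ^+ 2 <= (y - q) ^+ 2.
      by rewrite -[(y - q) ^+ 2]real_normK ?num_real// lerXn2r// nnegrE ltW.
    by have := sqr_ge0 (x - p); lra.
  move=> h2; pose u := p - x; pose v := q - y; pose d := x' - x; pose f := y' - y.
  have -> : (p - x') * (p - x) + (q - y') * (q - y) = u ^+ 2 + v ^+ 2 - d * u - f * v.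
    by rewrite /u /v /d /f; ring.
  have {}h2 : e ^+ 2 <= u ^+ 2 + v ^+ 2.
    by apply: le_trans h2 _; rewrite /u /v -(opprB x p) -(opprB y q) !sqrrN.
  have d1 : d ^+ 2 <= e ^+ 2 / 16 by rewrite /d; nra.
  have f1 : f ^+ 2 <= e ^+ 2 / 16 by rewrite /f; nra.
  have E2 : 0 < e ^+ 2 by rewrite exprn_gt0.
  (* Completing squares bounds [d * u] by [u ^+ 2 / 4 + d ^+ 2], and likewise [f * v]; what remains
     is at least [3/4 e ^+ 2 - e ^+ 2 / 8]. *)
  have := sqr_ge0 (u - d * 2); have := sqr_ge0 (v - f * 2); nra.
apply: (@near_cont _ _ (fun w' => ang g w + (D w' 1 - D w' 0))).
  by apply: filterS E => z ->.
apply: cvgD; first exact: cvg_cst.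
by apply: cvgB; apply: Dc; [exact: trk1|exact: trk0].
Qed.

End Ang.

Lemma argN (u : plane) : u != 0 -> eqm (arg (- u)) (arg u + pi).
Proof.
move=> u0; have n0 := nrm_gt0 u0.
have nu : - u != 0 by rewrite oppr_eq0.
have nn : nrm (- u) = nrm u by rewrite /nrm /dot /= !mulrNN.
apply: cossin_eqm.
  by rewrite cosDpi !cos_arg// nn mulNr.
by rewrite sinDpi !sin_arg// nn mulNr.
Qed.

Lemma no_winding_extensionN (f : plane -> R) (b : plane) (m : int) (rho : R) :
  (forall w, ccontat f w) -> 0 < rho ->
  (forall w, rho <= `|w.1 - b.1| \/ rho <= `|w.2 - b.2| ->
     eqm (f w) (m%:~R * arg (b - w))) -> m = 0.
Proof.
move=> cf r0 h.
apply: (@no_winding_extension _ (fun w => f w - m%:~R * pi) b m rho) => //.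
  by move=> w; apply: ccontatB => //; apply: ccontat_cont; exact: cvg_cst.
move=> w hw; rewrite -(addrK (m%:~R * pi) (m%:~R * arg (w - b))).
apply: eqmB; last exact: eqm_refl.
apply: eqm_trans (h w hw) _; rewrite -mulrDr; apply: eqmZ.
rewrite -(opprB w b); apply: argN; apply/eqP => /subr0_eq E.
by move: hw; rewrite E !subrr normr0 => -[]; rewrite leNgt r0.
Qed.

(** Pasting lemma for circle-valued maps: at a boundary point both formulas are continuous with the
    same cosine and sine, so it does not matter which of them is taken at nearby points. *)
Lemma ccontat_patch (T : topologicalType) (U : set T) (f1 f2 : T -> R) :
  open U -> (forall w, closure U w -> ccontat f1 w) ->
  (forall w, ~ U w -> ccontat f2 w) ->
  (forall w, closure U w -> ~ U w -> eqm (f1 w) (f2 w)) ->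
  forall w, ccontat (fun z => if `[< U z >] then f1 z else f2 z) w.
Proof.
move=> oU c1 c2 e12 w.
have [Uw|Uw] := pselect (U w).
  apply: ccontat_eqm (c1 _ (subset_closure Uw)).
  have : nbhs w U by exact: open_nbhs_nbhs.
  by apply: filterS => z Uz; rewrite asboolT//; exact: eqm_refl.
have [cUw|cUw] := pselect (closure U w); last first.
  apply: ccontat_eqm (c2 _ Uw).
  have : nbhs w (~` closure U).
    by apply: open_nbhs_nbhs; split => //; apply: closed_openC; exact: closed_closure.
  apply: filterS => z Uz; rewrite asboolF; first exact: eqm_refl.
  by move=> /subset_closure.
have [cf1 sf1] := c1 _ cUw; have [cf2 sf2] := c2 _ Uw; have e := e12 _ cUw Uw.
rewrite (eqm_cos e) in cf1; rewrite (eqm_sin e) in sf1.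
split; rewrite asboolF//.
  move=> A nA; have h1 : nbhs w [set z | A (cos (f1 z))] := cf1 A nA.
  have h2 : nbhs w [set z | A (cos (f2 z))] := cf2 A nA.
  have h3 : nbhs w [set z | A (cos (if `[< U z >] then f1 z else f2 z))].
    by apply: filterS (filterI h1 h2) => z /= [? ?]; case: ifP.
  exact: h3.
move=> A nA; have h1 : nbhs w [set z | A (sin (f1 z))] := sf1 A nA.
have h2 : nbhs w [set z | A (sin (f2 z))] := sf2 A nA.
have h3 : nbhs w [set z | A (sin (if `[< U z >] then f1 z else f2 z))].
  by apply: filterS (filterI h1 h2) => z /= [? ?]; case: ifP.
exact: h3.
Qed.

Lemma tietze_compact (E : set plane) (th : plane -> R) :
  compact E -> {within E, continuous th} ->
  exists2 g : plane -> R, continuous g & forall w, E w -> g w = th w.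
Proof.
move=> cE cth.
have [M M0 hM] : exists2 M : R, 0 < M & forall w, E w -> `|th w| <= M.
  have /compact_bounded[M [_ hM]] := continuous_compact cth cE.
  exists (Num.max 1 (M + 1)); first by rewrite lt_max ltr01.
  move=> w Ew; apply: hM; last by exists w.
  by rewrite lt_max ltrDl ltr01 orbT.
have [g [g1 g2 _]] := @continuous_bounded_extension _ R
  (@pseudometric_normal R plane) E (plane_compact_closed cE) th M M0 cth hM.
by exists g => // w Ew; rewrite g1// inE.
Qed.

Lemma compact_box (A : set plane) : compact A ->
  exists2 M : R, 0 < M & forall w, A w -> `|w.1| < M /\ `|w.2| < M.
Proof.
move=> /compact_bounded[M [_ hM]].
exists (Num.max 1 (M + 1) + 1); first by rewrite addr_gt0// lt_max ltr01.
move=> w Aw; have : `|w| <= Num.max 1 (M + 1).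
  by apply: hM => //; rewrite lt_max ltrDl ltr01 orbT.
rewrite prod_normE ge_max => /andP[h1 h2].
by split; rewrite ltr_pwDr// ltr01.
Qed.

Lemma box_open (M : R) : open [set w : plane | `|w.1| < M /\ `|w.2| < M].
Proof.
apply: openI.
  apply: (@open_comp _ _ (fun w : plane => `|w.1|) [set x | x < M]).
    move=> w _; apply: continuous_comp; last exact: norm_continuous.
    exact: cvg_fst.
  exact: open_lt.
apply: (@open_comp _ _ (fun w : plane => `|w.2|) [set x | x < M]).
  move=> w _; apply: continuous_comp; last exact: norm_continuous.
  exact: cvg_snd.
exact: open_lt.
Qed.

Lemma cbox_compact (M : R) : compact [set w : plane | `|w.1| <= M /\ `|w.2| <= M].
Proof.
rewrite (_ : [set _ | _] = `[-M, M]%classic `*` `[-M, M]%classic).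
  by apply: compact_setX; exact: segment_compact.
by apply/seteqP; split => w /=; rewrite !in_itv /= !ler_norml.
Qed.

(** Expresses that [(z - w) / (y - w)] has no continuous logarithm off two disjoint compact sets
    that hold [y] and [z] apart. Take a bounded open [U] around [A1] with closure off [A2] and
    extend [th] from its boundary: [arg (z - w) - th w] inside and [arg (y - w)] outside paste to a
    map of degree 1 at infinity. *)
Lemma no_log (A1 A2 : set plane) (y z : plane) (th : plane -> R) :
  compact A1 -> compact A2 -> A1 `&` A2 = set0 -> A1 y -> A2 z ->
  (forall w, ~ A1 w -> ~ A2 w -> {for w, continuous th} /\
     eqm (th w) (arg (z - w) - arg (y - w))) -> False.
Proof.
move=> c1 c2 A12 A1y A2z hth.
have [M M0 hM] := compact_box c1.
(* Adding the outside of a box to [A2] makes the separating neighbourhood of [A1] bounded. *)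
pose B : set plane := A2 `|` ~` [set w : plane | `|w.1| < M /\ `|w.2| < M].
have cB : closed B.
  apply: closedU; first exact: plane_compact_closed.
  by apply: open_closedC; exact: box_open.
have AB : A1 `&` B = set0.
  apply/seteqP; split => // w [A1w [A2w|/= nb]].
    by have : (A1 `&` A2) w by []; rewrite A12.
  by apply: nb; exact: hM.
have [U [V [oU oV AU BV UV]]] :=
  (@normal_openP R plane).1 pseudometric_normal _ _ (plane_compact_closed c1) cB AB.
have clUV w : closure U w -> ~ V w.
  move=> cw Vw; have [v [Uv Vv]] : U `&` V !=set0.
    by apply: cw; exact: open_nbhs_nbhs.
  by have : (U `&` V) v by []; rewrite UV.
have clU2 w : closure U w -> ~ A2 w by move=> /clUV nV A2w; apply: nV; apply: BV; left.
have clUb w : closure U w -> `|w.1| < M /\ `|w.2| < M.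
  move=> /clUV nV; apply: contrapT => nb; apply: nV; apply: BV; right; exact: nb.
pose E : set plane := closure U `&` ~` U.
have cE : compact E.
  apply: (@subclosed_compact _ _ [set w : plane | `|w.1| <= M /\ `|w.2| <= M]).
  - by apply: closedI; [exact: closed_closure|exact: open_closedC].
  - exact: cbox_compact.
  - by move=> w [/clUb[h1 h2] _]; split; exact: ltW.
have EA w : E w -> ~ A1 w /\ ~ A2 w.
  by move=> [cw Uw]; split; [move=> /AU|exact: clU2].
have [g cg gE] : exists2 g : plane -> R, continuous g & forall w, E w -> g w = th w.
  apply: tietze_compact => //; apply: continuous_in_subspaceT => w; rewrite inE => Ew.
  by have [h1 h2] := EA _ Ew; have [] := hth w h1 h2.
pose f w := if `[< U w >] then arg (z - w) - g w else arg (y - w).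
have cf w : ccontat f w.
  apply: (@ccontat_patch _ U (fun w => arg (z - w) - g w) (fun w => arg (y - w))) => //.
  - move=> {}w cw; apply: ccontatB; last by apply: ccontat_cont; exact: cg.
    by apply: arg_sub_ccontat => E0; apply: (clU2 w cw); rewrite -E0.
  - move=> {}w Uw; apply: arg_sub_ccontat => E0.
    by apply: Uw; rewrite -E0; exact: AU.
  - move=> {}w cw Uw; have Ew : E w by [].
    have [h1 h2] := EA _ Ew; have [_ e] := hth w h1 h2.
    rewrite (gE _ Ew); have -> : arg (y - w) = arg (z - w) - (arg (z - w) - arg (y - w)) by lra.
    by apply: eqmB => //; exact: eqm_refl.
suff : (1 : int) = 0 by [].
apply: (@no_winding_extensionN f y 1 (M + M)) => //; first by rewrite addr_gt0.
move=> w hw; rewrite mul1r /f asboolF; first exact: eqm_refl.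
move=> /subset_closure /clUb [h1 h2]; have [h3 h4] := hM _ A1y.
case: hw; rewrite leNgt => /negP; apply.
  by apply: le_lt_trans (ler_normB _ _) _; exact: ltrD.
by apply: le_lt_trans (ler_normB _ _) _; exact: ltrD.
Qed.

(* If the two branches agreed on both sides of [al] near the interior point
   [al t0], they would glue to a logarithm of [(z - w) / (y - w)] off two
   disjoint subarcs of [al]. *)
Lemma jump (al : R -> plane) (Th : plane -> R) (t0 e : R) :
  continuous al ->
  (forall s t, 0 <= s <= 1 -> 0 <= t <= 1 -> al s = al t -> s = t) ->
  0 < t0 < 1 -> 0 < e ->
  (forall w, ball (al t0) e w -> {for w, continuous Th} /\
     eqm (Th w) (arg (al 1 - w) - arg (al 0 - w))) ->
  exists a b, [/\ ball (al t0) e a, ball (al t0) e b, ~ trk al a, ~ trk al b &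
     ang al a - Th a != ang al b - Th b].
Proof.
move=> cal ial /andP[t00 t01] e0 hTh; apply: contrapT => H.
pose B := [set w | ball (al t0) e w].
have oB : open B.
  have -> : B = ball (al t0) e by [].
  exact: ball_open.
have [c hc ec] : exists2 c : R, (forall w, B w -> ~ trk al w -> ang al w = Th w + c) & eqm c 0.
  have [[w [Bw aw]]|N] := pselect (exists w, B w /\ ~ trk al w).
    exists (ang al w - Th w).
      move=> w' Bw' aw'; apply/eqP; apply: contrapT => /negP ne; apply: H.
      by exists w', w; split => //; apply: contra ne => /eqP h; apply/eqP; lra.
    rewrite -(subrr (arg (al 1 - w) - arg (al 0 - w))); apply: eqmB.
      exact: ang_eqm.
    by have [] := hTh w Bw.
  (* If the arc filled the ball, there would be no point at which the branches have to match, and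
     any multiple of [tau] could serve as [c]. *)
  exists 0; last exact: eqm_refl.
  by move=> w Bw aw; exfalso; apply: N; exists w.
have [d /andP[d0 d1] hd] : exists2 d : R, 0 < d < Num.min t0 (1 - t0) &
    forall t, t0 - d <= t <= t0 + d -> B (al t).
  have : nbhs t0 (al @^-1` B).
    by apply: cal; apply: open_nbhs_nbhs; split => //; exact: ballxx.
  move=> /nbhs_ballP[r /= r0 hr].
  pose m := Num.min t0 (1 - t0).
  have m0 : 0 < m by rewrite lt_min t00 subr_gt0.
  exists (Num.min (r / 2) (m / 2)).
    have h : Num.min (r / 2) (m / 2) <= m / 2 by rewrite ge_min lexx orbT.
    have m2 : m / 2 < m by clear -m0; lra.
    by rewrite lt_min !divr_gt0//=; exact: le_lt_trans h m2.
  move=> t /andP[h1 h2]; apply: hr; rewrite /ball /=.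
  set d := Num.min _ _ in h1 h2; have mr : d <= r / 2 by rewrite ge_min lexx.
  by rewrite ltr_norml; apply/andP; split; lra.
move: d1; rewrite lt_min => /andP[d1 d2].
(* The middle part of the arc lies in the ball, where [Th + c] replaces [ang al]; only the two end
   parts remain as obstacles. *)
pose A1 := al @` [set t | 0 <= t <= t0 - d]; pose A2 := al @` [set t | t0 + d <= t <= 1].
pose th w := if `[< B w >] then Th w + c else ang al w.
apply: (@no_log A1 A2 (al 0) (al 1) th).
- exact: segment_image_compact.
- exact: segment_image_compact.
- apply/seteqP; split => // w [[s /= /andP[s0 s1] <-] [t /= /andP[t1 t2] st]].
  have : t = s; last lra.
  by apply: ial => //; apply/andP; split; lra.
- by exists 0 => //=; apply/andP; split; lra.
- by exists 1 => //=; apply/andP; split; lra.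
move=> w w1 w2.
have [Bw|Bw] := pselect (B w).
  have [cTh eTh] := hTh w Bw; split; last first.
    by rewrite /th asboolT// -[X in eqm _ X]addr0; apply: eqmD.
  apply: (@near_cont _ _ (fun z => Th z + c)).
    have : nbhs w B by exact: open_nbhs_nbhs.
    by apply: filterS => z Bz; rewrite /th asboolT.
  by apply: cvgD => //; exact: cvg_cst.
have aw : ~ trk al w.
  move=> [t /= /andP[ta tb] tw]; have [h1|h1] := leP t (t0 - d).
    by apply: w1; exists t => //=; rewrite ta.
  have [h2|h2] := leP (t0 + d) t; first by apply: w2; exists t => //=; rewrite h2.
  by apply: Bw; rewrite -tw; apply: hd; rewrite !ltW.
split; last by rewrite /th asboolF//; exact: ang_eqm.
apply: (@near_cont _ _ (ang al)); last exact: ang_cont.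
  have : nbhs w (~` trk al).
    by apply: open_nbhs_nbhs; split => //; apply: closed_openC; exact: trk_closed.
  apply: filterS => z az; rewrite /th; case: asboolP => // Bz; exact: hc.
Qed.

Lemma path_const (f : plane -> R) (g : R -> plane) :
  continuous g ->
  (forall t, 0 <= t <= 1 -> {for g t, continuous f} /\ eqm (f (g t)) 0) ->
  f (g 0) = f (g 1).
Proof.
move=> cg h; apply: (@eqm_connected _ _ (f \o g) _ (@itv01_connected R)).
- apply: continuous_in_subspaceT => t; rewrite inE /= => t01.
  by apply: continuous_comp; [exact: cg|have [] := h t t01].
- by move=> t /h [].
- by rewrite /= lexx ler01.
- by rewrite /= lexx ler01.
Qed.

Lemma nrm_cart (r a : R) : 0 <= r -> nrm (r * cos a, r * sin a) = r.
Proof.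
move=> r0; rewrite /nrm /dot /=.
have -> : r * cos a * (r * cos a) + r * sin a * (r * sin a) = r ^+ 2 * (cos a ^+ 2 + sin a ^+ 2).
  by ring.
by rewrite cos2Dsin2 mulr1 sqrtr_sqr ger0_norm.
Qed.

Lemma polar (u : plane) : u != 0 -> u = (nrm u * cos (arg u), nrm u * sin (arg u)).
Proof.
move=> u0; have n0 := nrm_gt0 u0; rewrite cos_arg// sin_arg//.
by rewrite ![nrm u * _]mulrC !divfK ?gt_eqF// -surjective_pairing.
Qed.

(** Radius and angle are interpolated linearly. The radius is a convex combination of two numbers
    above [M], and the branches of [arg] at the ends do not matter. *)
Lemma far_path (M : R) (u v : plane) : 0 <= M -> M < nrm u -> M < nrm v ->
  exists g : R -> plane, [/\ continuous g, g 0 = u, g 1 = v &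
    forall t, 0 <= t <= 1 -> M < nrm (g t)].
Proof.
move=> M0 Mu Mv.
have nz w : M < nrm w -> w != 0.
  move=> h; apply: contraTneq h => ->.
  by rewrite /nrm /dot /= mulr0 addr0 sqrtr0 -leNgt.
pose rr t := nrm u + t * (nrm v - nrm u); pose aa t := arg u + t * (arg v - arg u).
have caff (a b : R) : continuous (fun t : R => a + t * b).
  by move=> t; apply: cvgD; [exact: cvg_cst|apply: cvgM; [exact: cvg_id|exact: cvg_cst]].
exists (fun t => (rr t * cos (aa t), rr t * sin (aa t))); split.
- move=> t; apply: (@pair_cont _ _ _ (fun t => rr t * cos (aa t)) (fun t => rr t * sin (aa t))).
    apply: cvgM; first exact: caff.
    by apply: continuous_comp; [exact: caff|exact: continuous_cos].
  apply: cvgM; first exact: caff.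
  by apply: continuous_comp; [exact: caff|exact: continuous_sin].
- by rewrite /rr /aa !mul0r !addr0 -polar// nz.
- by rewrite /rr /aa !mul1r !(addrC _ (_ - _)) !subrK -polar// nz.
move=> t /andP[t0 t1].
have h : M < rr t.
  rewrite /rr; have -> : nrm u + t * (nrm v - nrm u) = (1 - t) * nrm u + t * nrm v by ring.
  by have [ut|ut] := leP (nrm u) (nrm v); nra.
by rewrite nrm_cart// ltW// (le_lt_trans M0).
Qed.

End Separation.

(** * Homotopies in bounded open sets without holes *)

Section Homotopy.
Variable R : realType.
Local Notation plane := (R * R)%type.
Variable O : set plane.

Definition conv (C : set plane) := forall (a b : plane) (t : R),
  C a -> C b -> 0 <= t <= 1 -> C (a + t *: (b - a)).

Definition seg (a b : plane) (t : R) : plane := a + t *: (b - a).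

Lemma seg0 a b : seg a b 0 = a.
Proof. by rewrite /seg scale0r addr0. Qed.

Lemma seg1 a b : seg a b 1 = b.
Proof. by rewrite /seg scale1r addrC subrK. Qed.

Lemma segE a b t : seg a b t = (a.1 + t * (b.1 - a.1), a.2 + t * (b.2 - a.2)).
Proof. by []. Qed.

Lemma cont_seg (T : topologicalType) (x : T) (f g : T -> plane) (k : T -> R) :
  {for x, continuous f} -> {for x, continuous g} -> {for x, continuous k} ->
  {for x, continuous (fun z => seg (f z) (g z) (k z))}.
Proof.
move=> cf cg ck; apply: cvgD => //; apply: cvgZ => //; exact: cvgB.
Qed.

(** Paths live on the whole line and move only for [t] strictly between 0 and [M]. Concatenation is
    then a shift of time, and every continuity statement is unrestricted. *)
Definition homot (M : R) (f g : R -> plane) :=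
  exists H : R * R -> plane, [/\ continuous H, (forall t, H (0, t) = f t),
    (forall t, H (1, t) = g t), (forall s t, O (H (s, t)))
    & (forall s t, t <= 0 \/ M <= t -> H (s, t) = f t)].

Lemma homot_le M M' f g : M <= M' -> homot M f g -> homot M' f g.
Proof.
move=> MM [H [h1 h2 h3 h4 h5]]; exists H; split => // s t [h|h]; apply: h5.
  by left.
by right; exact: le_trans h.
Qed.

Lemma homot_refl M f : continuous f -> (forall t, O (f t)) -> homot M f f.
Proof.
move=> cf fO; exists (fun st => f st.2); split => // st.
by apply: continuous_comp; [exact: cvg_snd|exact: cf].
Qed.

Lemma homot_ends M f g t : homot M f g -> t <= 0 \/ M <= t -> f t = g t.
Proof. by case=> H [_ h2 h3 _ h5] h; rewrite -h3 h5. Qed.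

Lemma homot_sym M f g : homot M f g -> homot M g f.
Proof.
move=> hfg; case: (hfg) => H [h1 h2 h3 h4 h5]; exists (fun st => H (1 - st.1, st.2)); split.
- move=> st; apply: (@continuous_comp _ _ _ (fun st : R * R => (1 - st.1, st.2)) H); last exact: h1.
  apply: (@pair_cont _ _ _ (fun st : R * R => 1 - st.1) snd); last exact: cvg_snd.
  by apply: cvgB; [exact: cvg_cst|exact: cvg_fst].
- by move=> t /=; rewrite subr0.
- by move=> t /=; rewrite subrr.
- by move=> s t; exact: h4.
- by move=> s t ht /=; rewrite h5// (homot_ends hfg).
Qed.

Lemma clamp01_l (t : R) : t <= 0 -> clamp 0 1 t = 0.
Proof. exact: clamp_l. Qed.

Lemma clamp01_r (t : R) : 1 <= t -> clamp 0 1 t = 1.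
Proof. by apply: clamp_r; exact: ler01. Qed.

(** The homotopies are added rather than pasted: in the first half of the [s]-range the second one
    is frozen at [g] and cancels, in the second half the first one is frozen at [g]. *)
Lemma homot_trans M f g k : homot M f g -> homot M g k -> homot M f k.
Proof.
move=> hfg hgk; case: (hfg) => H [h1 h2 h3 h4 h5]; case: (hgk) => K [k1 k2 k3 k4 k5].
have cg : continuous g.
  have -> : g = fun t => K (0, t) by apply/funext => t; rewrite k2.
  move=> t; apply: (@continuous_comp _ _ _ (fun t : R => (0 : R, t)) K); last exact: k1.
  by apply: (@pair_cont _ _ _ (fun=> 0) id); [exact: cst_continuous|exact: cvg_id].
exists (fun st => H (clamp 0 1 (2 * st.1), st.2) + (K (clamp 0 1 (2 * st.1 - 1), st.2) - g st.2)).
have cl (a b : R) st : {for st, continuous (fun st : R * R => (clamp 0 1 (a * st.1 - b), st.2))}.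
  apply: (@pair_cont _ _ _ (fun st : R * R => clamp 0 1 (a * st.1 - b)) snd); last exact: cvg_snd.
  apply: continuous_comp; last exact: clamp_continuous.
  by apply: cvgB; [apply: cvgM; [exact: cvg_cst|exact: cvg_fst]|exact: cvg_cst].
split.
- move=> st; apply: cvgD.
    apply: (@continuous_comp _ _ _ (fun st : R * R => (clamp 0 1 (2 * st.1), st.2)) H); last exact: h1.
    have -> : (fun st : R * R => (clamp 0 1 (2 * st.1), st.2)) = (fun st : R * R => (clamp 0 1 (2 * st.1 - 0), st.2)).
      by apply/funext => z; rewrite subr0.
    exact: cl.
  apply: cvgB.
    apply: (@continuous_comp _ _ _ (fun st : R * R => (clamp 0 1 (2 * st.1 - 1), st.2)) K); last exact: k1.
    exact: cl.
  by apply: (@continuous_comp _ _ _ (fun st : R * R => st.2) g); [exact: cvg_snd|exact: cg].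
- move=> t /=; rewrite clamp01_l ?mulr0// clamp01_l; last by lra.
  by rewrite k2 subrr addr0.
- move=> t /=; rewrite clamp01_r; last by lra.
  by rewrite clamp01_r ?h3 ?k3 1?addrC ?subrK//; lra.
- move=> s t /=; have [s2|s2] := leP (2 * s) 1.
    by rewrite (@clamp01_l (2 * s - 1)) ?k2 ?subrr ?addr0 ?subr_le0.
  by rewrite (@clamp01_r (2 * s)) ?h3 1?addrC ?subrK// ltW.
- by move=> s t ht /=; rewrite h5// k5// subrr addr0.
Qed.

Lemma homot_straight M (f g : R -> plane) : continuous f -> continuous g ->
  (forall s t, 0 <= s <= 1 -> O (seg (f t) (g t) s)) ->
  (forall t, t <= 0 \/ M <= t -> f t = g t) -> homot M f g.
Proof.
move=> cf cg fgO fg; exists (fun st => seg (f st.2) (g st.2) (clamp 0 1 st.1)); split.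
- move=> st; apply: (@cont_seg _ st (f \o snd) (g \o snd) (clamp 0 1 \o fst)).
  + by apply: (@continuous_comp _ _ _ snd f); [exact: cvg_snd|exact: cf].
  + by apply: (@continuous_comp _ _ _ snd g); [exact: cvg_snd|exact: cg].
  + by apply: continuous_comp; [exact: cvg_fst|exact: clamp_continuous].
- by move=> t /=; rewrite clamp01_l// seg0.
- by move=> t /=; rewrite clamp01_r// seg1.
- by move=> s t; apply: fgO; exact: clamp01_in.
- by move=> s t ht /=; rewrite fg// /seg subrr scaler0 addr0.
Qed.

Lemma homot_reparam (M : R) (f : R -> plane) (r1 r2 : R -> R) :
  continuous f -> (forall t, O (f t)) -> continuous r1 -> continuous r2 ->
  (forall s t, 0 <= s <= 1 -> t <= 0 \/ M <= t ->
     f (r1 t + s * (r2 t - r1 t)) = f (r1 t)) ->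
  homot M (f \o r1) (f \o r2).
Proof.
move=> cf fO c1 c2 h.
exists (fun st => f (r1 st.2 + clamp 0 1 st.1 * (r2 st.2 - r1 st.2))); split.
- move=> st; apply: (@continuous_comp _ _ _
    (fun st : R * R => r1 st.2 + clamp 0 1 st.1 * (r2 st.2 - r1 st.2)) f); last exact: cf.
  have cc (r : R -> R) : continuous r -> {for st, continuous (fun st : R * R => r st.2)}.
    by move=> cr; apply: (@continuous_comp _ _ _ snd r); [exact: cvg_snd|exact: cr].
  apply: cvgD; first exact: cc.
  apply: cvgM; last by apply: cvgB; exact: cc.
  by apply: continuous_comp; [exact: cvg_fst|exact: clamp_continuous].
- by move=> t /=; rewrite clamp01_l// mul0r addr0.
- by move=> t /=; rewrite clamp01_r// mul1r addrC subrK.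
- by move=> s t; exact: fO.
- by move=> s t ht; apply: h => //; exact: clamp01_in.
Qed.

(** The polygonal path that visits the entries of [l] at the times 0, 1, 2, ... and rests before and
    after. The summand [PL l' (t - 1) - b] vanishes for [t <= 1], and the segment rests at [b]
    afterwards. *)
Fixpoint PL (l : seq plane) : R -> plane :=
  match l with
  | [::] => fun=> 0
  | a :: l' => fun t => if l' is b :: _ then seg a b (clamp 0 1 t) + (PL l' (t - 1) - b) else a
  end.

Arguments PL : simpl never.

Lemma PL_cons a b l t :
  PL (a :: b :: l) t = seg a b (clamp 0 1 t) + (PL (b :: l) (t - 1) - b).
Proof. by []. Qed.

Lemma PL_cont l : continuous (PL l).
Proof.
elim: l => [|a [|b l] IH]; try by move=> t; exact: cvg_cst.
move=> t; apply: cvgD.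
  apply: (@cont_seg _ t (fun=> a) (fun=> b) (clamp 0 1)).
  - exact: cvg_cst.
  - exact: cvg_cst.
  - exact: clamp_continuous.
apply: cvgB; last exact: cvg_cst.
apply: (@continuous_comp _ _ _ (fun t : R => t - 1) (PL (b :: l))); last exact: IH.
by apply: cvgB; [exact: cvg_id|exact: cvg_cst].
Qed.

Lemma PL_le0 a l t : t <= 0 -> PL (a :: l) t = a.
Proof.
elim: l a t => [//|b l IH] a t t0; rewrite PL_cons clamp01_l// seg0.
by rewrite IH ?subrr ?addr0//; lra.
Qed.

Lemma PL_le1 a b l t : t <= 1 -> PL (a :: b :: l) t = seg a b (clamp 0 1 t).
Proof. by move=> t1; rewrite PL_cons PL_le0 ?subrr ?addr0//; lra. Qed.

Lemma PL_ge1 a b l t : 1 <= t -> PL (a :: b :: l) t = PL (b :: l) (t - 1).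
Proof. by move=> t1; rewrite PL_cons clamp01_r// seg1 addrC subrK. Qed.

Lemma PL_last a l t : (size l)%:R <= t -> PL (a :: l) t = last a l.
Proof.
elim: l a t => [//|b l IH] a t /= lt.
have h : (size l)%:R <= t - 1 by rewrite -natr1 in lt; lra.
by rewrite -[LHS]/(PL (a :: b :: l) t) PL_ge1 ?IH//; have := ler0n R (size l); lra.
Qed.

Fixpoint okl (l : seq plane) : Prop :=
  match l with
  | [::] => False
  | a :: l' => O a /\ (if l' is b :: _ then (forall s, 0 <= s <= 1 -> O (seg a b s)) /\ okl l' else True)
  end.

Lemma okl_PL a l t : okl (a :: l) -> O (PL (a :: l) t).
Proof.
elim: l a t => [|b l IH] a t; first by case.
move=> [Oa [ab okb]]; have [t1|t1] := leP t 1.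
  by rewrite PL_le1//; apply: ab; exact: clamp01_in.
by rewrite PL_ge1 ?ltW//; exact: IH.
Qed.

(* Moves on polygonal paths: a vertex is moved inside a convex subset of O
   containing it, its new position and its two neighbours. *)
Inductive heq : seq plane -> seq plane -> Prop :=
| heq_refl l : heq l l
| heq_sym l l' : heq l l' -> heq l' l
| heq_trans l l' l'' : heq l l' -> heq l' l'' -> heq l l''
| heq_cons a b l l' : heq (b :: l) (b :: l') -> heq (a :: b :: l) (a :: b :: l')
| heq_stut a l : heq (a :: a :: l) (a :: l)
| heq_tri (C : set plane) a x y b l : conv C -> C `<=` O -> C a -> C x -> C y -> C b ->
    heq (a :: x :: b :: l) (a :: y :: b :: l).

Lemma heq_cat l l' k : heq l l' -> heq (l ++ k) (l' ++ k).
Proof.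
elim => {l l'}.
- by move=> l; exact: heq_refl.
- by move=> l l' _; exact: heq_sym.
- by move=> l l' l'' _ h _ h'; exact: heq_trans h'.
- by move=> a b l l' _; exact: heq_cons.
- by move=> a l; exact: heq_stut.
- by move=> C a x y b l cC CO Ca Cx Cy Cb; exact: (@heq_tri C).
Qed.

Lemma heq_catl k a l l' : heq (a :: l) (a :: l') -> heq (k ++ a :: l) (k ++ a :: l').
Proof.
elim: k a l l' => [//|b [|c k] IH] a l l' h; first exact: heq_cons.
by apply: heq_cons; exact: IH.
Qed.

Lemma homot_cons a b l l' M : (forall s, 0 <= s <= 1 -> O (seg a b s)) ->
  homot M (PL (b :: l)) (PL (b :: l')) ->
  homot (M + 1) (PL (a :: b :: l)) (PL (a :: b :: l')).
Proof.
move=> abO [H [h1 h2 h3 h4 h5]].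
exists (fun st => seg a b (clamp 0 1 st.2) + (H (st.1, st.2 - 1) - b)).
have hb s t : t <= 0 -> H (s, t) = b.
  by move=> t0; rewrite h5 ?PL_le0//; left.
split.
- move=> st; apply: cvgD.
    apply: (@cont_seg _ st (fun=> a) (fun=> b) (fun st : R * R => clamp 0 1 st.2)).
    - exact: cvg_cst.
    - exact: cvg_cst.
    - by apply: continuous_comp; [exact: cvg_snd|exact: clamp_continuous].
  apply: cvgB; last exact: cvg_cst.
  apply: (@continuous_comp _ _ _ (fun st : R * R => (st.1, st.2 - 1)) H); last exact: h1.
  apply: (@pair_cont _ _ _ fst (fun st : R * R => st.2 - 1)); first exact: cvg_fst.
  by apply: cvgB; [exact: cvg_snd|exact: cvg_cst].
- by move=> t; rewrite h2.
- by move=> t; rewrite h3.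
- move=> s t /=; have [t1|t1] := leP t 1.
    by rewrite hb ?subr_le0// subrr addr0; apply: abO; exact: clamp01_in.
  by rewrite clamp01_r ?ltW// seg1 addrC subrK.
- move=> s t ht; rewrite [LHS]/=.
  rewrite h5 -?h2; first by rewrite h2.
  by case: ht => ht; [left|right]; lra.
Qed.

(** A stutter is a reparametrization by a shift of time; moving a vertex inside a convex [C] is a
    straight-line homotopy during the times from 0 to 2. Admissibility is shown in both directions
    because moves may be reversed and composed. *)
Lemma heq_homot l l' : heq l l' -> (okl l <-> okl l') /\
  (okl l -> exists M, homot M (PL l) (PL l')).
Proof.
elim => {l l'}.
- move=> l; split => // okL; exists 0; apply: homot_refl; first exact: PL_cont.
  by case: l okL => [//|a l okL] t; exact: okl_PL.
- move=> l l' _ [e h]; split; first by rewrite e.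
  by move=> /e /h [M hM]; exists M; exact: homot_sym.
- move=> l l' l'' _ [e h] _ [e' h']; split; first by rewrite e.
  move=> okL; have [M hM] := h okL; have [M' hM'] := h' (e.1 okL).
  exists (Num.max M M'); apply: (@homot_trans _ _ (PL l')).
    by apply: homot_le hM; rewrite le_max lexx.
  by apply: homot_le hM'; rewrite le_max lexx orbT.
- move=> a b l l' _ [e h]; split.
    by split => -[Oa [ab /e ?]]; split.
  by move=> [Oa [ab /h [M hM]]]; exists (M + 1); exact: homot_cons.
- move=> a l; split.
    split => [[]//|]; first by move=> _ [].
    move=> h; have Oa : O a by case: l h => [|b l] [].
    split => //; split => // s _; by rewrite /seg subrr scaler0 addr0.
  move=> [Oa [_ okL]].
  pose M : R := (size l)%:R + 1.
  exists M.
  have -> : PL (a :: a :: l) = PL (a :: l) \o (fun t => t - 1).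
    apply/funext => t; by rewrite PL_cons /seg subrr scaler0 addr0 addrC subrK.
  have -> : PL (a :: l) = PL (a :: l) \o id by [].
  apply: homot_reparam.
  + exact: PL_cont.
  + by move=> t; exact: okl_PL.
  + by move=> t; apply: cvgB; [exact: cvg_id|exact: cvg_cst].
  + by move=> t; exact: cvg_id.
  + move=> s t /andP[s0 s1] [t0|tM].
      by rewrite /= !PL_le0//; nra.
    by rewrite /M in tM; rewrite /= !PL_last//; nra.
- move=> C a x y b l cC CO Ca Cx Cy Cb.
  have sC u v s : C u -> C v -> 0 <= s <= 1 -> C (seg u v s) by move=> *; exact: cC.
  split.
    split => -[Oa [_ [_ [_ okb]]]]; split => //; split; try by move=> *; apply/CO/sC.
      by split; [exact: CO|split => // *; apply/CO/sC].
    by split; [exact: CO|split => // *; apply/CO/sC].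
  move=> [Oa [_ [_ [_ okb]]]].
  have inC z t : C z -> t <= 2 -> C (PL (a :: z :: b :: l) t).
    move=> Cz t2; have [t1|t1] := leP t 1.
      by rewrite PL_le1//; apply: sC => //; exact: clamp01_in.
    rewrite PL_ge1 ?ltW// PL_le1; last by lra.
    by apply: sC => //; exact: clamp01_in.
  have ge2 z t : 2 <= t -> PL (a :: z :: b :: l) t = PL (b :: l) (t - 1 - 1).
    by move=> t2; rewrite PL_ge1 ?PL_ge1//; lra.
  exists 2; apply: homot_straight; try exact: PL_cont.
    move=> s t s01; have [t2|t2] := leP t 2; first by apply/CO/sC => //; exact: inC.
    by rewrite !ge2 ?ltW// /seg subrr scaler0 addr0; exact: okl_PL.
  by move=> t [t0|t2]; [rewrite !PL_le0|rewrite !ge2].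
Qed.

End Homotopy.

(** * Contracting closed walks on the integer lattice *)

Definition vtx := (int * int)%type.

Definition adj (a b : vtx) : bool :=
  [|| b == (a.1 + 1, a.2), b == (a.1 - 1, a.2), b == (a.1, a.2 + 1) | b == (a.1, a.2 - 1)].

Definition lexle (a b : vtx) : bool := (a.2 < b.2) || (a.2 == b.2) && (a.1 <= b.1).

Definition leftv (x : vtx) : vtx := (x.1 - 1, x.2).
Definition belowv (x : vtx) : vtx := (x.1, x.2 - 1).
Definition diagv (x : vtx) : vtx := (x.1 - 1, x.2 - 1).

Lemma adj_lex x q : adj x q -> lexle q x -> q = leftv x \/ q = belowv x.
Proof.
move: x q => [x1 x2] [q1 q2]; rewrite /adj /lexle /leftv /belowv /= => /or4P[] /eqP[-> ->] h.
- by exfalso; move: h; lia.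
- by left.
- by exfalso; move: h; lia.
- by right.
Qed.

Lemma lexle_total a b : lexle a b || lexle b a.
Proof. by rewrite /lexle; lia. Qed.

Lemma lexle_trans b a c : lexle a b -> lexle b c -> lexle a c.
Proof. by rewrite /lexle; lia. Qed.

Lemma lexle_max a s : exists2 x, x \in a :: s & all (lexle^~ x) (a :: s).
Proof.
elim: s a => [|b s IH] a.
  by exists a; rewrite ?mem_head//= andbT; have := lexle_total a a; rewrite orbb.
have [x xs /= xm] := IH b; case/orP: (lexle_total a x) => ax.
  by exists x; [rewrite inE xs orbT|rewrite /= ax].
exists a; first by rewrite mem_head.
apply/andP; split; first by have := lexle_total a a; rewrite orbb.
by apply: (sub_all _ (xm : all _ (b :: s))) => z /= zx; exact: lexle_trans ax.
Qed.

Lemma not_uniq_split (T : eqType) (l : seq T) : ~~ uniq l ->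
  exists x l1 l2 l3, l = l1 ++ x :: l2 ++ x :: l3.
Proof.
elim: l => [//|y s IH] /=; rewrite negb_and negbK => /orP[ys|/IH].
  by case/splitPr: ys => l2 l3; exists y, [::], l2, l3.
by move=> [x [l1 [l2 [l3 ->]]]]; exists x, (y :: l1), l2, l3.
Qed.

Section Walks.
Variable R : realType.
Local Notation plane := (R * R)%type.
(** In the application [st] holds between lattice points joined by a segment in [O], and [Q z] says
    that the unit square with lower left corner [z] lies in [O]. All topology is confined to [star]:
    at the topmost, then rightmost vertex of a simple closed walk, the square to its lower left lies
    in [O]. *)
Variables (O : set plane) (pt : vtx -> plane) (st : rel vtx) (Q : vtx -> Prop).
Hypothesis st_sym : symmetric st.
Hypothesis st_adj : forall a b, st a b -> a != b -> adj a b.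
Hypothesis st_conv : forall a b, st a b ->
  exists C, [/\ conv C, C `<=` O, C (pt a) & C (pt b)].
Hypothesis Q_conv : forall x, Q (diagv x) ->
  exists C, [/\ conv C, C `<=` O & [/\ C (pt x), C (pt (leftv x)), C (pt (belowv x)) & C (pt (diagv x))]].
Hypothesis Q_st : forall x, Q (diagv x) -> st (leftv x) (diagv x) /\ st (belowv x) (diagv x).
Hypothesis star : forall x m, cycle st (x :: leftv x :: rcons m (belowv x)) ->
  uniq (x :: leftv x :: rcons m (belowv x)) ->
  all (lexle^~ x) (x :: leftv x :: rcons m (belowv x)) -> Q (diagv x).

Let H (l l' : seq vtx) := heq O (map pt l) (map pt l').

Lemma H_catl k a l l' : H (a :: l) (a :: l') -> H (k ++ a :: l) (k ++ a :: l').
Proof. by rewrite /H !map_cat; exact: heq_catl. Qed.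

Lemma H_catr k l l' : H l l' -> H (l ++ k) (l' ++ k).
Proof. by rewrite /H !map_cat; exact: heq_cat. Qed.

Lemma H_back a b k l : st a b -> H (k ++ a :: b :: a :: l) (k ++ a :: l).
Proof.
move=> ab; apply: H_catl; have [C [cC CO Ca Cb]] := st_conv ab.
apply: (@heq_trans _ _ _ (map pt (a :: a :: a :: l))).
  exact: (@heq_tri _ O C).
apply: (@heq_trans _ _ _ (map pt (a :: a :: l))); exact: heq_stut.
Qed.

Definition ctr (c : seq vtx) : Prop :=
  if c is z :: r then H (z :: rcons r z) [:: z] else True.

(** Changing the base point conjugates by an edge: a backtracking along it is inserted, the old
    closed walk is contracted, and the backtracking is removed. *)
Lemma ctr_rot1 c : cycle st c -> ctr c -> ctr (rot 1 c).
Proof.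
case: c => [//|z [|y r]] // cyc h.
rewrite rot1_cons.
have zy : st y z by rewrite st_sym; case/andP: cyc.
apply: (@heq_trans _ _ _ (map pt (y :: (z :: rcons (y :: r) z) ++ [:: y]))).
  apply: heq_sym; have -> : y :: (z :: rcons (y :: r) z) ++ [:: y] =
    [::] ++ y :: z :: y :: rcons (rcons r z) y by rewrite cats1.
  exact: H_back.
apply: (@heq_trans _ _ _ (map pt (y :: [:: z] ++ [:: y]))).
  apply: (@H_catl [:: y] z (rcons (y :: r) z ++ [:: y]) [:: y]).
  exact: (@H_catr [:: y] _ _ h).
exact: (@H_back y z [::] [::]).
Qed.

Lemma ctr_rot i c : cycle st c -> ctr c -> ctr (rot i c).
Proof.
move=> cyc h; elim: i => [|i IH]; first by rewrite rot0.
have [ic|ci] := ltnP i (size c); last by rewrite rot_oversize// ltnW.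
by rewrite rotS//; apply: ctr_rot1 => //; rewrite rot_cycle.
Qed.

Lemma ctr_unrot i c : cycle st c -> ctr (rot i c) -> ctr c.
Proof.
move=> cyc h; rewrite -(rotK i c) /rotr.
by apply: ctr_rot h; rewrite rot_cycle.
Qed.

(** Inside [box K] the push to [diagv] moves towards [(-K, -K)] and lowers the distance by 2. The
    successor gives every vertex a positive weight, so splitting off a closed piece lowers the total
    as well. *)
Definition wt (K : int) (z : vtx) : nat := (absz (z.1 + K) + absz (z.2 + K)).+1.
Definition box (K : int) (z : vtx) : bool := (- K < z.1) && (- K < z.2).

Lemma wt_diag K x : box K (leftv x) -> box K (belowv x) -> (wt K (diagv x) < wt K x)%N.
Proof. by rewrite /box /wt /=; lia. Qed.

Lemma box_diag K x : box K (leftv x) -> box K (belowv x) -> box K (diagv x).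
Proof. by rewrite /box /=; lia. Qed.

(** At the lexicographic maximum the two neighbours are distinct and smaller, hence the left one and
    the lower one. The order opposite to that of [star] is handled by reversing the walk. *)
Lemma star_any x p q m : cycle st (x :: q :: rcons m p) -> uniq (x :: q :: rcons m p) ->
  all (lexle^~ x) (x :: q :: rcons m p) ->
  Q (diagv x) /\ ((q = leftv x /\ p = belowv x) \/ (q = belowv x /\ p = leftv x)).
Proof.
move=> cyc un mx.
have xq : st x q by case/andP: cyc.
have px : st p x.
  by move: cyc; rewrite /= rcons_path last_rcons => /and3P[].
have := un; rewrite /= !inE negb_or mem_rcons inE !negb_or => /and3P[].
move=> /and3P[nxq nxp _]; rewrite mem_rcons inE negb_or => /andP[nqp _] _.
have aq : adj x q by apply: st_adj.
have ap : adj x p by apply: st_adj; rewrite 1?st_sym.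
have lq : lexle q x by move: mx => /= /and3P[].
have lp : lexle p x by move: mx; rewrite /= all_rcons => /and4P[].
have [eq|eq] := adj_lex aq lq; have [ep|ep] := adj_lex ap lp.
- by move: nqp; rewrite eq ep eqxx.
- by split; [apply: (@star x m); rewrite -eq -ep|left].
- split; last by right.
  have E : rev (q :: rcons m p) = leftv x :: rcons (rev m) (belowv x).
    by rewrite rev_cons rev_rcons eq ep.
  have pe : perm_eq (x :: leftv x :: rcons (rev m) (belowv x)) (x :: q :: rcons m p).
    by rewrite perm_cons -E perm_rev.
  apply: (@star x (rev m)).
  + rewrite -E; move: cyc; rewrite /= -/(path st x (rcons (q :: rcons m p) x)).
    rewrite -rev_path last_rcons belast_rcons rev_cons -/(rev (q :: _)).
    rewrite (eq_path (e' := st)) => [|? ?]; last by rewrite /= st_sym.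
    by rewrite [path _ _ (rcons (rcons _ q) x)]rcons_path last_rcons (st_sym q) andbC.
  + by rewrite (perm_uniq pe).
  + by rewrite (perm_all _ pe).
- by move: nqp; rewrite eq ep eqxx.
Qed.

(* Induction on the total weight. A walk with a repeated vertex splits into two
   closed walks; otherwise its lexicographically largest vertex [x] is pushed to
   [diagv x] across a square contained in [O]. *)
Lemma closed_walk_heq K n a l : (sumn (map (wt K) l) <= n)%N -> all (box K) (a :: l) ->
  path st a l -> last a l = a -> H (a :: l) [:: a].
Proof.
elim: n a l => [|n IH] a l.
  by case: l => [|b l]; [move=> *; exact: heq_refl|].
move=> wl bx pl la.
have [ul|/not_uniq_split[x [l1 [l2 [l3 E]]]]] := boolP (uniq l); last first.
  move: pl; rewrite E cat_path /= cat_path /= => /and4P[p1 sx p2 /andP[sx2 p3]].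
  have w0 : (0 < wt K x)%N by [].
  have h1 : H (x :: l2 ++ [:: x]) [:: x].
    apply: IH.
    - move: wl; rewrite E !map_cat /= !map_cat /= !sumn_cat /= !sumn_cat /=; lia.
    - by move: bx; rewrite E /= !all_cat /= !all_cat /= !andbT => /and3P[_ _ /and3P[-> -> _]].
    - by rewrite cat_path p2 /= sx2.
    - by rewrite last_cat.
  apply: (@heq_trans _ _ _ (map pt ((a :: l1) ++ x :: l3))).
    apply: (@H_catl (a :: l1) x (l2 ++ x :: l3) l3).
    have -> : x :: l2 ++ x :: l3 = (x :: l2 ++ [:: x]) ++ l3 by rewrite /= -catA.
    exact: (@H_catr l3 _ _ h1).
  apply: IH.
  - move: wl; rewrite E !map_cat /= !map_cat /= !sumn_cat /= !sumn_cat /=; lia.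
  - by move: bx; rewrite E /= !all_cat /= !all_cat /= => /and3P[-> -> /and3P[-> _ /andP[_ ->]]].
  - by rewrite cat_path p1 /= sx.
  - by move: la; rewrite E !last_cat /= last_cat.
case/lastP: l wl bx pl la ul => [|s b]; first by move=> *; exact: heq_refl.
rewrite last_rcons => wl bx pl E; rewrite {b}E in wl bx pl * => ul.
have cyc : cycle st (a :: s) by [].
have pe : perm_eq (a :: s) (rcons s a) by rewrite perm_sym perm_rcons.
have uc : uniq (a :: s) by rewrite (perm_uniq pe).
suff : ctr (a :: s) by [].
case: s wl bx pl ul cyc pe uc => [|y [|y' s]] wl bx pl ul cyc pe uc.
- exact: heq_stut.
- by apply: (@H_back a y [::] [::]); case/andP: pl.
set c := a :: _ in cyc pe uc *.
have [x xc mx] := lexle_max a [:: y, y' & s]; rewrite -/c in xc mx.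
have [i s' rs] := rot_to xc.
have sz : size (rot i c) = (size s).+3 by rewrite size_rot.
move: sz; rewrite rs; case/lastP: s' rs => [//|m' p] rs.
case: m' rs => [//|q m] rs _; rewrite rcons_cons in rs.
have pr : perm_eq (x :: q :: rcons m p) c by rewrite -rs perm_rot.
have cyc' : cycle st (x :: q :: rcons m p) by rewrite -rs rot_cycle.
have un' : uniq (x :: q :: rcons m p) by rewrite -rs rot_uniq.
have mx' : all (lexle^~ x) (x :: q :: rcons m p) by rewrite (perm_all _ pr).
have [Qx pq] := star_any cyc' un' mx'.
have [C [cC CO [Cx Cl Cb Cd]]] := Q_conv Qx.
have [sl sb] := Q_st Qx.
have bx' : all (box K) (x :: q :: rcons m p).
  by rewrite (perm_all _ pr) (perm_all _ pe); case/andP: bx.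
have bq : box K q by move: bx' => /= /and3P[].
have bp : box K p by move: bx'; rewrite /= all_rcons => /and4P[].
have bm : all (box K) m by move: bx'; rewrite /= all_rcons => /and4P[].
have [bl bb] : box K (leftv x) /\ box K (belowv x).
  by case: pq => -[<- <-].
have spd : st p (diagv x) by case: pq => -[_ ->].
have sdq : st (diagv x) q by rewrite st_sym; case: pq => -[-> _].
(* The same closed walk based at [q], with [x] replaced by [diagv x]: its total weight is smaller,
   so the induction hypothesis applies. *)
have h : H (q :: rcons (rcons (rcons m p) (diagv x)) q) [:: q].
  apply: IH.
  - have : sumn (map (wt K) (x :: q :: rcons m p)) = sumn (map (wt K) (rcons [:: y, y' & s] a)).
      by apply: perm_sumn; apply: perm_map; apply: perm_trans pr pe.
    move=> E1; move: (wt_diag bl bb) wl; rewrite -E1.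
    rewrite /= !map_rcons !sumn_rcons.
    move: (sumn _) (wt K x) (wt K _) (wt K q) (wt K p) => w1 w2 w3 w4 w5.
    clear; lia.
  - by rewrite /= !all_rcons bq bp bm box_diag.
  - rewrite !rcons_path !last_rcons spd sdq !andbT.
    by move: cyc'; rewrite /= !rcons_path => /andP[_ /andP[/andP[-> ->]]].
  - by rewrite last_rcons.
have h2 : ctr (q :: rcons (rcons m p) x).
  apply: (@heq_trans _ _ _ _ _ _ h).
  rewrite -!cats1 -!catA /=.
  have := @H_catl (q :: m) p [:: x; q] [:: diagv x; q]; apply.
  have [Cp Cq] : C (pt p) /\ C (pt q) by case: pq => -[-> ->].
  exact: (@heq_tri _ O C).
have E : rot 1 (rot i c) = q :: rcons (rcons m p) x by rewrite rs rot1_cons.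
apply: (@ctr_unrot i) => //; apply: (@ctr_unrot 1); first by rewrite rot_cycle.
by rewrite E.
Qed.

Lemma walk_box a l : exists K, all (box K) (a :: l).
Proof.
elim: l a => [|b l IH] a.
  by exists ((absz a.1 + absz a.2).+1%:Z); rewrite /= andbT /box; lia.
have [K hK] := IH b; exists (`|K| + (absz a.1 + absz a.2).+1%:Z).
rewrite /= -/(all _ (b :: l)); apply/andP; split; first by rewrite /box; lia.
by apply: (sub_all _ hK) => z; rewrite /box; lia.
Qed.

Lemma closed_heq a l : path st a l -> last a l = a -> H (a :: l) [:: a].
Proof. by move=> pl la; have [K hK] := walk_box a l; exact: (closed_walk_heq (leqnn _) hK). Qed.

(** Both are compared with [l] followed by [l'] reversed and then [l']: the last two pieces form a
    closed walk at the end of [l], the first two a closed walk at [a]. *)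
Lemma walks_heq a l l' : path st a l -> path st a l' -> last a l = last a l' ->
  H (a :: l) (a :: l').
Proof.
move=> p p' e.
pose r := rev (belast a l').
have pr : path st (last a l') r.
  by rewrite /r rev_path; apply: sub_path p' => x y; rewrite st_sym.
have lr : last (last a l') r = a.
  rewrite /r; case: l' {p' e pr r} => [//|b l'] /=.
  by rewrite rev_cons last_rcons.
apply: (@heq_trans _ _ _ (map pt ((a :: l) ++ (r ++ l')))).
  have -> : (a :: l) ++ (r ++ l') = belast a l ++ last a l :: (r ++ l').
    by rewrite lastI cat_rcons.
  have {1}-> : a :: l = belast a l ++ [:: last a l] by rewrite lastI cats1.
  apply: heq_sym; apply: H_catl; apply: closed_heq.
    by rewrite e cat_path pr lr.
  by rewrite last_cat e lr.
rewrite catA; apply: (@H_catr l' ((a :: l) ++ r) [:: a]).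
by apply: closed_heq; rewrite ?cat_path ?p ?last_cat e.
Qed.

End Walks.

(** * Grid walks in a bounded set without holes *)

Section Grid.
Variable R : realType.
Local Notation plane := (R * R)%type.
Variables (O : set plane) (p0 : plane) (h M : R).
Hypothesis h0 : 0 < h.
Hypothesis M0 : 0 <= M.
Hypothesis OM : forall w, O w -> nrm w <= M.
Hypothesis exits : forall w, ~ O w -> exists g : R -> plane, [/\ continuous g, g 0 = w,
  (forall t, 0 <= t <= 1 -> ~ O (g t)) & M < nrm (g 1)].

Definition pt (z : vtx) : plane := (p0.1 + z.1%:~R * h, p0.2 + z.2%:~R * h).
Definition cx (w : plane) : R := (w.1 - p0.1) / h.
Definition cy (w : plane) : R := (w.2 - p0.2) / h.

(** Equality is allowed because consecutive samples of a path may fall into the same row or column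
    of the grid. *)
Definition st : rel vtx := fun a b =>
  ((a == b) || adj a b) && `[< forall s, 0 <= s <= 1 -> O (seg (pt a) (pt b) s) >].

Definition sq (z : vtx) : set plane := [set w |
  z.1%:~R <= cx w <= z.1%:~R + 1 /\ z.2%:~R <= cy w <= z.2%:~R + 1].

Definition Qsq (z : vtx) : Prop := sq z `<=` O.

Lemma cx_pt z : cx (pt z) = z.1%:~R.
Proof. by rewrite /cx /= addrC addKr mulfK// gt_eqF. Qed.

Lemma cy_pt z : cy (pt z) = z.2%:~R.
Proof. by rewrite /cy /= addrC addKr mulfK// gt_eqF. Qed.

Lemma cx_seg a b t : cx (seg a b t) = cx a + t * (cx b - cx a).
Proof. by rewrite /cx segE /=; field; rewrite gt_eqF. Qed.

Lemma cy_seg a b t : cy (seg a b t) = cy a + t * (cy b - cy a).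
Proof. by rewrite /cy segE /=; field; rewrite gt_eqF. Qed.

Lemma cxy_inj a b : cx a = cx b -> cy a = cy b -> a = b.
Proof.
rewrite /cx /cy => /(congr1 (fun z => z * h)) + /(congr1 (fun z => z * h)).
have hn : h != 0 by rewrite gt_eqF.
rewrite !divfK// => e1 e2.
by rewrite [a]surjective_pairing [b]surjective_pairing; congr pair; lra.
Qed.

Lemma itv_seg (l u x y t : R) : l <= x <= u -> l <= y <= u -> 0 <= t <= 1 ->
  l <= x + t * (y - x) <= u.
Proof. by move=> /andP[? ?] /andP[? ?] /andP[? ?]; apply/andP; split; nra. Qed.

Lemma seg_rev (a b : plane) s : seg a b s = seg b a (1 - s).
Proof. by rewrite !segE; congr pair; ring. Qed.

Lemma adj_sym a b : adj a b = adj b a.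
Proof. by move: a b => [a1 a2] [b1 b2]; rewrite /adj !xpair_eqE /=; lia. Qed.

Lemma st_sym : symmetric st.
Proof.
move=> a b; rewrite /st eq_sym adj_sym; congr (_ && _).
by apply/asboolP/asboolP => H s /andP[s0 s1]; rewrite seg_rev; apply: H; apply/andP; split; lra.
Qed.

Lemma st_adj a b : st a b -> a != b -> adj a b.
Proof. by move=> /andP[/orP[->//|//]]. Qed.

Lemma st_seg a b s : st a b -> 0 <= s <= 1 -> O (seg (pt a) (pt b) s).
Proof. by move=> /andP[_ /asboolP H]; exact: H. Qed.

Lemma st_conv a b : st a b -> exists C, [/\ conv C, C `<=` O, C (pt a) & C (pt b)].
Proof.
move=> sab; exists (seg (pt a) (pt b) @` [set s | 0 <= s <= 1]); split.
- move=> _ _ t [s /= s01 <-] [r /= r01 <-] t01.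
  exists (s + t * (r - s)); first exact: itv_seg.
  rewrite -[RHS]/(seg (seg (pt a) (pt b) s) (seg (pt a) (pt b) r) t) !segE.
  by congr pair => /=; ring.
- by move=> _ [s s01 <-]; exact: st_seg.
- by exists 0; rewrite ?seg0//= lexx ler01.
- by exists 1; rewrite ?seg1//= lexx ler01.
Qed.

Lemma sq_conv z : conv (sq z).
Proof.
move=> a b t [a1 a2] [b1 b2] t01; rewrite -/(seg a b t) /sq /= cx_seg cy_seg.
by split; apply: itv_seg.
Qed.

Lemma sq_corners x : [/\ sq (diagv x) (pt x), sq (diagv x) (pt (leftv x)),
  sq (diagv x) (pt (belowv x)) & sq (diagv x) (pt (diagv x))].
Proof.
by split; split; rewrite ?cx_pt ?cy_pt /= ?intrB; apply/andP; split; lra.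
Qed.

Lemma Q_conv x : Qsq (diagv x) -> exists C, [/\ conv C, C `<=` O &
  [/\ C (pt x), C (pt (leftv x)), C (pt (belowv x)) & C (pt (diagv x))]].
Proof.
by move=> Qx; exists (sq (diagv x)); split => //; [exact: sq_conv|exact: sq_corners].
Qed.

Lemma Q_st x : Qsq (diagv x) -> st (leftv x) (diagv x) /\ st (belowv x) (diagv x).
Proof.
move=> Qx; have [c1 c2 c3 c4] := sq_corners x.
split; apply/andP; split.
- by apply/orP; right; rewrite /adj /= !xpair_eqE; lia.
- by apply/asboolP => s s01; apply: Qx; exact: sq_conv.
- by apply/orP; right; rewrite /adj /= !xpair_eqE; lia.
- by apply/asboolP => s s01; apply: Qx; exact: sq_conv.
Qed.

Definition consec (l : seq vtx) u v := exists l1 l2, l = l1 ++ u :: v :: l2.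

Lemma PL_consec a b l t : exists u v s, [/\ consec (a :: b :: l) u v, 0 <= s <= 1 &
  PL (map pt (a :: b :: l)) t = seg (pt u) (pt v) s].
Proof.
elim: l a b t => [|c l IH] a b t.
  exists a, b, (clamp 0 1 t); split; [by exists [::], [::]|exact: clamp01_in|].
  by rewrite [map _ _]/= PL_cons /PL subrr addr0.
have [t1|t1] := leP t 1.
  exists a, b, (clamp 0 1 t); split; [by exists [::], (c :: l)|exact: clamp01_in|].
  exact: PL_le1.
have [u [v [s [[l1 [l2 E]] s01 e]]]] := IH b c (t - 1).
exists u, v, s; split => //; first by exists (a :: l1), l2; rewrite E.
by rewrite -e; apply: PL_ge1; exact: ltW.
Qed.

Lemma consec_st a l u v : path st a l -> consec (a :: l) u v -> st u v.
Proof.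
move=> p [[|c l1] [l2]] /=; case=> E El.
  by move: p; rewrite E El => /andP[].
by move: p; rewrite El cat_path /= => /and4P[].
Qed.

Lemma consec_index l u v : uniq l -> consec l u v -> index v l = (index u l).+1.
Proof.
move=> un [l1 [l2 E]]; move: un; rewrite E cat_uniq /= => /and3P[_ H /andP[un _]].
have [ul vl] : u \notin l1 /\ v \notin l1.
  by move: H; rewrite /= !negb_or => /and3P[].
rewrite !index_cat (negbTE ul) (negbTE vl) /= eqxx.
by move: un; rewrite inE negb_or => /andP[/negbTE -> _]; rewrite eqxx addn0 addn1.
Qed.

Lemma int_close (k l : int) : `|k%:~R - l%:~R| < 1 :> R -> k = l.
Proof.
rewrite -intrB -intr_norm (_ : 1 = 1%:~R)// ltr_int => H; lia.
Qed.

Lemma edge_int u v s : (u == v) || adj u v ->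
  exists k : int, cx (seg (pt u) (pt v) s) = k%:~R \/ cy (seg (pt u) (pt v) s) = k%:~R.
Proof.
move: u v => [u1 u2] [v1 v2]; rewrite /adj /= !xpair_eqE !cx_seg !cy_seg !cx_pt !cy_pt /=.
move=> H; have [/andP[/eqP-> _]|/eqP->] : (u1 == v1) && true \/ u2 == v2.
- by rewrite andbT; lia.
- by exists v1; left; rewrite subrr mulr0 addr0.
- by exists v2; right; rewrite subrr mulr0 addr0.
Qed.

(** Near the midpoint [cx] lies strictly between consecutive integers, which excludes vertical
    edges, and the nearest integer to [cy] fixes the row; a horizontal edge is then determined. *)
Lemma edge_mid x u v s : (u == v) || adj u v -> 0 <= s <= 1 ->
  `|cx (seg (pt u) (pt v) s) - (x.1%:~R - 2^-1)| < 2^-1 ->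
  `|cy (seg (pt u) (pt v) s) - x.2%:~R| < 2^-1 ->
  (u = leftv x /\ v = x) \/ (u = x /\ v = leftv x).
Proof.
move: u v x => [u1 u2] [v1 v2] [x1 x2]; rewrite /leftv !cx_seg !cy_seg !cx_pt !cy_pt /=.
rewrite !ltr_norml => H /andP[s0 s1] /andP[c1 c2] /andP[c3 c4].
have hv (k : int) : k%:~R - (x1%:~R - 2^-1) < 2^-1 :> R -> k <= x1 - 1.
  move=> K; have : k%:~R < x1%:~R :> R by lra.
  by rewrite ltr_int; clear; lia.
have hv' (k : int) : - 2^-1 < k%:~R - (x1%:~R - 2^-1) :> R -> x1 <= k.
  move=> K; have : (x1 - 1)%:~R < k%:~R :> R by rewrite intrB; lra.
  by rewrite ltr_int; clear; lia.
have vert : u1 != v1.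
  apply/negP => /eqP E; move: c1 c2; rewrite E subrr mulr0 addr0 => /hv' + /hv; clear; lia.
have E2 : u2 = v2.
  by move: H vert; clear; rewrite /adj /= !xpair_eqE; lia.
move: c3 c4; rewrite E2 subrr mulr0 addr0 => c3 c4.
have E3 : v2 = x2 by apply: int_close; rewrite ltr_norml; apply/andP; split; lra.
have [E|E] : v1 = u1 + 1 \/ u1 = v1 + 1 by move: H vert; clear; rewrite /adj /= !xpair_eqE; lia.
  left; move: c1 c2; rewrite E intrD => c1 c2.
  have : u1%:~R < x1%:~R :> R by nra.
  have : (x1 - 2)%:~R < u1%:~R :> R by rewrite intrB; nra.
  rewrite !ltr_int => k1 k2; rewrite E3; move: k1 k2; clear; split; congr pair; lia.
right; move: c1 c2; rewrite E intrD => c1 c2.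
have : v1%:~R < x1%:~R :> R by nra.
have : (x1 - 2)%:~R < v1%:~R :> R by rewrite intrB; nra.
rewrite !ltr_int => k1 k2; rewrite E3; move: k1 k2; clear; split; congr pair; lia.
Qed.

Lemma nrm_ge2 (w : plane) : `|w.2| <= nrm w.
Proof. by rewrite -sqrtr_sqr ler_wsqrtr// /dot -!expr2 lerDr sqr_ge0. Qed.

Lemma affine_cont (a b : plane) : continuous (fun t : R => seg a b t).
Proof.
by move=> t; apply: (@cont_seg _ _ t (fun=> a) (fun=> b) id); [exact: cvg_cst|exact: cvg_cst|exact: cvg_id].
Qed.

(* The argument variation along the polygon jumps across the edge from [leftv x]
   to [x]. Above this edge it has its value at infinity; it would have the same
   value on the square below if a point of the square could escape off [O]. *)
Lemma star x m : cycle st (x :: leftv x :: rcons m (belowv x)) ->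
  uniq (x :: leftv x :: rcons m (belowv x)) ->
  all (lexle^~ x) (x :: leftv x :: rcons m (belowv x)) -> Qsq (diagv x).
Proof.
set y := leftv x; set b := belowv x => cyc un mx.
pose L := y :: rcons (rcons m b) x.
have pL : path st y (rcons (rcons m b) x) by case/andP: cyc.
have sxy : st x y by case/andP: cyc.
have peL : perm_eq L (x :: y :: rcons m b) by rewrite /L -[y :: rcons _ x]rcons_cons perm_rcons.
have uL : uniq L by rewrite (perm_uniq peL).
have mL z : z \in L -> z.2 <= x.2.
  rewrite (perm_mem peL) => zL; have := allP mx z zL; rewrite /lexle /=; clear; lia.
pose al := seg (pt y) (pt x).
(* [L] has [size m + 3] vertices, so after this rescaling [ga] reaches [pt x] exactly at time 1. *)
pose n : R := (size m).+2%:R.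
pose ga t := PL (map pt L) (t * n).
have n0 : 0 < n by rewrite ltr0n.
have cal : continuous al by exact: affine_cont.
have cga : continuous ga.
  move=> t; apply: (@continuous_comp _ _ _ (fun t : R => t * n) (PL (map pt L))); last exact: PL_cont.
  by apply: cvgM; [exact: cvg_id|exact: cvg_cst].
have al0 : al 0 = pt y by rewrite /al seg0.
have al1 : al 1 = pt x by rewrite /al seg1.
have ga0 : ga 0 = pt y by rewrite /ga mul0r; apply: PL_le0.
have ga1 : ga 1 = pt x.
  rewrite /ga mul1r PL_last ?last_map ?last_rcons// size_map !size_rcons.
  exact: lexx.
have gaL w : trk ga w -> exists u v s, [/\ consec L u v, 0 <= s <= 1 & w = seg (pt u) (pt v) s].
  move=> [t _ <-]; rewrite /ga /L; case: (m) => [|c m'].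
    by have [u [v [s [? ? ->]]]] := PL_consec y b [:: x] (t * n); exists u, v, s.
  by have [u [v [s [? ? ->]]]] := PL_consec y c (rcons (rcons m' b) x) (t * n); exists u, v, s.
pose Z w := trk al w \/ trk ga w.
have ZE w : Z w -> exists u v s, [/\ st u v, (u.2 <= x.2) && (v.2 <= x.2), 0 <= s <= 1 &
    w = seg (pt u) (pt v) s].
  move=> [[s s01 <-]|/gaL[u [v [s [cuv s01 ->]]]]].
    by exists y, x, s; split => //; rewrite 1?st_sym//= lexx.
  exists u, v, s; split => //; first exact: consec_st pL cuv.
  by case: cuv => l1 [l2 E]; rewrite !mL// E mem_cat !inE !eqxx ?orbT.
have ZO w : Z w -> O w by move=> /ZE[u [v [s [suv _ s01 ->]]]]; exact: st_seg.
have Zy w : Z w -> cy w <= x.2%:~R.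
  move=> /ZE[u [v [s [_ /andP[u2 v2] /andP[s0 s1] ->]]]]; rewrite cy_seg !cy_pt.
  by move: u2 v2; rewrite -(ler_int R) -(ler_int R v.2) => ? ?; nra.
have Zsq w : Z w -> x.1%:~R - 1 < cx w < x.1%:~R -> x.2%:~R - 1 < cy w < x.2%:~R -> False.
  move=> /ZE[u [v [s [/andP[suv _] _ s01 ->]]]] /andP[a1 a2] /andP[b1 b2].
  have [k [E|E]] := edge_int s suv.
    have : (x.1 - 1)%:~R < k%:~R :> R by rewrite intrB -E.
    have : k%:~R < x.1%:~R :> R by rewrite -E.
    by rewrite !ltr_int; clear; lia.
  have : (x.2 - 1)%:~R < k%:~R :> R by rewrite intrB -E.
  have : k%:~R < x.2%:~R :> R by rewrite -E.
  by rewrite !ltr_int; clear; lia.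
(* [al] and [ga] both run from [pt y] to [pt x], one along the top edge and one along the rest of
   the polygon; their difference measures the winding of the closed polygon. *)
pose N w := ang al w - ang ga w.
have Npath (g : R -> plane) : continuous g -> (forall t, 0 <= t <= 1 -> ~ Z (g t)) -> N (g 0) = N (g 1).
  move=> cg gZ; apply: path_const => // t t01; have nz := gZ t t01.
  have n1 : ~ trk al (g t) by move=> ?; apply: nz; left.
  have n2 : ~ trk ga (g t) by move=> ?; apply: nz; right.
  split; first by apply: cvgB; exact: ang_cont.
  rewrite -(subrr (arg (pt x - g t) - arg (pt y - g t))); apply: eqmB.
    by rewrite -al0 -al1; exact: ang_eqm.
  by rewrite -ga0 -ga1; exact: ang_eqm.
have Nseg u v : (forall t, 0 <= t <= 1 -> ~ Z (seg u v t)) -> N u = N v.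
  by move=> /(Npath _ (@affine_cont u v)); rewrite seg0 seg1.
have Nfar u v : M < nrm u -> M < nrm v -> N u = N v.
  move=> Mu Mv; have [g [cg g0 g1 gM]] := far_path M0 Mu Mv.
  rewrite -g0 -g1; apply: Npath => // t /gM Mg /ZO /OM; rewrite leNgt => /negP; exact.
(* No vertex of the polygon is higher than [x], so the vertical ray upwards from such a point avoids
   it. *)
have Nup u : x.2%:~R < cy u -> exists2 v, M < nrm v & N u = N v.
  move=> uy; pose v : plane := (u.1, `|u.2| + M + 1 + `|p0.2| + h * `|cy u|).
  have Mv : M < nrm v.
    apply: lt_le_trans (nrm_ge2 v); apply: lt_le_trans (ler_norm _); rewrite /v /=.
    have := normr_ge0 u.2; have := normr_ge0 p0.2; have := mulr_ge0 (ltW h0) (normr_ge0 (cy u)); lra.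
  exists v => //; apply: Nseg => t t01 /Zy; rewrite leNgt => /negP; apply.
  rewrite cy_seg; have : cy u <= cy v.
    rewrite /cy ler_pM2r ?invr_gt0// lerB// /v /=.
    have := ler_norm u.2; have := normr_ge0 p0.2; have := mulr_ge0 (ltW h0) (normr_ge0 (cy u)); have := M0; lra.
  by case/andP: t01 => ? ? ?; nra.
have Nlow u v : x.1%:~R - 1 <= cx u <= x.1%:~R -> x.2%:~R - 1 <= cy u <= x.2%:~R -> ~ Z u ->
    x.1%:~R - 1 < cx v < x.1%:~R -> x.2%:~R - 1 < cy v < x.2%:~R -> N u = N v.
  move=> /andP[a1 a2] /andP[b1 b2] nu /andP[c1 c2] /andP[d1 d2]; apply: Nseg => t /andP[t0 t1].
  have [->|tn] := eqVneq t 0; first by rewrite seg0.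
  have tp : 0 < t by rewrite lt_neqAle eq_sym tn.
  by move=> /Zsq; apply; rewrite ?cx_seg ?cy_seg; apply/andP; split; nra.
have bE w : ball (al 2^-1) (h / 2) w ->
    `|cx w - (x.1%:~R - 2^-1)| < 2^-1 /\ `|cy w - x.2%:~R| < 2^-1.
  have hE (r s : R) : `|r - s| < h / 2 -> `|s / h - r / h| < 2^-1.
    rewrite -mulrBl normrM distrC normfV (gtr0_norm h0) => ?.
    by rewrite ltr_pdivrMr// mulrC.
  have e1 : x.1%:~R - 2^-1 = ((al 2^-1).1 - p0.1) / h.
    have := cx_seg (pt y) (pt x) 2^-1; rewrite !cx_pt /cx => ->; rewrite /y /= intrB; lra.
  have e2 : x.2%:~R = ((al 2^-1).2 - p0.2) / h.
    have := cy_seg (pt y) (pt x) 2^-1; rewrite !cy_pt /cy => ->; rewrite /y /=; lra.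
  move=> /planeballE[k1 k2]; rewrite e1 e2 /cx /cy; split; apply: hE.
    by rewrite opprB addrA subrK.
  by rewrite opprB addrA subrK.
(* Only the edge between [y] and [x] comes this close to its midpoint, and [ga] does not use it: [y]
   is first in [L], [x] is last, and at least one vertex lies between them. *)
have bga w : ball (al 2^-1) (h / 2) w -> ~ trk ga w.
  move=> /bE[k1 k2] /gaL[u [v [s [cuv s01 E]]]].
  have /andP[suv _] := consec_st pL cuv.
  have ix : index x L = (size m).+2.
    rewrite /L /= ifN; last by move: un => /= /andP[]; rewrite inE negb_or eq_sym => /andP[].
    rewrite -cats1 index_cat ifN; last first.
      by move: un => /= /andP[]; rewrite inE negb_or => /andP[_].
    by rewrite /= eqxx addn0 size_rcons.
  have iy : index y L = 0%N by rewrite /L /= eqxx.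
  have := consec_index uL cuv.
  rewrite E in k1 k2; have [[-> ->]|[-> ->]] := edge_mid suv s01 k1 k2.
    by rewrite ix iy.
  by rewrite ix iy.
have ial s t : 0 <= s <= 1 -> 0 <= t <= 1 -> al s = al t -> s = t.
  by move=> _ _ /(congr1 cx); rewrite /al !cx_seg !cx_pt /y /= intrB; lra.
have [a [c [Ba Bc na nc]]] : exists a c, [/\ ball (al 2^-1) (h / 2) a, ball (al 2^-1) (h / 2) c,
    ~ trk al a, ~ trk al c & N a != N c].
  apply: jump => //.
  - by apply/andP; split; lra.
  - by rewrite divr_gt0.
  move=> w /bga nw; split; first exact: ang_cont.
  by rewrite al0 al1 -ga0 -ga1; exact: ang_eqm.
move=> /eqP nac w0 [/=]; rewrite !intrB => q1 q2; apply: contrapT => w0O.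
have w0Z : ~ Z w0 by move=> /ZO.
have [g [cg g0 gO gM]] := exits w0O.
have far_w0 : N w0 = N (g 1).
  by rewrite -g0; apply: Npath => // t t01 /ZO; exact: gO.
have q1' : x.1%:~R - 1 <= cx w0 <= x.1%:~R by move: q1 => /andP[]; rewrite subrK => -> ->.
have q2' : x.2%:~R - 1 <= cy w0 <= x.2%:~R by move: q2 => /andP[]; rewrite subrK => -> ->.
(* Points above the edge are joined to infinity, as [w0] is by assumption, and points below are
   joined to [w0] inside the square; equal values on both sides contradict the jump. *)
have key u : ball (al 2^-1) (h / 2) u -> ~ trk al u -> N u = N w0.
  move=> Bu nu; have [k1 k2] := bE u Bu.
  move: k1 k2; rewrite !ltr_norml => /andP[k1 k2] /andP[k3 k4].
  have [cu|cu|cu] := ltgtP (cy u) x.2%:~R.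
  - symmetry; apply: Nlow => //; apply/andP; split; lra.
  - by have [v Mv ->] := Nup u cu; rewrite far_w0; exact: Nfar.
  exfalso; apply: nu; exists (cx u - (x.1%:~R - 1)).
    by apply/andP; split; lra.
  apply: cxy_inj; rewrite /al ?cx_seg ?cy_seg ?cx_pt ?cy_pt /y /= ?intrB; last by lra.
  ring.
by apply: nac; rewrite !key.
Qed.

Lemma grid_walks a l l' : path st a l -> path st a l' -> last a l = last a l' ->
  heq O (map pt (a :: l)) (map pt (a :: l')).
Proof. exact: (walks_heq st_sym st_adj st_conv Q_conv Q_st star). Qed.

End Grid.

(** * Approximating a path by a grid walk *)

Section Sampling.
Variable R : realType.
Local Notation plane := (R * R)%type.
Variables (O : set plane) (p0 : plane) (h : R).
Hypothesis h0 : 0 < h.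

Local Notation pt := (pt p0 h).
Local Notation st := (st O p0 h).
Local Notation cx := (cx p0 h).
Local Notation cy := (cy p0 h).

Definition fl (w : plane) : vtx := (Num.floor (cx w), Num.floor (cy w)).
Definition corner (a b : plane) : vtx := ((fl b).1, (fl a).2).

(** The path is sampled at integer times. Consecutive samples lie in equal or neighbouring columns
    and rows and are linked through [corner], first horizontally and then vertically, hence two
    steps per unit of time. *)
Fixpoint swk (g : R -> plane) (n : nat) : seq vtx :=
  if n is n'.+1 then corner (g 0) (g 1) :: fl (g 1) :: swk (fun t => g (t + 1)) n' else [::].

(** The collar of width [4 * h] has room for a drift of [h] within one unit of time and for the grid
    points used, which are less than [2 * h] away from the sample. *)
Definition small (g : R -> plane) :=
  (forall s t, `|s - t| <= 1 -> ball (g s) h (g t)) /\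
  (forall s z, ball (g s) (4 * h) z -> O z).

Lemma small_shift g : small g -> small (fun t => g (t + 1)).
Proof.
move=> [g1 g2]; split => [s t st|s z]; last exact: g2.
by apply: g1; rewrite opprD addrACA subrr addr0.
Qed.

Lemma coord_floor (q r x : R) : x = (q - r) / h ->
  - h < r + (Num.floor x)%:~R * h - q <= 0.
Proof.
move=> E; have : q = r + x * h by rewrite E divfK ?gt_eqF// addrC subrK.
have /andP[k1 k2] : (Num.floor x)%:~R <= x < (Num.floor x + 1)%:~R by exact: floor_itv.
move: k2; rewrite intrD => k2 ->.
have m1 : 0 < h * ((Num.floor x)%:~R + 1%:~R - x) by rewrite mulr_gt0// subr_gt0.
have m2 : 0 <= h * (x - (Num.floor x)%:~R) by rewrite mulr_ge0 ?subr_ge0// ltW.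
by apply/andP; split; lra.
Qed.

Lemma conv_norm_lt (x y t e : R) : `|x| < e -> `|y| < e -> 0 <= t <= 1 ->
  `|x + t * (y - x)| < e.
Proof.
move=> xe ye /andP[t0 t1]; pose m := Num.max `|x| `|y|.
have me : m < e by rewrite gt_max xe.
apply: le_lt_trans me.
have : `|x| <= m by rewrite le_max lexx.
have : `|y| <= m by rewrite le_max lexx orbT.
rewrite !ler_norml => /andP[y1 y2] /andP[x1 x2].
have := mulr_ge0 t0 (_ : 0 <= m - y); have := mulr_ge0 t0 (_ : 0 <= m + y).
have := @mulr_ge0 _ (1 - t) (m - x); have := @mulr_ge0 _ (1 - t) (m + x).
rewrite !subr_ge0 => k1 k2 k3 k4; have {}k1 := k1 t1; have {}k2 := k2 t1 x2.
have {}k4 := k4 y2.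
have {}k1 : 0 <= (1 - t) * (m + x) by apply: k1; lra.
have {}k3 : 0 <= t * (m + y) by apply: k3; lra.
by apply/andP; split; lra.
Qed.

Lemma ball_seg (w a b : plane) e t : ball w e a -> ball w e b -> 0 <= t <= 1 ->
  ball w e (seg a b t).
Proof.
move=> /planeballE[a1 a2] /planeballE[b1 b2] t01; apply/planeballE.
have E (x y z : R) : x - (y + t * (z - y)) = (x - y) + t * ((x - z) - (x - y)) by ring.
by rewrite segE /= !E; split; apply: conv_norm_lt.
Qed.

Lemma ball_corner (a b : plane) : ball a h b ->
  [/\ ball a (2 * h) (pt (fl a)), ball a (2 * h) (pt (corner a b)) & ball a (2 * h) (pt (fl b))].
Proof.
move=> /planeballE; rewrite !ltr_norml => -[/andP[k1 k2] /andP[k3 k4]].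
have /andP[a1 a2] := coord_floor (erefl (cx a)).
have /andP[a3 a4] := coord_floor (erefl (cy a)).
have /andP[b1 b2] := coord_floor (erefl (cx b)).
have /andP[b3 b4] := coord_floor (erefl (cy b)).
by split; apply/planeballE; rewrite /= !ltr_norml; split; apply/andP; split; lra.
Qed.

Lemma floor_close (x y : R) : `|x - y| < 1 ->
  [|| Num.floor y == Num.floor x, Num.floor y == Num.floor x + 1 | Num.floor y == Num.floor x - 1].
Proof.
rewrite ltr_norml => /andP[k1 k2].
have /andP[a1 a2] : (Num.floor x)%:~R <= x < (Num.floor x + 1)%:~R by exact: floor_itv.
have /andP[b1 b2] : (Num.floor y)%:~R <= y < (Num.floor y + 1)%:~R by exact: floor_itv.
have : (Num.floor x)%:~R < (Num.floor y + 2)%:~R :> R by move: a2 b2; rewrite !intrD; lra.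
have : (Num.floor y)%:~R < (Num.floor x + 2)%:~R :> R by move: a2 b2; rewrite !intrD; lra.
by rewrite !ltr_int; move: (Num.floor x) (Num.floor y); clear; lia.
Qed.

Lemma ball_cx (a b : plane) : ball a h b -> `|cx a - cx b| < 1 /\ `|cy a - cy b| < 1.
Proof.
have H (r s t : R) : `|r - s| < h -> `|(r - t) / h - (s - t) / h| < 1.
  move=> rs; rewrite -mulrBl opprB addrA subrK normrM normfV (gtr0_norm h0).
  by rewrite ltr_pdivrMr// mul1r.
by move=> /planeballE[k1 k2]; split; apply: H.
Qed.

Lemma st_corner g : small g ->
  st (fl (g 0)) (corner (g 0) (g 1)) /\ st (corner (g 0) (g 1)) (fl (g 1)).
Proof.
move=> [g1 g2]; have B : ball (g 0) h (g 1) by apply: g1; rewrite sub0r normrN normr1.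
have [c1 c2 c3] := ball_corner B; have [k1 k2] := ball_cx B.
have e1 := floor_close k1; have e2 := floor_close k2.
have bO a b s : ball (g 0) (2 * h) a -> ball (g 0) (2 * h) b -> 0 <= s <= 1 -> O (seg a b s).
  move=> Ba Bb s01; apply: (g2 0); apply: (@le_ball _ _ _ (2 * h)).
    by rewrite ler_pM2r// ler_nat.
  exact: ball_seg.
split; apply/andP; split; try by apply/asboolP => s s01; exact: bO.
  rewrite /fl /corner /adj /= !xpair_eqE; move: e1; clear.
  by move: (Num.floor _) (Num.floor _) (Num.floor _) => *; lia.
rewrite /fl /corner /adj /= !xpair_eqE; move: e2; clear.
by move: (Num.floor (cx _)) (Num.floor _) (Num.floor _) => *; lia.
Qed.

Lemma swk_path g n : small g -> path st (fl (g 0)) (swk g n).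
Proof.
elim: n g => [//|n IH] g sg /=; have [-> ->] := st_corner sg.
by have := IH _ (small_shift sg); rewrite add0r.
Qed.

Lemma swk_last g n : last (fl (g 0)) (swk g n) = fl (g n%:R).
Proof.
elim: n g => [//|n IH] g /=.
by have := IH (fun t => g (t + 1)); rewrite add0r natr1.
Qed.

Lemma swk_size g n : size (swk g n) = (2 * n)%N.
Proof. by elim: n g => [//|n IH] g /=; rewrite IH; lia. Qed.

Lemma okl_walk a l z : path st a l -> O (pt a) ->
  (forall s, 0 <= s <= 1 -> O (seg (pt (last a l)) z s)) -> okl O (map pt (a :: l) ++ [:: z]).
Proof.
elim: l a => [|b l IH] a /=.
  move=> _ Oa Oz; split => //; split => //; split => //.
  by have := Oz 1; rewrite seg1; apply; rewrite ler01 lexx.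
move=> /andP[ab pl] Oa Oz; split => //; split; first by move=> s; exact: st_seg.
apply: IH => //; have := st_seg ab (_ : 0 <= 1 <= 1); rewrite seg1; apply.
by rewrite ler01 lexx.
Qed.

Definition poly g n := map pt (fl (g 0) :: swk g n) ++ [:: g n%:R].

Lemma polyE g n : poly g n = pt (fl (g 0)) :: (map pt (swk g n) ++ [:: g n%:R]).
Proof. by []. Qed.

Lemma h3 : h + 2 * h <= 4 * h.
Proof. by have := h0; lra. Qed.

(** Two polygon edges correspond to one unit of time of [g], whence the argument [t / 2]; the clamp
    covers the last edge, which leads to the exact endpoint while [g] rests. *)
Lemma poly_close n g t : small g -> ball (g (clamp 0 n%:R (t / 2))) (4 * h) (PL (poly g n) t).
Proof.
elim: n g t => [|n IH] g t sg.
  have -> : clamp 0 0%:R (t / 2) = 0.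
    by have [t0|t0] := leP (t / 2) 0; [rewrite clamp_l|rewrite clamp_r// ltW].
  have -> : poly g 0 = [:: pt (fl (g 0)); g 0] by [].
  rewrite PL_cons /PL subrr addr0.
  have B : ball (g 0) h (g 0) by exact: ballxx.
  have [c1 _ _] := ball_corner B.
  apply: ball_seg; last exact: clamp01_in.
    by apply: le_ball c1; rewrite ler_pM2r// ler_nat.
  by apply: ballxx; rewrite mulr_gt0.
have E : poly g n.+1 = pt (fl (g 0)) :: pt (corner (g 0) (g 1)) :: poly (fun t => g (t + 1)) n.
  by rewrite /poly /= add0r natr1.
have B : ball (g 0) h (g 1) by apply: sg.1; rewrite sub0r normrN normr1.
have [c1 c2 c3] := ball_corner B.
have near_ s a : 0 <= s <= 1 -> ball (g 0) (2 * h) a -> ball (g s) (4 * h) a.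
  move=> /andP[s0 s1] ga; have gs : ball (g s) h (g 0).
    by apply: sg.1; rewrite subr0 ger0_norm.
  have := ball_triangle gs ga; apply: le_ball.
  exact: h3.
have E' : poly (fun t => g (t + 1)) n = pt (fl (g 1)) :: behead (poly (fun t => g (t + 1)) n).
  by rewrite /poly /= add0r.
have n1 : 0 <= n.+1%:R :> R by [].
have cl : t <= 2 -> 0 <= clamp 0 n.+1%:R (t / 2) <= 1.
  move=> t2; have /andP[-> _] := clamp_itv (t / 2) n1.
  by rewrite /clamp ge_max ler01 /= ge_min orbC (_ : t / 2 <= 1)//; lra.
have [t1|t1] := leP t 1.
  rewrite E PL_le1//; apply: near_; first by apply: cl; lra.
  by apply: ball_seg => //; exact: clamp01_in.
have [t2|t2] := leP t 2.
  rewrite E PL_ge1 ?ltW// E' PL_le1; last by lra.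
  apply: near_; first exact: cl.
  by apply: ball_seg => //; exact: clamp01_in.
rewrite E PL_ge1 ?ltW// E' PL_ge1; last by lra.
rewrite -E'; have := IH _ (t - 1 - 1) (small_shift sg).
congr (ball (g _) _ _).
rewrite /clamp /Num.max /Num.min; have := ler0n R n; rewrite -[n.+1%:R]natr1 => n0.
by do ! case: ifP => [?|/negbT]; rewrite -?leNgt; lra.
Qed.

End Sampling.

(** * Open sets without holes are simply connected *)

Section SimplyConnected.
Variable R : realType.
Local Notation plane := (R * R)%type.
Variables (O : set plane) (M : R).
Hypothesis oO : open O.
Hypothesis M0 : 0 <= M.
Hypothesis OM : forall w, O w -> nrm w <= M.
Hypothesis exits : forall w, ~ O w -> exists g : R -> plane, [/\ continuous g, g 0 = w,
  (forall t, 0 <= t <= 1 -> ~ O (g t)) & M < nrm (g 1)].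

Lemma clamp_lip (s t : R) : `|clamp 0 1 s - clamp 0 1 t| <= `|s - t|.
Proof.
wlog st : s t / s <= t.
  by move=> H; have [/H//|/ltW/H] := leP s t; rewrite distrC (distrC t).
rewrite distrC (distrC s) (@ger0_norm _ (t - s)) ?subr_ge0//.
have [s0|s0] := leP s 0.
  rewrite (clamp01_l s0) subr0 ger0_norm; last by have /andP[] := clamp01_in t.
  have [t0|t0] := leP t 0; first by rewrite clamp01_l// subr_ge0.
  have [t1|t1] := leP 1 t; first by rewrite clamp01_r//; lra.
  by rewrite clamp_id ?(ltW t0) ?(ltW t1)//; lra.
have [s1|s1] := leP 1 s.
  by rewrite !clamp01_r ?(le_trans s1)// subrr normr0 subr_ge0.
rewrite (@clamp_id _ 0 1 s) ?(ltW s0) ?(ltW s1)//.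
have [t1|t1] := leP 1 t; first by rewrite clamp01_r// ger0_norm; lra.
by rewrite clamp_id ?ger0_norm ?subr_ge0 ?(ltW t1) ?andbT// (le_trans (ltW s0)).
Qed.

Lemma path_collar (f : R -> plane) : continuous f ->
  (forall t, 0 <= t <= 1 -> O (f t)) ->
  exists2 e : R, 0 < e & forall t z, 0 <= t <= 1 -> ball (f t) e z -> O z.
Proof.
move=> cf fO; have /compact_near_coveringP cK := @itv01_compact R.
have := cK R 0^'+ (fun e t => forall z, ball (f t) e z -> O z) _.
case.
  move=> t t01; have /oO : O (f t) by exact: fO.
  rewrite -nbhs_ballE => -[r /= r0 hr].
  have : nbhs t (f @^-1` ball (f t) (r / 2)).
    by apply: cf; apply: nbhsx_ballx; rewrite divr_gt0.
  move=> nt; exists (f @^-1` ball (f t) (r / 2), [set d : R | 0 < d < r / 2]).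
    split => //=; near=> d; apply/andP; split; near: d.
      exact: nbhs_right_gt.
    by apply: nbhs_right_lt; rewrite divr_gt0.
  move=> [s d] [/= ts /andP[d0 dl]] z sz; apply: hr.
  by rewrite (splitr r); apply: ball_triangle ts _; apply: le_ball sz; apply: ltW.
move=> e /= e0 he; exists (e / 2); first by rewrite divr_gt0.
move=> t z t01; apply: (he (e / 2)) => //=.
  by rewrite sub0r normrN ger0_norm ?divr_ge0 ?ltW// ltr_pdivrMr// ltr_pMr// ltr1n.
by rewrite divr_gt0.
Unshelve. all: by end_near. Qed.

Lemma path_heine (f : R -> plane) (e : R) : continuous f -> 0 < e ->
  exists N : nat, forall n s t, (N <= n)%N -> 0 <= s <= 1 -> 0 <= t <= 1 ->
    `|s - t| <= n.+1%:R^-1 -> ball (f s) e (f t).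
Proof.
move=> cf e0.
have [d d0 hd] : exists2 d : R, 0 < d & forall s t : R, 0 <= s <= 1 -> 0 <= t <= 1 ->
    ball s d t -> ball (f s) e (f t).
  apply: (@compact_unif _ _ _ (fun s t => ball (f s) e (f t)) (@itv01_compact R)).
  move=> t _; have : nbhs t (f @^-1` ball (f t) (e / 2)).
    by apply: cf; apply: nbhsx_ballx; rewrite divr_gt0.
  move=> /nbhs_ballP[r /= r0 hr]; exists r => // y z _ _ /hr ty /hr tz.
  by rewrite (splitr e); apply: ball_triangle tz; exact: ball_sym.
have [N hN] := small_frac d0.
exists N => n s t Nn s01 t01 st; apply: hd => //; apply: le_lt_trans st _.
apply: le_lt_trans hN; rewrite lef_pV2 ?posrE ?ltr0n// ler_nat ltnS//.
Qed.

Lemma homot_scale (c : R) F G : 0 < c -> homot O c F G ->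
  homot O 1 (fun t => F (t * c)) (fun t => G (t * c)).
Proof.
move=> c0 [H [h1 h2 h3 h4 h5]]; exists (fun x => H (x.1, x.2 * c)); split => //.
- move=> x; apply: (@continuous_comp _ _ _ (fun x : R * R => (x.1, x.2 * c)) H); last exact: h1.
  apply: (@pair_cont _ _ _ fst (fun x : R * R => x.2 * c)); first exact: cvg_fst.
  by apply: cvgM; [exact: cvg_snd|exact: cvg_cst].
- move=> s t [t0|t1]; apply: h5; first by left; rewrite mulr_le0_ge0// ltW.
  by right; rewrite ler_peMl// ltW.
Qed.

Lemma clamped_homot (f : R -> plane) (c : R) : continuous f ->
  (forall t, 0 <= t <= 1 -> O (f t)) -> 1 <= c ->
  homot O 1 (f \o clamp 0 1) (fun t => f (clamp 0 1 (t * c))).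
Proof.
move=> cf fO c1.
apply: (@homot_reparam _ _ 1 (f \o clamp 0 1) id (fun t => t * c)).
- exact: clamped_cont.
- by move=> t; apply: fO; exact: clamp01_in.
- by move=> t; exact: cvg_id.
- by move=> t; apply: cvgM; [exact: cvg_id|exact: cvg_cst].
move=> s t /andP[s0 s1] [t0|t1]; rewrite /= .
  have : s * (t * c - t) <= 0.
    by apply: mulr_ge0_le0 => //; nra.
  by move=> ?; rewrite !clamp01_l//; lra.
have : 0 <= s * (t * c - t) by apply: mulr_ge0 => //; nra.
by move=> ?; rewrite !clamp01_r//; lra.
Qed.

(* Both paths are approximated by walks in one fine grid. *)
Lemma simply_connected (f g : R -> plane) : continuous f -> continuous g ->
  (forall t, 0 <= t <= 1 -> O (f t)) -> (forall t, 0 <= t <= 1 -> O (g t)) ->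
  f 0 = g 0 -> f 1 = g 1 -> homot O 1 (f \o clamp 0 1) (g \o clamp 0 1).
Proof.
move=> cf cg fO gO fg0 fg1.
have [e1 e10 fe] := path_collar cf fO; have [e2 e20 ge] := path_collar cg gO.
pose h := Num.min e1 e2 / 4.
have h0 : 0 < h by rewrite divr_gt0// lt_min e10.
have [N1 hN1] := path_heine cf h0; have [N2 hN2] := path_heine cg h0.
pose n := (maxn N1 N2).+1.
have n0 : 0 < n%:R :> R by rewrite ltr0n.
pose u (k : R -> plane) t := k (clamp 0 1 (t / n%:R)).
have small_u k e N : (forall t z, 0 <= t <= 1 -> ball (k t) e z -> O z) -> 4 * h <= e ->
    (N <= maxn N1 N2)%N ->
    (forall n s t, (N <= n)%N -> 0 <= s <= 1 -> 0 <= t <= 1 ->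
      `|s - t| <= n.+1%:R^-1 -> ball (k s) h (k t)) -> small O h (u k).
  move=> ke he NN hk; split => [s t st|s z Bz].
    apply: (hk (maxn N1 N2)) => //; try exact: clamp01_in.
    apply: le_trans (clamp_lip _ _) _; rewrite -mulrBl normrM normfV (gtr0_norm n0).
    by rewrite ler_pdivrMr// mulVf ?gt_eqF.
  by apply: (ke (clamp 0 1 (s / n%:R))); [exact: clamp01_in|exact: le_ball Bz].
have sf : small O h (u f).
  apply: small_u fe _ (leq_maxl _ _) hN1.
  by rewrite /h mulrC divfK// ge_min lexx.
have sg : small O h (u g).
  apply: small_u ge _ (leq_maxr _ _) hN2.
  by rewrite /h mulrC divfK// ge_min lexx orbT.
have u0 k : u k 0 = k 0 by rewrite /u mul0r clamp01_l.
have un k : u k n%:R = k 1 by rewrite /u mulfV ?gt_eqF// clamp01_r.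
(* The grid is centred at the common starting point, so that both walks start exactly there; at the
   other end [poly] appends the exact endpoint. *)
pose p0 := f 0.
have flp : fl p0 h p0 = (0, 0) by rewrite /fl /cx /cy !subrr !mul0r floor0.
have ptp : pt p0 h (0, 0) = p0 by rewrite /pt /= !mul0r !addr0 -surjective_pairing.
have hq : heq O (poly p0 h (u f) n) (poly p0 h (u g) n).
  rewrite /poly !un fg1; apply: heq_cat.
  have E : fl p0 h (u g 0) = fl p0 h (u f 0) by rewrite !u0 fg0.
  rewrite E; apply: (grid_walks h0 M0 OM exits).
  - exact: swk_path.
  - by rewrite -E; exact: swk_path.
  - by rewrite -{2}E !swk_last !un fg1.
pose F (k : R -> plane) (t : R) : plane := k (clamp 0 1 (t / (2 * n%:R))).
have FE (k : R -> plane) t : u k (clamp 0 n%:R (t / 2)) = F k t.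
  rewrite /u /F; congr k; have -> : t / (2 * n%:R) = (t / 2) / n%:R.
    by field; rewrite gt_eqF.
  have [t0|t0] := leP (t / 2) 0.
    by rewrite (clamp_l _ t0) mul0r [RHS]clamp01_l ?clamp01_l// pmulr_lle0 ?invr_gt0.
  have [tn|tn] := leP (t / 2) n%:R; first by rewrite (@clamp_id _ 0 n%:R) ?(ltW t0).
  rewrite (@clamp_r _ 0 n%:R) ?ltW// mulfV ?gt_eqF// !clamp01_r//.
  by rewrite ler_pdivlMr// mul1r ltW.
(* Path and polygon are joined by straight segments inside the collar. The time is [2 * n] for the
   grid steps and 1 for the edge to the endpoint. *)
have stage (k : R -> plane) : continuous k -> k 0 = p0 -> (forall t, 0 <= t <= 1 -> O (k t)) -> small O h (u k) ->
    homot O (2 * n + 1)%:R (F k) (PL (poly p0 h (u k) n)).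
  move=> ck k0 kO sk; apply: homot_straight.
  - move=> t; apply: (@continuous_comp _ _ _ (fun t : R => t / (2 * n%:R)) (k \o clamp 0 1)).
      by apply: cvgM; [exact: cvg_id|exact: cvg_cst].
    exact: clamped_cont.
  - exact: PL_cont.
  - move=> s t s01; apply: (sk.2 (clamp 0 n%:R (t / 2))); rewrite -FE.
    apply: ball_seg => //; last exact: (poly_close p0 h0 n t sk).
    by apply: ballxx; rewrite mulr_gt0.
  - move=> t [t0|tn].
      rewrite polyE PL_le0// u0 k0 flp ptp /F clamp01_l ?k0//.
      by rewrite pmulr_lle0// invr_gt0 mulr_gt0.
    rewrite polyE PL_last; last first.
      by rewrite size_cat size_map swk_size.
    rewrite last_cat [last _ _]/= un /F clamp01_r//.
    rewrite ler_pdivlMr ?mulr_gt0// mul1r; apply: le_trans tn.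
    by rewrite natrD natrM lerDl.
have [okE okH] := heq_homot hq.
have okf : okl O (poly p0 h (u f) n).
  apply: okl_walk; first exact: swk_path.
    by rewrite u0 flp ptp; apply: fO; rewrite lexx ler01.
  move=> s s01; rewrite swk_last un; apply: (sf.2 n%:R); rewrite un.
  have [c1 _ _] := ball_corner p0 h0 (ballxx (f 1) h0).
  apply: ball_seg => //; last by apply: ballxx; rewrite mulr_gt0.
  by apply: le_ball c1; rewrite ler_pM2r// ler_nat.
have [M1 hM1] := okH okf.
pose c := Num.max M1 (2 * n + 1)%:R.
have c1 : 2 * n%:R <= c by rewrite le_max natrD natrM lerDl ler01 orbT.
have c0 : 0 < c by apply: lt_le_trans c1; rewrite mulr_gt0.
have big : homot O c (F f) (F g).
  apply: homot_trans (homot_le _ (stage f cf erefl fO sf)) _; first by rewrite le_max lexx orbT.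
  apply: homot_trans (homot_le _ hM1) _; first by rewrite le_max lexx.
  apply: homot_sym; apply: homot_le (stage g cg _ gO sg); first by rewrite le_max lexx orbT.
  by rewrite -fg0.
have cn : 1 <= c / (2 * n%:R) by rewrite ler_pdivlMr ?mulr_gt0// mul1r.
have Fc k : (fun t => F k (t * c)) = fun t => k (clamp 0 1 (t * (c / (2 * n%:R)))).
  by apply/funext => t; rewrite /F mulrA.
apply: homot_trans (clamped_homot cf fO cn) _.
apply: homot_trans (homot_sym (clamped_homot cg gO cn)).
by rewrite -!Fc; exact: homot_scale.
Qed.

End SimplyConnected.

(** * Homotopies between accesses *)

Section Joined.
Variable R : realType.
Local Notation plane := (R * R)%type.
Implicit Types P Q : set plane.

Lemma comp_clamp (T : topologicalType) (f : R -> plane) (k : T -> R) (x : T) : continuous f ->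
  {for x, continuous k} -> {for x, continuous (fun z => f (clamp 0 1 (k z)))}.
Proof.
move=> cf ck; apply: (@continuous_comp _ _ _ k (f \o clamp 0 1)) => //.
exact: clamped_cont.
Qed.

Definition joined (P : set plane) (a b : plane) := exists c : R -> plane,
  [/\ continuous c, c 0 = a, c 1 = b & forall t, 0 <= t <= 1 -> P (c t)].

Lemma joined_sub P Q a b : P `<=` Q -> joined P a b -> joined Q a b.
Proof. by move=> PQ [c [? ? ? h]]; exists c; split => // t /h/PQ. Qed.

Lemma joined_seg P a b : (forall t : R, 0 <= t <= 1 -> P (seg a b t)) -> joined P a b.
Proof. by move=> h; exists (seg a b); split => //; [exact: affine_cont|exact: seg0|exact: seg1]. Qed.

Lemma joined_path P (c : R -> plane) s t : continuous c ->
  (forall u, Num.min s t <= u <= Num.max s t -> P (c u)) -> joined P (c s) (c t).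
Proof.
move=> cc h; exists (fun u => c (s + u * (t - s))); split.
- move=> u; apply: (@continuous_comp _ _ _ (fun u : R => s + u * (t - s)) c); last exact: cc.
  by apply: cvgD; [exact: cvg_cst|apply: cvgM; [exact: cvg_id|exact: cvg_cst]].
- by rewrite mul0r addr0.
- by rewrite mul1r addrC subrK.
- move=> u /andP[u0 u1]; apply: h; rewrite ge_min le_max.
  by have [st|st] := leP s t; apply/andP; split; apply/orP; [left|right|right|left]; nra.
Qed.

Lemma joined_sym P a b : joined P a b -> joined P b a.
Proof.
move=> [c [cc <- <- h]]; apply: joined_path => // u; rewrite (min_r ler01) (max_l ler01).
exact: h.
Qed.

Lemma joined_trans P b a d : joined P a b -> joined P b d -> joined P a d.
Proof.
move=> [c [cc c0 c1 cP]] [k [ck k0 k1 kP]].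
exists (fun t => c (clamp 0 1 (2 * t)) + (k (clamp 0 1 (2 * t - 1)) - b)); split.
- move=> t; apply: cvgD.
    by apply: comp_clamp => //; apply: cvgM; [exact: cvg_cst|exact: cvg_id].
  apply: cvgB; last exact: cvg_cst.
  apply: (@comp_clamp _ k (fun t : R => 2 * t - 1)) => //.
  by apply: cvgB; [apply: cvgM; [exact: cvg_cst|exact: cvg_id]|exact: cvg_cst].
- by rewrite mulr0 (@clamp01_l _ 0)// (@clamp01_l _ (0 - 1)) ?k0 ?subrr ?addr0 ?c0//; lra.
- by rewrite mulr1 (@clamp01_r _ 2) ?(@clamp01_r _ (2 - 1)) ?c1 ?k1 1?addrC ?subrK//; lra.
- move=> t /andP[t0 t1]; have [t2|t2] := leP (2 * t) 1.
    rewrite (@clamp01_l _ (2 * t - 1)) ?subr_le0// k0 subrr addr0; apply: cP.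
    exact: clamp01_in.
  by rewrite (@clamp01_r _ (2 * t)) ?(ltW t2)// c1 addrC subrK; apply: kP; exact: clamp01_in.
Qed.

Lemma joined_in P a b : joined P a b -> P a /\ P b.
Proof. by move=> [c [_ <- <- h]]; split; apply: h; rewrite lexx ler01. Qed.

Lemma joined_open P a : open P -> open [set w | joined P a w].
Proof.
move=> oP; rewrite openE => w aw; have [_ Pw] := joined_in aw.
have : nbhs w P by exact: open_nbhs_nbhs.
move=> /nbhs_ballP[e /= e0 he]; apply/nbhs_ballP; exists e => // z wz /=.
apply: joined_trans aw _; apply: joined_seg => t t01; apply: he.
by apply: ball_seg => //; exact: ballxx.
Qed.

Lemma joined_boundary P a w : open P -> closure [set w | joined P a w] w ->
  ~ joined P a w -> ~ P w.
Proof.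
move=> oP cw naw Pw; have : nbhs w P by exact: open_nbhs_nbhs.
move=> /nbhs_ballP[e /= e0 he].
have [z [/= az wz]] : [set w | joined P a w] `&` ball w e !=set0.
  by apply: cw; exact: nbhsx_ballx.
apply: naw; apply: joined_trans az _; apply: joined_seg => t t01; apply: he.
by apply: ball_seg => //; exact: ballxx.
Qed.

End Joined.

(** * Filling a rectangle from its four sides *)

Section Rectangle.
Variable R : realType.
Local Notation plane := (R * R)%type.
Variables (O : set plane) (M : R).
Hypothesis oO : open O.
Hypothesis M0 : 0 <= M.
Hypothesis OM : forall w, O w -> nrm w <= M.
Hypothesis exits : forall w, ~ O w -> exists g : R -> plane, [/\ continuous g, g 0 = w,
  (forall t, 0 <= t <= 1 -> ~ O (g t)) & M < nrm (g 1)].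

Lemma addrABK (V : zmodType) (u a b : V) : u + a + b - a - b = u.
Proof. by rewrite (addrAC (u + a)) !addrK. Qed.

Lemma addABrK (V : zmodType) (u a b : V) : a + b + u - a - b = u.
Proof. by rewrite (addrC (a + b)) addrA addrABK. Qed.

Lemma addArBK (V : zmodType) (u a b : V) : a + u + b - a - b = u.
Proof. by rewrite (addrC a) addrABK. Qed.

(** The path [c] reversed, then [p], then [c'] has the endpoints of [q], so simple connectedness
    deforms it into [q]. Before that, [p] is deformed into this path by letting its ends travel
    along [c] and [c']; each stage takes half of the [s]-range. *)
Lemma rectangle (p q c c' : R -> plane) :
  continuous p -> continuous q -> continuous c -> continuous c' ->
  (forall t, 0 <= t <= 1 -> O (p t)) -> (forall t, 0 <= t <= 1 -> O (q t)) ->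
  (forall t, 0 <= t <= 1 -> O (c t)) -> (forall t, 0 <= t <= 1 -> O (c' t)) ->
  c 0 = p 0 -> c 1 = q 0 -> c' 0 = p 1 -> c' 1 = q 1 ->
  exists S : R * R -> plane, [/\ continuous S, forall s t, O (S (s, t)),
    forall t, 0 <= t <= 1 -> S (0, t) = p t, forall t, 0 <= t <= 1 -> S (1, t) = q t &
    forall s, S (s, 0) = c (clamp 0 1 (2 * s)) /\ S (s, 1) = c' (clamp 0 1 (2 * s))].
Proof.
move=> cp cq cc cc' pO qO cO cO' c0 c1 c'0 c'1.
(* At each time only one summand moves: [c] backwards from [c s] until [t = s / 3], then all of [p],
   and from [t = 1 - s / 3] on [c'] up to [c' s]; the subtracted corners cancel the two resting
   summands. *)
pose m s t := c (clamp 0 1 (s - 3 * t)) + p (clamp 0 1 ((t - s / 3) / (1 - 2 * s / 3)))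
  + c' (clamp 0 1 (s - 3 * (1 - t))) - p 0 - p 1.
have mO s t : 0 <= s <= 1 -> 0 <= t <= 1 -> O (m s t).
  move=> /andP[s0 s1] /andP[t0 t1].
  have d0 : 0 < 1 - 2 * s / 3 by lra.
  have [h1|h1] := leP (3 * t) s.
    rewrite /m (@clamp01_l _ ((t - s / 3) / _)); last by rewrite pmulr_lle0 ?invr_gt0//; lra.
    rewrite (@clamp01_l _ (s - 3 * (1 - t))); last by lra.
    by rewrite c'0 addrABK; apply: cO; exact: clamp01_in.
  have [h2|h2] := leP (3 * (1 - t)) s.
    rewrite /m (@clamp01_r _ ((t - s / 3) / _)); last by rewrite ler_pdivlMr//; lra.
    rewrite (@clamp01_l _ (s - 3 * t)); last by lra.
    by rewrite c0 addABrK; apply: cO'; exact: clamp01_in.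
  rewrite /m (@clamp01_l _ (s - 3 * t)); last by lra.
  rewrite (@clamp01_l _ (s - 3 * (1 - t))); last by lra.
  by rewrite c0 c'0 addArBK; apply: pO; exact: clamp01_in.
pose f t := m 1 (clamp 0 1 t).
have mc (T : topologicalType) (a b : T -> R) (x : T) :
    {for x, continuous a} -> {for x, continuous b} -> a x <= 1 ->
    {for x, continuous (fun z => m (a z) (b z))}.
  move=> ca cb ax; apply: cvgB; last exact: cvg_cst.
  apply: cvgB; last exact: cvg_cst.
  apply: cvgD; first apply: cvgD.
  - apply: (@comp_clamp _ _ c (fun z => a z - 3 * b z)) => //.
    by apply: cvgB => //; apply: cvgM => //; exact: cvg_cst.
  - apply: (@comp_clamp _ _ p (fun z => (b z - a z / 3) / (1 - 2 * a z / 3))) => //.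
    apply: cvgM; first by apply: cvgB => //; apply: cvgM => //; exact: cvg_cst.
    apply: cvgV; first by rewrite gt_eqF//; lra.
    apply: cvgB; first exact: cvg_cst.
    by apply: cvgM; [apply: cvgM => //|]; exact: cvg_cst.
  - apply: (@comp_clamp _ _ c' (fun z => a z - 3 * (1 - b z))) => //.
    apply: cvgB => //; apply: cvgM; first exact: cvg_cst.
    by apply: cvgB => //; exact: cvg_cst.
have cf : continuous f.
  by move=> t; apply: (mc _ (fun=> 1) (clamp 0 1)) => //; [exact: cvg_cst|exact: clamp_continuous].
have fO t : 0 <= t <= 1 -> O (f t).
  by move=> _; apply: mO; [rewrite ler01 lexx|exact: clamp01_in].
have m0 s : 0 <= s <= 1 -> m s 0 = c s.
  move=> s01; have /andP[s0 s1] := s01.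
  rewrite /m (@clamp_id _ 0 1); last by rewrite mulr0 subr0.
  rewrite (@clamp01_l _ (_ / _)); last by rewrite pmulr_lle0 ?invr_gt0//; lra.
  rewrite (@clamp01_l _ (s - 3 * (1 - 0))); last by lra.
  by rewrite mulr0 subr0 c'0 addrABK.
have m1 s : 0 <= s <= 1 -> m s 1 = c' s.
  move=> s01; have /andP[s0 s1] := s01.
  rewrite /m (@clamp_id _ 0 1 (s - 3 * (1 - 1))); last by rewrite subrr mulr0 subr0.
  rewrite (@clamp01_l _ (s - 3 * 1)); last by lra.
  rewrite (@clamp01_r _ (_ / _)); last by rewrite ler_pdivlMr; lra.
  by rewrite subrr mulr0 subr0 c0 addABrK.
have f0 : f 0 = q 0 by rewrite /f clamp01_l// m0 ?c1// ler01 lexx.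
have f1 : f 1 = q 1 by rewrite /f clamp01_r// m1 ?c'1// ler01 lexx.
have [G [G1 G2 G3 G4 G5]] := simply_connected oO M0 OM exits cf cq fO qO f0 f1.
exists (fun x => m (clamp 0 1 (2 * x.1)) (clamp 0 1 x.2) +
   (G (clamp 0 1 (2 * x.1 - 1), clamp 0 1 x.2) - f (clamp 0 1 x.2))); split.
- move=> x.
  have k1 : {for x, continuous (fun x : R * R => clamp 0 1 x.2)}.
    by apply: continuous_comp; [exact: cvg_snd|exact: clamp_continuous].
  apply: cvgD.
    apply: (mc _ (fun x : R * R => clamp 0 1 (2 * x.1)) (fun x : R * R => clamp 0 1 x.2)) => //;
      last by case/andP: (clamp01_in (2 * x.1)).
    apply: continuous_comp; last exact: clamp_continuous.
    by apply: cvgM; [exact: cvg_cst|exact: cvg_fst].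
  apply: cvgB; last by apply: (@continuous_comp _ _ _ (fun x : R * R => clamp 0 1 x.2) f); [exact: k1|exact: cf].
  apply: (@continuous_comp _ _ _ (fun x : R * R => (clamp 0 1 (2 * x.1 - 1), clamp 0 1 x.2)) G); last exact: G1.
  apply: (@pair_cont _ _ _ (fun x : R * R => clamp 0 1 (2 * x.1 - 1)) (fun x : R * R => clamp 0 1 x.2)) => //.
  apply: continuous_comp; last exact: clamp_continuous.
  by apply: cvgB; [apply: cvgM; [exact: cvg_cst|exact: cvg_fst]|exact: cvg_cst].
- move=> s t /=; set u := clamp 0 1 t.
  have uu : clamp 0 1 u = u by apply: clamp_id; exact: clamp01_in.
  have [s2|s2] := leP (2 * s) 1.
    rewrite (@clamp01_l _ (2 * s - 1)) ?subr_le0// G2 /= uu subrr addr0.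
    by apply: mO; exact: clamp01_in.
  by rewrite (@clamp01_r _ (2 * s)) ?ltW// [f u]/f uu addrC subrK.
- move=> t t01 /=; rewrite mulr0 (@clamp01_l _ 0)// (@clamp01_l _ (0 - 1)) ?G2 /=; last by lra.
  rewrite !clamp_id// subrr addr0; case/andP: t01 => t0 t1.
  rewrite /m mulr0 !mul0r !subr0 divr1 (@clamp01_l _ (0 - 3 * t)); last by lra.
  rewrite (@clamp01_l _ (0 - 3 * (1 - t))); last by lra.
  by rewrite clamp_id ?t0// c0 c'0 addArBK.
- move=> t t01 /=; rewrite mulr1 (@clamp01_r _ 2); last by lra.
  rewrite (@clamp01_r _ (2 - 1)); last by lra.
  by rewrite !clamp_id// G3 /= /f !clamp_id// addrC subrK.
- move=> s /=; rewrite (@clamp01_l _ 0)// (@clamp01_r _ 1)//.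
  have g0 r : G (r, 0) = f 0 by rewrite G5 /= ?clamp01_l//; left.
  have g1 r : G (r, 1) = f 1 by rewrite G5 /= ?clamp01_r//; right.
  by rewrite g0 g1 !subrr !addr0 m0 ?m1//; exact: clamp01_in.
Qed.

End Rectangle.

(** * A homotopy between two accesses with jointly shrinking tails *)

Section AccessHomotopy.
Variable R : realType.
Local Notation plane := (R * R)%type.
Variables (K : set plane) (v : plane) (r0 : R).
Hypothesis cK : closed K.
Hypothesis r00 : 0 < r0.
Hypothesis K_exit : forall r w, 0 < r <= r0 -> K w -> exists2 u, joined K w u & ~ ball v r u.

Let Or r := ball v r `\` K.

Lemma Or_open r : open (Or r).
Proof. by apply: openI; [exact: ball_open|exact: closed_openC]. Qed.

Lemma nrm_le (w : plane) : nrm w <= `|w.1| + `|w.2|.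
Proof.
rewrite -(@ger0_norm _ (_ + _)) ?addr_ge0// -sqrtr_sqr ler_wsqrtr// /dot.
rewrite -!expr2 sqrrD -[X in X + _ <= _]real_normK ?num_real//.
rewrite -[X in _ + X <= _]real_normK ?num_real// addrAC lerDl.
by rewrite mulrn_wge0// mulr_ge0.
Qed.

Lemma nrm_ge1 (w : plane) : `|w.1| <= nrm w.
Proof. by rewrite -sqrtr_sqr ler_wsqrtr// /dot -!expr2 lerDl sqr_ge0. Qed.

Lemma Or_bounded r w : 0 < r <= r0 -> Or r w -> nrm w <= `|v.1| + `|v.2| + 2 * r0.
Proof.
move=> /andP[_ rr] [/planeballE[h1 h2] _]; apply: le_trans (nrm_le w) _.
have k (x y : R) : `|x - y| < r -> `|y| <= `|x| + r0.
  move=> xy; have := ler_normD x (y - x); rewrite addrC subrK distrC => h; lra.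
have := k _ _ h1; have := k _ _ h2; lra.
Qed.

Lemma ray_exit r w (N : R) : 0 < r -> ~ ball v r w -> exists2 u, N < nrm u &
  forall t, 0 <= t <= 1 -> ~ ball v r (seg w u t).
Proof.
move=> rp nb.
(* In a coordinate where [w] is at distance at least [r] from [v], stretching by [1 + c] makes the
   offset exceed [N] even after the coordinate of [v] is subtracted. *)
pose c := (`|N| + `|v.1| + `|v.2| + 1) / r.
have c0 : 0 <= c by rewrite divr_ge0 ?(ltW rp)// !addr_ge0.
have cr : c * r = `|N| + `|v.1| + `|v.2| + 1 by rewrite /c divfK// gt_eqF.
pose u : plane := (w.1 + c * (w.1 - v.1), w.2 + c * (w.2 - v.2)).
have far (x y : R) : r <= `|x - y| -> `|x| <= `|v.1| + `|v.2| -> N < `|y + c * (y - x)|.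
  rewrite distrC => xy hx.
  have : `|(1 + c) * (y - x)| <= `|y + c * (y - x)| + `|x|.
    by apply: le_trans (ler_normB _ _); rewrite (_ : y + _ - x = (1 + c) * (y - x))//; ring.
  rewrite normrM (@ger0_norm _ (1 + c)) ?addr_ge0// => h.
  have : (1 + c) * r <= (1 + c) * `|y - x| by rewrite ler_wpM2l// addr_ge0.
  by rewrite mulrDl mul1r cr => h2; have := ler_norm N; lra.
have out (x y t : R) : r <= `|x - y| -> 0 <= t <= 1 -> r <= `|x - (y + t * (y + c * (y - x) - y))|.
  move=> xy /andP[t0 _]; rewrite (_ : x - _ = (1 + t * c) * (x - y)); last by ring.
  have tc : 0 <= t * c by rewrite mulr_ge0.
  rewrite normrM (@ger0_norm _ (1 + t * c)) ?addr_ge0//; apply: (le_trans xy).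
  by rewrite ler_peMl// lerDl.
have [k1|k1] : r <= `|v.1 - w.1| \/ r <= `|v.2 - w.2|.
    have [h1|h1] := leP r `|v.1 - w.1|; first by left.
    have [h2|h2] := leP r `|v.2 - w.2|; first by right.
    by exfalso; apply: nb; apply/planeballE.
all: exists u.
- by apply: lt_le_trans (nrm_ge1 u); apply: far => //; rewrite lerDl.
- move=> t t01 /planeballE[]; rewrite segE /=; have := out _ _ t k1 t01; lra.
- by apply: lt_le_trans (nrm_ge2 u); apply: far => //; rewrite lerDr.
- move=> t t01 /planeballE[_]; rewrite segE /=; have := out _ _ t k1 t01; lra.
Qed.

(** A removed point inside the disc belongs to [K] and leaves the disc along [K]; from outside, the
    ray away from the centre leads arbitrarily far. Hence [Or r] has no holes. *)
Lemma Or_exits r w (N : R) : 0 < r <= r0 -> ~ Or r w -> exists g : R -> plane,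
  [/\ continuous g, g 0 = w, (forall t, 0 <= t <= 1 -> ~ Or r (g t)) & N < nrm (g 1)].
Proof.
move=> rr nw; have /andP[rp _] := rr.
have [bw|nbw] := pselect (ball v r w); last first.
  have [u uN uo] := ray_exit N rp nbw; exists (seg w u); split.
  - exact: affine_cont.
  - exact: seg0.
  - by move=> t /uo h [].
  - by rewrite seg1.
have Kw : K w by apply: contrapT => nK; apply: nw.
have [x wx nx] := K_exit rr Kw; have [u uN uo] := ray_exit N rp nx.
have [k [ck k0 k1 kP]] : joined (~` Or r) w u.
  apply: (@joined_trans _ _ x); first by apply: joined_sub wx => y Ky [].
  by apply: joined_seg => t /uo h [].
by exists k; split => //; rewrite k1.
Qed.

Lemma Or_rectangle r (p q c c' : R -> plane) : 0 < r <= r0 ->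
  continuous p -> continuous q -> continuous c -> continuous c' ->
  (forall t, 0 <= t <= 1 -> Or r (p t)) -> (forall t, 0 <= t <= 1 -> Or r (q t)) ->
  (forall t, 0 <= t <= 1 -> Or r (c t)) -> (forall t, 0 <= t <= 1 -> Or r (c' t)) ->
  c 0 = p 0 -> c 1 = q 0 -> c' 0 = p 1 -> c' 1 = q 1 ->
  exists S : R * R -> plane, [/\ continuous S, forall s t, Or r (S (s, t)),
    forall t, 0 <= t <= 1 -> S (0, t) = p t, forall t, 0 <= t <= 1 -> S (1, t) = q t &
    forall s, S (s, 0) = c (clamp 0 1 (2 * s)) /\ S (s, 1) = c' (clamp 0 1 (2 * s))].
Proof.
move=> rr; apply: (@rectangle _ (Or r) (`|v.1| + `|v.2| + 2 * r0)).
- exact: Or_open.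
- by rewrite !addr_ge0// mulr_ge0// ltW.
- by move=> w; exact: Or_bounded.
- by move=> w nw; exact: Or_exits.
Qed.

Section Gluing.
Variables (p q : R -> plane).
Hypothesis (cp : continuous p) (cq : continuous q) (p1 : p 1 = v) (q1 : q 1 = v).
Hypothesis pK : forall t, 0 <= t < 1 -> Or r0 (p t).
Hypothesis qK : forall t, 0 <= t < 1 -> Or r0 (q t).
Hypothesis pq_joined : forall r a, 0 < r <= r0 -> 0 <= a < 1 ->
  (forall t, a <= t <= 1 -> ball v r (p t) /\ ball v r (q t)) -> joined (Or r) (p a) (q a).

Let rn (n : nat) : R := r0 / n.+1%:R.

Lemma rn_gt0 n : 0 < rn n <= r0.
Proof.
rewrite divr_gt0//= ler_pdivrMr// ler_peMr ?(ltW r00)// ler1n//.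
Qed.

Lemma tail_exists r : 0 < r -> exists2 a, a < 1 & forall t, a <= t <= 1 -> ball v r (p t) /\ ball v r (q t).
Proof.
move=> rp; have : nbhs (1 : R) ((p @^-1` ball v r) `&` (q @^-1` ball v r)).
  by apply: filterI; [apply: cp; rewrite p1|apply: cq; rewrite q1]; exact: nbhsx_ballx.
move=> /nbhs_ballP[d /= d0 hd]; exists (1 - d / 2); first by lra.
by move=> t /andP[t1 t2]; apply: hd; rewrite /ball /= ger0_norm; lra.
Qed.

Lemma half_le (x y a b : R) : 1 - x <= a -> (1 + x) / 2 <= y -> 2^-1 * a <= b -> 1 - y <= b.
Proof. by lra. Qed.

(** Each new time passes the midpoint between the previous one and 1, which forces convergence to 1,
    and is late enough for both tails to lie in the next disc. At time 0 the disc of radius [r0] is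
    guaranteed by hypothesis. *)
Lemma times : exists t : nat -> R, [/\ t 0%N = 0, forall n, t n < t n.+1, forall n, 0 <= t n < 1,
  forall n s, t n <= s <= 1 -> ball v (rn n) (p s) /\ ball v (rn n) (q s)
  & forall s, s < 1 -> exists n, s < t n].
Proof.
have /choice[a ha] : forall n, exists a, a < 1 /\ forall t, a <= t <= 1 ->
    ball v (rn n) (p t) /\ ball v (rn n) (q t).
  by move=> n; have [a ? ?] := tail_exists (proj1 (andP (rn_gt0 n))); exists a.
pose t := fix t n := if n is n'.+1 then Num.max (a n'.+1) ((1 + t n') / 2) else 0.
have t01 n : 0 <= t n < 1.
  elim: n => [|n /andP[IH0 IH1]] /=; first by rewrite lexx ltr01.
  by rewrite le_max gt_max (ha n.+1).1 /=; apply/andP; split; [apply/orP; right|]; lra.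
have half n : (1 + t n) / 2 <= t n.+1 by rewrite /= le_max lexx orbT.
exists t; split => //.
- by move=> n; apply: lt_le_trans (half n); have /andP[] := t01 n; lra.
- case=> [|n] s /andP[s1 s2].
    have [->|sn] := eqVneq s 1; first by rewrite p1 q1 /rn divr1; split; exact: ballxx.
    have s01 : 0 <= s < 1 by rewrite s1 lt_neqAle sn.
    by rewrite /rn divr1; split; [have [] := pK s01|have [] := qK s01].
  by apply: (ha n.+1).2; rewrite s2 andbT; apply: le_trans s1; rewrite /= le_max lexx.
- move=> s s1.
  have g n : 1 - t n <= n.+1%:R^-1.
    elim: n => [|n IH]; first by rewrite /= subr0 invr1.
    have h1 := half n; have h2 : 2^-1 * n.+1%:R^-1 <= n.+2%:R^-1 :> R.
      rewrite -invfM lef_pV2 ?posrE ?mulr_gt0// -!natrM ler_nat; lia.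
    exact: half_le IH h1 h2.
  have s10 : 0 < 1 - s by rewrite subr_gt0.
  have [n hn] := small_frac s10.
  exists n; move: (g n) (le_lt_trans (g n) hn) => _; rewrite ltrD2l ltrN2; exact.
Qed.

Lemma access_homotopy : exists H : R * R -> plane, [/\ continuous H,
  forall s, H (s, 1) = v,
  forall s t, 0 <= t < 1 -> Or r0 (H (s, t)),
  forall t, 0 <= t <= 1 -> H (0, t) = p t
  & forall t, 0 <= t <= 1 -> H (1, t) = q t].
Proof.
have [t [t0 tS t01 tb tlim]] := times.
have tmono m n : (m <= n)%N -> t m <= t n.
  by move=> mn; apply: (@homo_leq _ t (fun x y => x <= y)) mn => //; [move=> ? ? ?; exact: le_trans|move=> i; exact: ltW].
have rmono m n : (m <= n)%N -> rn n <= rn m.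
  move=> mn; rewrite /rn ler_pM2l// lef_pV2 ?posrE//; by rewrite ler_nat.
have Orle m n : (m <= n)%N -> Or (rn n) `<=` Or (rn m).
  by move=> mn w [bw Kw]; split => //; apply: le_ball bw; exact: rmono.
have Ot n s : t n <= s < 1 -> Or (rn n) (p s) /\ Or (rn n) (q s).
  move=> /andP[ns s1]; have ns1 : t n <= s <= 1 by rewrite ns ltW.
  have [b1 b2] := tb n s ns1.
  have s01 : 0 <= s < 1 by rewrite s1 andbT; apply: le_trans ns; have /andP[] := t01 n.
  by have [_ ?] := pK s01; have [_ ?] := qK s01.
have /choice[c hc] : forall n, joined (Or (rn n)) (p (t n)) (q (t n)).
  by move=> n; apply: pq_joined => //; [exact: rn_gt0|exact: tb].
have dt n : 0 < t n.+1 - t n by rewrite subr_gt0.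
pose strip (k : R -> plane) n (x : R) := k (t n + x * (t n.+1 - t n)).
have strip_cont (k : R -> plane) n : continuous k -> continuous (strip k n).
  move=> ck x; apply: (@continuous_comp _ _ _ (fun x : R => t n + x * (t n.+1 - t n)) k); last exact: ck.
  by apply: cvgD; [exact: cvg_cst|apply: cvgM; [exact: cvg_id|exact: cvg_cst]].
have strip_in n x : 0 <= x <= 1 -> t n <= t n + x * (t n.+1 - t n) < 1.
  move=> /andP[x0 x1]; have := dt n; have /andP[_] := t01 n.+1 => h1 h2.
  by apply/andP; split; nra.
have /choice[S hS] : forall n, exists S : R * R -> plane, [/\ continuous S, forall s x, Or (rn n) (S (s, x)),
    forall x, 0 <= x <= 1 -> S (0, x) = strip p n x, forall x, 0 <= x <= 1 -> S (1, x) = strip q n x &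
    forall s, S (s, 0) = c n (clamp 0 1 (2 * s)) /\ S (s, 1) = c n.+1 (clamp 0 1 (2 * s))].
  move=> n; have [h1 h2 h3 h4] := hc n; have [k1 k2 k3 k4] := hc n.+1.
  apply: Or_rectangle => //.
  - exact: rn_gt0.
  - exact: strip_cont.
  - exact: strip_cont.
  - by move=> x /(strip_in n) h; have [] := Ot n _ h.
  - by move=> x /(strip_in n) h; have [] := Ot n _ h.
  - by move=> x x01; apply: Orle (k4 x x01).
  - by rewrite h2 /strip mul0r addr0.
  - by rewrite h3 /strip mul0r addr0.
  - by rewrite k2 /strip mul1r addrC subrK.
  - by rewrite k3 /strip mul1r addrC subrK.
pose loc n x := clamp 0 1 ((x - t n) / (t n.+1 - t n)).
have loc0 n x : x <= t n -> loc n x = 0.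
  by move=> h; apply: clamp01_l; rewrite pmulr_lle0 ?invr_gt0// subr_le0.
have loc1 n x : t n.+1 <= x -> loc n x = 1.
  by move=> h; apply: clamp01_r; rewrite ler_pdivlMr// mul1r lerB.
have locE n x : t n <= x <= t n.+1 -> t n + loc n x * (t n.+1 - t n) = x.
  move=> /andP[h1 h2]; rewrite /loc clamp_id; first by rewrite divfK ?gt_eqF// addrC subrK.
  apply/andP; split; first by rewrite divr_ge0// ?subr_ge0// ltW.
  by rewrite ler_pdivrMr// mul1r lerB.
pose E n s := c n (clamp 0 1 (2 * s)).
(* Partial gluing of the strips up to [n]: before strip [n] its summand cancels against the shared
   side [E n], and after it the earlier strips rest at [E n]. *)
pose G := fix G n (x : R * R) : plane := if n is n'.+1
  then G n' x + (S n (x.1, loc n x.2) - E n x.1) else S 0%N (x.1, loc 0%N x.2).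
have Gge n s x : t n.+1 <= x -> G n (s, x) = E n.+1 s.
  elim: n => [|n IH] h.
    by rewrite /= loc1//; have [_ _ _ _ /(_ s)[_ ->]] := hS 0%N.
  rewrite [G _ _]/= IH; last by apply: le_trans h; exact: ltW.
  rewrite loc1//; have [_ _ _ _ /(_ s)[_ ->]] := hS n.+1.
  by rewrite addrC subrK.
have Gstep n s x : x <= t n.+1 -> G n.+1 (s, x) = G n (s, x).
  move=> h; rewrite [LHS]/= loc0//; have [_ _ _ _ /(_ s)[-> _]] := hS n.+1.
  by rewrite subrr addr0.
have Gstable m n s x : (m <= n)%N -> x <= t m.+1 -> G n (s, x) = G m (s, x).
  move=> mn h; rewrite -(subnK mn); elim: (n - m)%N => [//|d IH].
  by rewrite addSn Gstep// (le_trans h)// tmono// ltnS leq_addl.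
have Gstrip n s x : t n <= x <= t n.+1 -> G n (s, x) = S n (s, loc n x).
  move=> /andP[h1 h2]; case: n h1 h2 => [//|n] h1 h2.
  by rewrite [LHS]/= Gge// addrC subrK.
have cG n : continuous (G n).
  have cl n' (x : R * R) : {for x, continuous (fun x : R * R => S n' (x.1, loc n' x.2))}.
    apply: (@continuous_comp _ _ _ (fun x : R * R => (x.1, loc n' x.2)) (S n')); last by have [k1 _ _ _ _] := hS n'; exact: k1.
    apply: (@pair_cont _ _ _ fst (fun x : R * R => loc n' x.2)); first exact: cvg_fst.
    apply: (@continuous_comp _ _ _ (fun x : R * R => (x.2 - t n') / (t n'.+1 - t n')) (clamp 0 1));
      last exact: clamp_continuous.
    apply: cvgM; last exact: cvg_cst.
    by apply: cvgB; [exact: cvg_snd|exact: cvg_cst].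
  elim: n => [|n IH] x; first exact: cl.
  apply: cvgD; first exact: IH.
  apply: cvgB; first exact: cl.
  apply: (@comp_clamp _ _ (c n.+1) (fun x : R * R => 2 * x.1)); first by have [k1 _ _ _] := hc n.+1.
  by apply: cvgM; [exact: cvg_cst|exact: cvg_fst].
(* For [x < 1] every index beyond [x] yields the same value by [Gstable]; for larger [x] the index 0
   is a placeholder. *)
have /choice[N hN] : forall x, exists n, x < 1 -> x < t n.+1.
  move=> x; have [x1|x1] := ltP x 1; last by exists 0%N.
  by have [n hn] := tlim x x1; exists n => _; apply: lt_trans hn _.
have between x : 0 <= x < 1 -> exists n, t n <= x <= t n.+1.
  move=> /andP[x0 x1]; have [n] := tlim x x1.
  elim: n => [|n IH] xn; first by move: xn; rewrite t0 ltNge x0.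
  have [h|h] := ltP x (t n); first exact: IH.
  by exists n; rewrite h ltW.
pose H (x : R * R) := if x.2 < 1 then G (N x.2) x else v.
have HG n s x : x < 1 -> x <= t n.+1 -> H (s, x) = G n (s, x).
  move=> x1 h; rewrite /H /= x1; have h2 := ltW (hN x x1).
  by case/orP: (leq_total n (N x)) => mn; [apply: Gstable|symmetry; apply: Gstable].
have HO n s x : t n <= x < 1 -> Or (rn n) (H (s, x)).
  move=> /andP[h1 h2].
  have [|m /andP[m1 m2]] := between x; first by rewrite h2 andbT (le_trans _ h1)//; have /andP[] := t01 n.
  rewrite (@HG m)// Gstrip ?m1//; have [_ k2 _ _ _] := hS m.
  have [nm|mn] := leqP n m; first by apply: Orle (k2 s (loc m x)).
  (* The chosen strip may be the one that ends at height [t n]; the point is then on its upper side,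
     a joining path that already lies in the smaller disc. *)
  have E1 : x = t m.+1 by apply/eqP; rewrite eq_le m2 /= (le_trans _ h1)// tmono.
  have [nm|mn'] := leqP n m.+1; last first.
    by move: h1; rewrite E1 leNgt (lt_le_trans (tS m.+1))// tmono.
  rewrite loc1 -?E1//; have [_ _ _ _ /(_ s)[_ ->]] := hS m.
  by have [_ _ _ k4] := hc m.+1; apply: Orle nm _ (k4 _ _); exact: clamp01_in.
exists H; split.
- move=> [s x]; have [x1|x1] := ltP x 1.
    apply: (@near_cont _ _ (G (N x))); last exact: cG.
    have : nbhs (s, x) [set y : R * R | y.2 < Num.min 1 (t (N x).+1)].
      apply: open_nbhs_nbhs; split; last by rewrite /= lt_min x1 hN.
      apply: (@open_comp _ _ snd [set z | z < Num.min 1 (t (N x).+1)]).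
        by move=> ? _; exact: cvg_snd.
      exact: open_lt.
    apply: filterS => -[s' x'] /=; rewrite lt_min => /andP[h1 h2].
    by rewrite (@HG (N x))// ltW.
  have HE : H (s, x) = v by rewrite /H /= ltNge x1.
  (* Above height [t n] all values lie within [rn n] of [v], and [rn n] tends to 0. *)
  rewrite /continuous_at HE; apply/cvgrPdist_lt => e e0.
  have [n hn] := small_frac (divr_gt0 e0 r00).
  have rne : rn n < e by rewrite /rn mulrC -ltr_pdivlMr.
  have : nbhs (s, x) [set y : R * R | t n < y.2].
    apply: open_nbhs_nbhs; split; last by rewrite /=; have /andP[_] := t01 n; move=> h; exact: lt_le_trans h x1.
    apply: (@open_comp _ _ snd [set z | t n < z]).
      by move=> ? _; exact: cvg_snd.
    exact: open_gt.
  apply: filterS => -[s' x'] /= h.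
  have B : ball v e (H (s', x')).
    have [x1'|x1'] := ltP x' 1.
      have [B _] : Or (rn n) (H (s', x')) by apply: HO; rewrite ltW.
      by apply: le_ball B; exact: ltW.
    by rewrite /H /= ltNge x1'; exact: ballxx.
  by move: B; rewrite -ball_normE.
- by move=> s; rewrite /H /= ltxx.
- by move=> s x h; have := HO 0%N s x; rewrite t0 /rn divr1; apply.
- move=> x /andP[x0 x1]; have [->|xn] := eqVneq x 1; first by rewrite /H /= ltxx p1.
  have x01 : 0 <= x < 1 by rewrite x0 lt_neqAle xn.
  have [n hn] := between x x01; have /andP[_ h2] := hn.
  rewrite (@HG n)//; last by case/andP: x01.
  rewrite Gstrip//; have [_ _ k3 _ _] := hS n.
  by rewrite k3 /strip ?locE//; exact: clamp01_in.
- move=> x /andP[x0 x1]; have [->|xn] := eqVneq x 1; first by rewrite /H /= ltxx q1.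
  have x01 : 0 <= x < 1 by rewrite x0 lt_neqAle xn.
  have [n hn] := between x x01; have /andP[_ h2] := hn.
  rewrite (@HG n)//; last by case/andP: x01.
  rewrite Gstrip//; have [_ _ _ k3 _] := hS n.
  by rewrite k3 /strip ?locE//; exact: clamp01_in.
Qed.

End Gluing.
End AccessHomotopy.

(** * Accesses and arcs at a vertex *)

Section IntegerKernel.
Local Open Scope ring_scope.

Lemma rank_lt_col (F : fieldType) m n (A : 'M[F]_(m, n)) (x : 'cV_n) :
  x != 0 -> A *m x = 0 -> (\rank A < n)%N.
Proof.
move=> x0 Ax; rewrite ltn_neqAle rank_leq_col andbT; apply: contra x0.
by move=> /row_fullP[B BA]; rewrite -[x]mul1mx -BA -mulmxA Ax mulmx0.
Qed.

Lemma rat_common_denominator m n (A : 'M[rat]_(m, n)) :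
  exists2 D : int, D != 0 & exists Z : 'M[int]_(m, n), map_mx intr Z = D%:~R *: A.
Proof.
exists (\prod_(p : 'I_m * 'I_n) denq (A p.1 p.2)).
  by apply/prodf_neq0 => p _; exact: denq_neq0.
exists (\matrix_(i, j) (numq (A i j) * \prod_(p | p != (i, j)) denq (A p.1 p.2))).
apply/matrixP => i j; rewrite !mxE [in RHS](bigD1 (i, j))//=.
rewrite rmorphM/= [in RHS]intrM mulrAC; congr (_ * _).
by rewrite -[X in _ = _ * X]divq_num_den [RHS]mulrC divfK// intr_eq0 denq_neq0.
Qed.

(** A rational basis of the kernel is multiplied by a common denominator, because winding arguments
    need integral coefficients. *)
Lemma int_kernel m n (B : 'M[rat]_(m, n)) : exists Z : 'M[int]_(m - \rank B, m),
  row_free (map_mx intr Z : 'M[rat]_(_, _)) /\ (map_mx intr Z : 'M[rat]_(_, _)) *m B = 0.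
Proof.
have Ek : \rank (kermx B) = (m - \rank B)%N by rewrite mxrank_ker.
rewrite -Ek; have [D D0 [Z HZ]] := rat_common_denominator (row_base (kermx B)).
have D0' : D%:~R != 0 :> rat by rewrite intr_eq0.
exists Z; rewrite HZ; split.
  by rewrite /row_free mxrank_scale_nz//; exact: row_base_free.
have /submxP[C ->] : (row_base (kermx B) <= kermx B)%MS by rewrite eq_row_base.
by rewrite -scalemxAl -mulmxA mulmx_ker mulmx0 scaler0.
Qed.

(** Subtracting the column of a fixed [j0] leaves a square matrix with a zero column; an integral
    relation among its rows makes the combined value at [j] equal to that at [j0]. *)
Lemma int_relation (d : nat) (J : finType) (a : 'I_d -> J -> int) :
  #|J| = d -> (0 < d)%N -> exists m : 'I_d -> int, (exists i, m i != 0) /\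
  exists c, forall j, \sum_i m i * a i j = c.
Proof.
move=> Jd d0; have [j0 _] : exists j0 : J, true.
  by have /card_gt0P[j0 _] : (0 < #|J|)%N; [rewrite Jd|exists j0].
pose A : 'M[rat]_(d, #|J|) := \matrix_(i, k) (a i (enum_val k) - a i j0)%:~R.
have rA : (\rank A < d)%N.
  rewrite -[X in (_ < X)%N]Jd; apply: (@rank_lt_col _ _ _ _ (delta_mx (enum_rank j0) 0)).
    apply/eqP => /matrixP/(_ (enum_rank j0) 0); rewrite !mxE !eqxx => /eqP.
    by rewrite oner_eq0.
  apply/matrixP => i k; rewrite !mxE (bigD1 (enum_rank j0))//= !mxE enum_rankK subrr mul0r add0r.
  by rewrite big1// => l /negbTE h; rewrite !mxE h mulr0.
have [Z [fZ ZA]] := int_kernel A.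
have k0 : (0 < d - \rank A)%N by rewrite subn_gt0.
pose i0 := Ordinal k0.
exists (fun i => Z i0 i); split.
  apply: contrapT => N; have Zi : row i0 (map_mx intr Z : 'M[rat]_(_, _)) = 0.
    apply/matrixP => k i; rewrite !mxE; apply/eqP; rewrite intr_eq0; apply/negPn/negP => h.
    by apply: N; exists i.
  have : delta_mx 0 i0 *m (map_mx intr Z : 'M[rat]_(_, _)) = (0 : 'rV[rat]_(d - \rank A)) *m map_mx intr Z.
    by rewrite -rowE Zi mul0mx.
  move=> /(row_free_inj fZ)/matrixP/(_ 0 i0); rewrite !mxE !eqxx => /eqP.
  by rewrite oner_eq0.
exists (\sum_i Z i0 i * a i j0) => j.
have /matrixP/(_ i0 (enum_rank j)) := ZA; rewrite !mxE => E.
apply/eqP; rewrite -subr_eq0 -(intr_eq0 rat) -sumrB rmorph_sum/= -[X in _ == X]E.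
by apply/eqP; apply: eq_bigr => i _; rewrite !mxE enum_rankK -mulrBr intrM.
Qed.

End IntegerKernel.

(** * Separated accesses in a disc around a vertex *)

Section LocalAccess.
Variable R : realType.
Local Notation plane := (R * R)%type.
Variables (K : set plane) (v : plane) (r : R) (J : finType) (e : J -> R -> plane).
Variables (d : nat) (p : 'I_d.+1 -> R -> plane).
Let O := ball v r `\` K.
Hypothesis cK : closed K.
Hypothesis Kv : K v.
Hypothesis r0 : 0 < r.
Hypotheses (Jd : #|J| = d) (d0 : (0 < d)%N).
Hypothesis ce : forall j, continuous (e j).
Hypothesis e0 : forall j, e j 0 = v.
Hypothesis eK : forall j t, 0 <= t <= 1 -> K (e j t).
Hypothesis ev : forall j t, 0 < t <= 1 -> e j t <> v.
Hypothesis Kloc : exists K' : set plane, [/\ closed K', ~ K' v &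
  forall w, K w -> [\/ w = v, K' w | exists j t, 0 <= t <= 1 /\ w = e j t]].
Hypothesis cp : forall i, continuous (p i).
Hypothesis p1 : forall i, p i 1 = v.
Hypothesis pO : forall i t, 0 <= t < 1 -> O (p i t).

Lemma O_open : open O.
Proof. exact: Or_open. Qed.

Let b i := p i 0.

Lemma b_in i : O (b i).
Proof. by apply: pO; rewrite lexx ltr01. Qed.

Lemma b_neq i : b i <> v.
Proof. by have [_ nK] := b_in i => E; apply: nK; rewrite E. Qed.

Lemma p_trk i w : ~ O w -> w <> v -> ~ trk (p i) w.
Proof.
move=> Ow wv [t /andP[t0 t1] pw]; move: t1; rewrite le_eqVlt => /orP[/eqP E|t1].
  by apply: wv; rewrite -pw E p1.
by apply: Ow; rewrite -pw; apply: pO; rewrite t0.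
Qed.

(** Variation of the argument from [b (lift ord0 i)] through [v] to [b ord0]. The contributions of
    [v] cancel, so off the paths [th i] is a real branch of [tg i]. *)
Let th (i : 'I_d) w := ang (p (lift ord0 i)) w - ang (p ord0) w.
Let tg (i : 'I_d) w := arg (b ord0 - w) - arg (b (lift ord0 i) - w).

Lemma th_cont i w : ~ O w -> w <> v -> {for w, continuous (th i)}.
Proof. by move=> Ow wv; apply: cvgB; apply: ang_cont => //; exact: p_trk. Qed.

Lemma th_eqm i w : ~ O w -> w <> v -> eqm (th i w) (tg i w).
Proof.
move=> Ow wv; have -> : tg i w = (arg (v - w) - arg (b (lift ord0 i) - w)) - (arg (v - w) - arg (b ord0 - w)).
  by rewrite /tg; lra.
have h k : eqm (ang (p k) w) (arg (v - w) - arg (b k - w)).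
  by have := ang_eqm (@cp k) (@p_trk k w Ow wv); rewrite p1.
exact: eqmB.
Qed.

Let loc (c w : plane) := prin (arg (c - w) - arg (c - v)).
(** A branch of [tg i] that is continuous in a neighbourhood of [v], including [v] itself, through
    which all the paths run. *)
Let br (i : 'I_d) w := loc (b ord0) w - loc (b (lift ord0 i)) w + tg i v.

Lemma loc_nbhs c : c <> v ->
  nbhs v [set w | {for w, continuous (loc c)} /\ eqm (loc c w) (arg (c - w) - arg (c - v))].
Proof.
move=> cv; pose h w : R := arg (c - w) - arg (c - v).
have hc w : c <> w -> ccontat h w.
  by move=> cw; apply: ccontatB; [exact: arg_sub_ccontat|apply: ccontat_cont; exact: cvg_cst].
have n1 : nbhs v [set w : plane | 0 < cos (h w)].
  have [ch _] := hc v cv.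
  have : nbhs (cos (h v)) [set x : R | 0 < x].
    by apply: open_nbhs_nbhs; split; [exact: open_gt|rewrite /= /h subrr cos0 ltr01].
  by move=> /ch.
have n2 : nbhs v [set w : plane | c <> w].
  have : nbhs v (~` [set c]).
    apply: open_nbhs_nbhs; split; last by move=> /= E; apply: cv.
    by apply: closed_openC; apply: plane_compact_closed; exact: compact_set1.
  by apply: filterS => w /= cw E; apply: cw.
apply: filterS (filterI n1 n2) => w [/= h1 h2]; split; last exact: prin_eqm.
by apply: prin_continuous => //; exact: hc.
Qed.

Lemma br_nbhs : nbhs v [set w | forall i, {for w, continuous (br i)} /\ eqm (br i w) (tg i w)].
Proof.
apply: (@filter_forall _ _ (fun i => [set w | {for w, continuous (br i)} /\ eqm (br i w) (tg i w)]) _ (nbhs_filter v)).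
move=> i; apply: filterS (filterI (loc_nbhs (b_neq (i := ord0))) (loc_nbhs (b_neq (i := lift ord0 i)))).
move=> w [[c1 q1] [c2 q2]]; split.
  by apply: cvgD; [apply: cvgB => //|exact: cvg_cst].
have -> : tg i w = (arg (b ord0 - w) - arg (b ord0 - v)) -
  (arg (b (lift ord0 i) - w) - arg (b (lift ord0 i) - v)) + tg i v by rewrite /tg; lra.
by apply: eqmD; [exact: eqmB|exact: eqm_refl].
Qed.

(** On a connected initial piece of the arc [j], without [v], the difference [th i - br i] is
    continuous with values in the multiples of [tau], hence constant. Close to [v] every point
    outside [O] other than [v] lies on such a piece. *)
Lemma local_branches : exists a : 'I_d -> J -> int,
  nbhs v [set w | ~ O w -> w <> v -> exists j, forall i, th i w = br i w + (a i j)%:~R * tau R].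
Proof.
have /nbhs_ballP[rho /= rho0 hrho] := br_nbhs.
have /choice[t ht] : forall j, exists t, 0 < t <= 1 /\ forall s, 0 <= s <= t -> ball v rho (e j s).
  move=> j; have : nbhs (0 : R) (e j @^-1` ball v rho).
    by apply: ce; rewrite e0; exact: nbhsx_ballx.
  move=> /nbhs_ballP[x /= x0 hx]; exists (Num.min 1 (x / 2)).
  split; first by rewrite lt_min ltr01 divr_gt0//= ge_min lexx.
  move=> s /andP[s0]; rewrite le_min => /andP[_ sx]; apply: hx.
  by rewrite /ball /= sub0r normrN ger0_norm//; lra.
have inO j s : 0 < s <= t j -> [/\ ~ O (e j s), e j s <> v & ball v rho (e j s)].
  move=> /andP[s0 st]; have [/andP[t0 t1] h] := ht j.
  split; last by apply: h; rewrite ltW.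
    by case=> _; apply; apply: eK; rewrite ltW//= (le_trans st).
  by apply: ev; rewrite s0 (le_trans st).
have dif j s i : 0 < s <= t j -> eqm (th i (e j s) - br i (e j s)) 0.
  move=> /inO[h1 h2 /hrho/(_ i)[_ h3]]; rewrite -(subrr (tg i (e j s))); apply: eqmB => //.
  exact: th_eqm.
have tt j : 0 < t j <= t j by have [/andP[-> _] _] := ht j; rewrite lexx.
have /choice[a ha] : forall ij : 'I_d * J, exists k : int,
    th ij.1 (e ij.2 (t ij.2)) - br ij.1 (e ij.2 (t ij.2)) = k%:~R * tau R.
  by move=> [i j] /=; have [k ->] := dif j (t j) i (tt j); exists k; rewrite add0r.
exists (fun i j => a (i, j)).
have con j i s : 0 < s <= t j -> th i (e j s) - br i (e j s) = (a (i, j))%:~R * tau R.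
  move=> st; rewrite -(ha (i, j)) /=.
  apply: (@eqm_connected _ _ (fun s => th i (e j s) - br i (e j s)) [set s | 0 < s <= t j]) => //=.
  - apply/connected_intervalP => x y /= /andP[x0 _] /andP[_ y1] z /andP[xz zy].
    by rewrite (lt_le_trans x0 xz) (le_trans zy).
  - apply: continuous_in_subspaceT => z; rewrite inE /= => /inO[h1 h2 /hrho/(_ i)[h3 _]].
    apply: (@continuous_comp _ _ _ (e j) (fun w => th i w - br i w)); first exact: ce.
    by apply: cvgB; [exact: th_cont|exact: h3].
  - by move=> z /(dif j z i).
have [K' [cK' vK' hK']] := Kloc.
have n1 : nbhs v (ball v r `&` ~` K').
  apply: filterI; first exact: nbhsx_ballx.
  by apply: open_nbhs_nbhs; split => //; exact: closed_openC.
have n2 : nbhs v [set w | forall j, ~ (e j @` [set s | t j <= s <= 1]) w].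
  apply: (@filter_forall _ _ (fun j => [set w | ~ (e j @` [set s | t j <= s <= 1]) w]) _ (nbhs_filter v)) => j.
  apply: open_nbhs_nbhs; split.
    by apply: closed_openC; apply: plane_compact_closed; exact: segment_image_compact.
  move=> [s /= /andP[s1 s2] E]; have /andP[t0 _] := tt j.
  by apply: (@ev j s) => //; rewrite s2 andbT (lt_le_trans t0).
apply: filterS (filterI n1 n2) => w [[bw nK'] nt] Ow wv.
have Kw : K w by apply: contrapT => nK; apply: Ow.
case: (hK' w Kw) => // -[j [s [/andP[s0 s1] E]]].
exists j => i; have st : 0 < s <= t j.
  apply/andP; split.
    by rewrite lt_neqAle s0 andbT; apply/eqP => E0; apply: wv; rewrite E -E0 e0.
  by rewrite leNgt; apply/negP => h; apply: (nt j); exists s => //=; rewrite (ltW h).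
by rewrite -(con j i s)// E addrC subrK.
Qed.

Lemma too_many_accesses : (forall i j, i != j -> ~ joined O (b i) (b j)) -> False.
Proof.
move=> sep; have [a na] := local_branches.
have [m [[i0 mi0] [c hc]]] := int_relation a Jd d0.
pose Br w := \sum_i (m i)%:~R * br i w + c%:~R * tau R.
pose Th w := if w == v then Br v else \sum_i (m i)%:~R * th i w.
pose Tg (w : plane) := \sum_i (m i)%:~R * tg i w.
have ThE : nbhs v [set w | ~ O w -> Th w = Br w].
  apply: filterS na => w h Ow; rewrite /Th; case: eqP => [->//|wv].
  have [j hj] := h Ow wv; rewrite /Br -(hc j) rmorph_sum/= mulr_suml -big_split/=.
  by apply: eq_bigr => i _; rewrite hj mulrDr intrM mulrA.
have brv i : {for v, continuous (br i)} /\ eqm (br i v) (tg i v).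
  by have := nbhs_singleton br_nbhs; exact.
have cTh : {within ~` O, continuous Th}.
  apply/subspace_continuousP => w Ow; have [wv|wv] := pselect (w = v).
    rewrite wv; suff : Th x @[x --> within (~` O) (nbhs v)] --> Th v by [].
    have -> : Th v = Br v by rewrite /Th eqxx.
    have cB : {for v, continuous Br}.
      apply: cvgD; last exact: cvg_cst.
      by apply: sum_cont => i _; apply: cvgM; [exact: cvg_cst|have [] := brv i].
    have cBw : Br x @[x --> within (~` O) (nbhs v)] --> Br v.
      exact: (cvg_within_filter (~` O) cB).
    apply: cvg_trans cBw; apply: near_eq_cvg.
    have : nbhs v [set z | (~` O) z -> Br z = Th z] by apply: filterS ThE => z h /h ->.
    by [].
  suff : Th x @[x --> within (~` O) (nbhs w)] --> Th w by [].
  suff cW : {for w, continuous Th} by exact: (cvg_within_filter (~` O) cW).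
  apply: (@near_cont _ _ (fun w => \sum_i (m i)%:~R * th i w)).
    have : nbhs w (~` [set v]).
      apply: open_nbhs_nbhs; split => //.
      by apply: closed_openC; apply: plane_compact_closed; exact: compact_set1.
    by apply: filterS => z /= /eqP/negbTE zv; rewrite /Th zv.
  by apply: sum_cont => i _; apply: cvgM; [exact: cvg_cst|exact: th_cont].
have eTh w : ~ O w -> eqm (Th w) (Tg w).
  move=> Ow; rewrite /Th; case: eqP => [->|wv].
    rewrite /Br -[Tg v]addr0; apply: eqmD; last by exists c; rewrite add0r.
    by apply: eqm_sum => i _; apply: eqmZ; have [] := brv i.
  by apply: eqm_sum => i _; apply: eqmZ; exact: th_eqm.
(* The component to be filled is that of a base point with nonzero coefficient; separation keeps all
   the other base points out of its closure. *)
pose i1 := lift ord0 i0; pose U := [set w | joined O (b i1) w].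
have oU : open U by apply: joined_open; exact: O_open.
have UO w : U w -> O w by move=> h; have [] := joined_in h.
have bU w : closure U w -> ~ U w -> ~ O w by apply: joined_boundary; exact: O_open.
have bcl i : i != i1 -> ~ closure U (b i).
  move=> ii cb; have nU : ~ U (b i) by apply: sep; rewrite eq_sym.
  by apply: (bU _ cb nU); exact: b_in.
pose E := closure U `&` ~` U.
have UM w : U w -> `|w.1| <= `|v.1| + r /\ `|w.2| <= `|v.2| + r.
  move=> Uw; have [/planeballE[h1 h2] _] := UO w Uw; split.
    by have := ler_normD v.1 (w.1 - v.1); rewrite addrC subrK distrC; lra.
  by have := ler_normD v.2 (w.2 - v.2); rewrite addrC subrK distrC; lra.
pose M := `|v.1| + `|v.2| + r.
have clM w : closure U w -> `|w.1| <= M /\ `|w.2| <= M.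
  have cM : closed [set w : plane | `|w.1| <= M /\ `|w.2| <= M].
    by apply: plane_compact_closed; exact: cbox_compact.
  move=> cw; have : closure [set w : plane | `|w.1| <= M /\ `|w.2| <= M] w.
    apply: closure_subset cw => z /UM[h1 h2]; rewrite /M; split.
      by apply: le_trans h1 _; rewrite lerD2r lerDl.
    by apply: le_trans h2 _; rewrite lerD2r lerDr.
  by move/closure_id: cM => <-.
have cE : compact E.
  apply: (@subclosed_compact _ _ [set w : plane | `|w.1| <= M /\ `|w.2| <= M]).
  - by apply: closedI; [exact: closed_closure|exact: open_closedC].
  - exact: cbox_compact.
  - by move=> w [/clM].
have [g cg gE] : exists2 g : plane -> R, continuous g & forall w, E w -> g w = Th w.
  apply: tietze_compact => //; apply: continuous_subspaceW cTh => w [cw nU].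
  exact: bU.
pose S := \sum_i m i.
(* On the boundary of [U] the extension [g] is congruent to the sum of the [m i * tg i w]; solving
   this for the term of [b i1] gives [f1] and [f2]. The base points in [f1] lie off the closure of
   [U] and that of [f2] lies in [U], so neither formula is singular where it is used. *)
pose f1 w := g w - S%:~R * arg (b ord0 - w) +
  \sum_(i | i != i0) (m i)%:~R * arg (b (lift ord0 i) - w).
pose f2 (w : plane) := - ((m i0)%:~R * arg (b i1 - w)) : R.
have argc i w : b i <> w -> ccontat (fun w : plane => arg (b i - w)) w by exact: arg_sub_ccontat.
have Ub : U (b i1).
  exists (fun=> b i1); split => //; first by move=> ?; exact: cvg_cst.
  by move=> t _; exact: b_in.
have cf w : ccontat (fun z => if `[< U z >] then f1 z else f2 z) w.
  apply: ccontat_patch => // {}w.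
  - move=> cw; apply: ccontatD.
      apply: ccontatB; first by apply: ccontat_cont; exact: cg.
      by apply: ccontatZ; apply: argc => Ew; apply: (@bcl ord0) => //; rewrite Ew.
    apply: ccontat_sum => i ii; apply: ccontatZ; apply: argc => Ew.
    by apply: (@bcl (lift ord0 i)); rewrite ?Ew// (inj_eq lift_inj).
  - move=> nU; apply: ccontatN; apply: ccontatZ; apply: argc => Ew; by apply: nU; rewrite -Ew.
  - move=> cw nU; rewrite /f1 gE//; have Ow := bU _ cw nU.
    have -> : f2 w = Tg w - S%:~R * arg (b ord0 - w) +
        \sum_(i | i != i0) (m i)%:~R * arg (b (lift ord0 i) - w).
      rewrite /Tg /S rmorph_sum/= mulr_suml -sumrB (bigD1 i0)//= -addrA -big_split/= big1.
        by rewrite addr0 /f2 /tg -/i1; lra.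
      by move=> i _; rewrite /tg; lra.
    by apply: eqmD; [apply: eqmB => //; [exact: eTh|exact: eqm_refl]|exact: eqm_refl].
suff : - m i0 = 0 by move/eqP; rewrite oppr_eq0 (negbTE mi0).
have MM : 0 < M + M + 1 by rewrite ltr_wpDl// !addr_ge0// ltW.
apply: (@no_winding_extensionN _ _ (b i1) (- m i0) _ cf MM) => w hw.
rewrite asboolF; first by rewrite /f2 intrN mulNr; exact: eqm_refl.
move=> Uw; have [h1 h2] := clM w (subset_closure Uw).
have [h3 h4] := clM _ (subset_closure Ub).
by case: hw; rewrite leNgt => /negP; apply; apply: le_lt_trans (ler_normB _ _) _; lra.
Qed.

End LocalAccess.

(** * Winding numbers of cycles *)

Section Cycles.
Variable R : realType.
Local Notation plane := (R * R)%type.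

Section Arc.
Variable al : R -> plane.
Hypothesis cal : continuous al.
Hypothesis ial : forall s t, 0 <= s <= 1 -> 0 <= t <= 1 -> al s = al t -> s = t.

Lemma interior_neq t0 : 0 < t0 < 1 -> al 0 <> al t0 /\ al 1 <> al t0.
Proof.
move=> /andP[h0 h1]; split => /ial; rewrite !lexx ler01 !ltW// => /(_ isT isT) E.
  by rewrite -E ltxx in h0.
by rewrite -E ltxx in h1.
Qed.

(** An arc has no interior: [jump], applied to a local branch of the difference of the arguments of
    its ends, produces points off the arc in every ball around an interior point. *)
Lemma arc_thin t0 e : 0 < t0 < 1 -> 0 < e -> exists2 a, ball (al t0) e a & ~ trk al a.
Proof.
move=> t01 e0; have [n0 n1] := interior_neq t01.
have := filterI (nbhsx_ballx (al t0) e e0) (filterI (loc_nbhs n0) (loc_nbhs n1)).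
move=> /(_ _ _)/nbhs_ballP[d /= d0 hd].
pose loc (c w : plane) : R := prin (arg (c - w) - arg (c - al t0)).
pose Th (w : plane) := loc (al 1) w - loc (al 0) w + (arg (al 1 - al t0) - arg (al 0 - al t0)).
have [w bw|a [b [ba _ na _ _]]] := @jump _ al Th t0 d cal ial t01 d0.
  have [_ [[c0 q0] [c1 q1]]] := hd w bw; split.
    by apply: cvgD; [exact: cvgB|exact: cvg_cst].
  have -> : arg (al 1 - w) - arg (al 0 - w) = (arg (al 1 - w) - arg (al 1 - al t0)) -
    (arg (al 0 - w) - arg (al 0 - al t0)) + (arg (al 1 - al t0) - arg (al 0 - al t0)) by lra.
  by apply: eqmD; [exact: eqmB|exact: eqm_refl].
by exists a => //; have [] := hd a ba.
Qed.

(* By density of the complement of the arc, [jump] only needs its congruence off the arc. *)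
Lemma jump_off (Th : plane -> R) t0 e : 0 < t0 < 1 -> 0 < e ->
  (forall w, ball (al t0) e w -> {for w, continuous Th}) ->
  (forall w, ball (al t0) e w -> ~ trk al w -> eqm (Th w) (arg (al 1 - w) - arg (al 0 - w))) ->
  exists a b, [/\ ball (al t0) e a, ball (al t0) e b, ~ trk al a, ~ trk al b &
     ang al a - Th a != ang al b - Th b].
Proof.
move=> t01 e0 cT eT; have [n0 n1] := interior_neq t01.
have av (c : plane) : c <> al t0 -> nbhs (al t0) (~` [set c]).
  move=> ct; apply: open_nbhs_nbhs; split => /=; last by move=> E; apply: ct.
  by apply: closed_openC; apply: plane_compact_closed; exact: compact_set1.
have := filterI (nbhsx_ballx (al t0) e e0) (filterI (av _ n0) (av _ n1)).
move=> /(_ _ _)/nbhs_ballP[d /= d0 hd].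
suff H w : ball (al t0) d w -> {for w, continuous Th} /\ eqm (Th w) (arg (al 1 - w) - arg (al 0 - w)).
  have [a [b [ba bb na nb ab]]] := jump cal ial t01 d0 H.
  by exists a, b; split => //; [have [] := hd a ba|have [] := hd b bb].
move=> bw; have [bw' [w0 w1]] := hd w bw; split; first exact: cT.
pose D w := Th w - (arg (al 1 - w) - arg (al 0 - w)).
have cD : ccontat D w.
  apply: ccontatB; first by apply: ccontat_cont; exact: cT.
  by apply: ccontatB; apply: arg_sub_ccontat => E; [apply: w1|apply: w0].
suff D1 : cos (D w) = 1.
  rewrite -[X in eqm _ X]add0r -[X in eqm X _](subrK (arg (al 1 - w) - arg (al 0 - w))).
  by apply: eqmD; [exact: cos1_eqm|exact: eqm_refl].
have off z : ball (al t0) d z -> ~ trk al z -> cos (D z) = 1.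
  move=> bz nz; rewrite -(cos0 R); apply: eqm_cos.
  rewrite -(subrr (arg (al 1 - z) - arg (al 0 - z))); apply: eqmB; last exact: eqm_refl.
  by apply: eT => //; have [] := hd z bz.
have [[s /andP[s0 s1] sw]|] := pselect (trk al w); last exact: off.
have s01 : 0 < s < 1.
  rewrite !lt_neqAle s0 s1 !andbT; apply/andP; split; apply/eqP => E.
    by apply: w0; rewrite /= -sw -E.
  by apply: w1; rewrite /= -sw E.
apply/eqP/negPn/negP => ne.
have nD : nbhs w [set z | cos (D z) != 1].
  have [c _] := cD; have : nbhs (cos (D w)) [set x : R | x != 1].
    by apply: open_nbhs_nbhs; split => //; exact: open_neq.
  by move=> /c.
have nb : nbhs w (ball (al t0) d) by apply: open_nbhs_nbhs; split => //; exact: ball_open.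
have := filterI nD nb.
move=> /(_ _)/nbhs_ballP[r /= r0 hr].
have [a ba na] := arc_thin s01 r0; rewrite sw in ba; have [/= h1 h2] := hr a ba.
by move: h1; rewrite off// eqxx.
Qed.

End Arc.

Variables (E V : finType) (al : E -> R -> plane) (tl hd : E -> V) (z : V -> plane).
Hypothesis cal : forall e, continuous (al e).
Hypothesis ial : forall e s t, 0 <= s <= 1 -> 0 <= t <= 1 -> al e s = al e t -> s = t.
Hypothesis al0 : forall e, al e 0 = z (tl e).
Hypothesis al1 : forall e, al e 1 = z (hd e).
Hypothesis free_pt : forall e, exists t0, 0 < t0 < 1 /\ forall f, f != e -> ~ trk (al f) (al e t0).

Definition arcs : set plane := [set w | exists e, trk (al e) w].

Definition winding (c : E -> R) (w : plane) : R := \sum_e c e * ang (al e) w.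

Definition cycle (c : E -> int) := forall v, \sum_e c e * ((hd e == v)%:Z - (tl e == v)%:Z) = 0.

Lemma arcs_fin : arcs = \bigcup_(e in [set: E]) trk (al e).
Proof.
by apply/seteqP; split => w [e]; [exists e|move=> _ ?; exists e].
Qed.

Lemma arcs_closed : closed arcs.
Proof.
rewrite arcs_fin; apply: closed_bigcup => [|e _]; first exact: finite_finset.
exact: trk_closed.
Qed.

Lemma winding_cont c w : ~ arcs w -> {for w, continuous (winding c)}.
Proof.
move=> nw; apply: sum_cont => e _; apply: cvgM; first exact: cvg_cst.
by apply: ang_cont => // h; apply: nw; exists e.
Qed.

(** Modulo [tau] only the arguments of the ends count; summed over vertices instead of edges, they
    have the boundary of [c] as coefficients, which is zero. *)
Lemma winding_cycle c w : cycle c -> ~ arcs w -> eqm (winding (fun e => (c e)%:~R) w) 0.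
Proof.
move=> cc nw.
have : \sum_v arg (z v - w) * (\sum_e c e * ((hd e == v)%:Z - (tl e == v)%:Z))%:~R = 0 :> R.
  by rewrite big1// => v _; rewrite cc mulr0.
under eq_bigr do rewrite rmorph_sum mulr_sumr.
rewrite exchange_big /= => h0.
suff : eqm (winding (fun e => (c e)%:~R) w) (\sum_e (c e)%:~R * (arg (al e 1 - w) - arg (al e 0 - w))).
  suff -> : \sum_e (c e)%:~R * (arg (al e 1 - w) - arg (al e 0 - w)) = 0 :> R by [].
  rewrite -[RHS]h0; apply: eq_bigr => e _; rewrite al0 al1.
  under eq_bigr do rewrite intrM intrB mulrCA mulrBr.
  rewrite -mulr_sumr sumrB; congr (_ * (_ - _)).
    by rewrite (bigD1 (hd e))//= eqxx mulr1 big1 ?addr0// => v; rewrite eq_sym => /negbTE ->; rewrite mulr0.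
  by rewrite (bigD1 (tl e))//= eqxx mulr1 big1 ?addr0// => v; rewrite eq_sym => /negbTE ->; rewrite mulr0.
apply: eqm_sum => e _; apply: eqmZ; by apply: ang_eqm => // h; apply: nw; exists e.
Qed.

(** Near a point of [e] off all other arcs, a constant total with [c e] nonzero could be solved for
    [ang (al e)]. This gives a branch [Th] continuous across the arc that equals [ang (al e)] on
    both sides, against [jump_off]. *)
Lemma winding_support (c : E -> R) (C : R) e :
  (forall w, ~ arcs w -> winding c w = C) -> c e = 0.
Proof.
move=> H; apply/eqP/negPn/negP => ce0; have [t0 [t01 ht0]] := free_pt e.
pose K' : set plane := \bigcup_(f in [set f | f != e]) trk (al f).
have cK' : closed K'.
  by apply: closed_bigcup => [|f _]; [exact: finite_finset|exact: trk_closed].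
have nK' : ~ K' (al e t0) by move=> [f /= fe]; exact: ht0.
have [r r0 hr] := closed_dist cK' nK'.
pose Th w := (C - \sum_(f | f != e) c f * ang (al f) w) / c e.
have off w : ball (al e t0) r w -> ~ trk (al e) w -> Th w = ang (al e) w.
  move=> bw nw; have nK : ~ arcs w.
    move=> [f fw]; have [E'|fe] := eqVneq f e; first by apply: nw; rewrite -E'.
    by apply: (hr w bw); exists f.
  by rewrite /Th -(H w nK) /winding (bigD1 e)//= addrK mulrC mulKf.
have [|w bw nw|a [b [ba bb na nb]]] := @jump_off (al e) (@cal e) (@ial e) Th t0 r t01 r0.
- move=> w bw; apply: cvgM; last exact: cvg_cst.
  apply: cvgB; first exact: cvg_cst.
  apply: sum_cont => f fe; apply: cvgM; first exact: cvg_cst.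
  by apply: ang_cont => // h; apply: (hr w bw); exists f.
- by rewrite off//; exact: ang_eqm.
by rewrite !off// !subrr eqxx.
Qed.

(** With [l + 1] classes only [l] differences of values have to vanish, whereas the cycle space has
    dimension at least [l + 1]. Some nontrivial real combination of cycles thus has constant
    winding, so it is zero by [winding_support], against independence. *)
Lemma few_classes (l : nat) (val : (E -> int) -> 'I_l.+1 -> R) (v0 : V) :
  (l + #|V| <= #|E|)%N ->
  (forall w, ~ arcs w -> exists i, forall c, cycle c -> winding (fun e => (c e)%:~R) w = val c i) ->
  False.
Proof.
move=> lE hval.
pose B : 'M[rat]_(#|E|, #|V|) := \matrix_(i, j)
  (((hd (enum_val i) == enum_val j)%:Z - (tl (enum_val i) == enum_val j)%:Z)%:~R).
(* Every edge has one head and one tail, so the rows of the incidence matrix sum to zero. *)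
have rB : (\rank B < #|V|)%N.
  apply: (@rank_lt_col _ _ _ _ (const_mx 1)).
    apply/eqP => /matrixP/(_ (enum_rank v0) 0); rewrite !mxE => /eqP; by rewrite oner_eq0.
  apply/matrixP => i k; rewrite !mxE.
  under eq_bigr do rewrite !mxE mulr1 intrB.
  rewrite sumrB; set s := enum_val i.
  have one (u : V) : \sum_(j < #|V|) ((u == enum_val j)%:Z)%:~R = 1 :> rat.
    rewrite (bigD1 (enum_rank u))//= enum_rankK eqxx big1 ?addr0// => j hj.
    case: eqP => // E1; case/eqP: hj; rewrite E1; exact: esym (enum_valK j).
  by rewrite !one subrr.
have [Z [fZ ZB]] := int_kernel B.
pose c k e : int := Z k (enum_rank e).
have cc k : cycle (c k).
  move=> v; have /matrixP/(_ k (enum_rank v)) := ZB; rewrite !mxE => h.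
  apply/eqP; rewrite -(intr_eq0 rat) rmorph_sum/= -[X in _ == X]h.
  apply/eqP; rewrite (reindex (@enum_val E predT)); last first.
    by apply: onW_bij; exact: enum_val_bij.
  by apply: eq_bigr => i _; rewrite !mxE enum_rankK intrM /c enum_valK.
pose q := (#|E| - \rank B)%N.
pose A : 'M[R]_(q, l) := \matrix_(k, i) (val (c k) (lift ord0 i) - val (c k) ord0).
have ker0 : kermx A != 0.
  rewrite kermx_eq0 /row_free; apply/eqP => h; have := rank_leq_col A; rewrite h /q; lia.
have /rowV0Pn[lam /sub_kermxP lamA lam0] := ker0.
pose c' e : R := \sum_k lam 0 k * (c k e)%:~R.
have wE w : winding c' w = \sum_k lam 0 k * winding (fun e => (c k e)%:~R) w.
  rewrite /winding /c'; under eq_bigr do rewrite mulr_suml.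
  rewrite exchange_big; apply: eq_bigr => k _; rewrite mulr_sumr.
  by apply: eq_bigr => e _; rewrite mulrA.
have c'0 e : c' e = 0.
  apply: (@winding_support c' (\sum_k lam 0 k * val (c k) ord0)) => w nw.
  have [i hi] := hval w nw; rewrite wE.
  under eq_bigr do rewrite (hi _ (cc _)).
  have [[j ->]|->] : (exists j, i = lift ord0 j) \/ i = ord0; last by [].
    by case: (unliftP ord0 i) => [j ->|->]; [left; exists j|right].
  apply/eqP; rewrite -subr_eq0 -sumrB; have /matrixP/(_ 0 j) := lamA; rewrite !mxE => h.
  by rewrite -[X in _ == X]h; apply/eqP; apply: eq_bigr => k _; rewrite !mxE mulrBr.
(* Independence was obtained over the rationals; the rank does not change when the field is extended
   to [R]. *)
have fZR : row_free (map_mx intr Z : 'M[R]_(q, #|E|)).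
  have -> : map_mx intr Z = map_mx (ratr : rat -> R) (map_mx intr Z).
    by apply/matrixP => i j; rewrite !mxE ratr_int.
  by rewrite row_free_map.
case/eqP: lam0; apply: (row_free_inj fZR); rewrite mul0mx.
apply/matrixP => i j; rewrite !mxE ord1 -[RHS](c'0 (enum_val j)).
by apply: eq_bigr => k _; rewrite !mxE /c enum_valK.
Qed.

End Cycles.

(** * Stereographic projection *)

Section Chart.
Variable R : realType.
Local Notation plane := (R * R)%type.
Local Notation point := (R * R * R)%type.
Local Notation sphere := (@sphere R).

Definition dist2 (x y : point) : R :=
  (x.1.1 - y.1.1) ^+ 2 + (x.1.2 - y.1.2) ^+ 2 + (x.2 - y.2) ^+ 2.

Lemma pointballE (x : point) e y : ball x e y <->
  [/\ `|x.1.1 - y.1.1| < e, `|x.1.2 - y.1.2| < e & `|x.2 - y.2| < e].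
Proof. by split => [[[]]//|[]]. Qed.

Lemma coord1 (x : point) : {for x, continuous (fun x : point => x.1.1)}.
Proof. by apply: (@continuous_comp _ _ _ (fun x : point => x.1) fst); exact: cvg_fst. Qed.

Lemma coord2 (x : point) : {for x, continuous (fun x : point => x.1.2)}.
Proof. by apply: (@continuous_comp _ _ _ (fun x : point => x.1) snd); [exact: cvg_fst|exact: cvg_snd]. Qed.

Lemma coord3 (x : point) : {for x, continuous (fun x : point => x.2)}.
Proof. exact: cvg_snd. Qed.

Let N : point := (0, 0, 1).

(* Householder reflection exchanging [P] and the north pole. *)
Lemma reflection P : sphere P -> exists h : point -> point,
  [/\ continuous h, involutive h, h P = N, h (0, 0, 0) = (0, 0, 0) &
   forall x y, dist2 (h x) (h y) = dist2 x y].
Proof.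
case: P => [[a b] c]; rewrite /Defs.sphere /= => sP.
(* On the sphere [c = 1] means that the point is already the pole, where the reflecting vector
   [(a, b, c - 1)] vanishes. *)
have [c1|c1] := eqVneq c 1.
  exists id; split => //; first by move=> x; exact: cvg_id.
  rewrite /N c1; move: sP; rewrite c1 expr1n => /eqP.
  rewrite -subr_eq0 addrK paddr_eq0 ?sqr_ge0// !sqrf_eq0.
  by move=> /andP[/eqP-> /eqP->].
(* The Householder factor, 2 over the squared length of the reflecting vector, which is
   [2 * (1 - c)]. *)
pose l := (1 - c)^-1.
have l1 : l * (1 - c) = 1 by rewrite mulVf// subr_eq0 eq_sym.
pose k (x : point) : R := l * (x.1.1 * a + x.1.2 * b + x.2 * (c - 1)).
pose h (x : point) : point := (x.1.1 - k x * a, x.1.2 - k x * b, x.2 - k x * (c - 1)).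
have uu : a ^+ 2 + b ^+ 2 + (c - 1) ^+ 2 = 2 * (1 - c).
  have -> : a ^+ 2 + b ^+ 2 + (c - 1) ^+ 2 = (a ^+ 2 + b ^+ 2 + c ^+ 2) + 1 - 2 * c by ring.
  by rewrite sP; ring.
have kh x : k (h x) = - k x.
  rewrite {1}/k /h /=.
  have -> : l * ((x.1.1 - k x * a) * a + (x.1.2 - k x * b) * b + (x.2 - k x * (c - 1)) * (c - 1)) =
    l * (x.1.1 * a + x.1.2 * b + x.2 * (c - 1)) - l * (k x * (a ^+ 2 + b ^+ 2 + (c - 1) ^+ 2)) by ring.
  rewrite uu -/(k x); have -> : l * (k x * (2 * (1 - c))) = 2 * k x * (l * (1 - c)) by ring.
  by rewrite l1; ring.
exists h; split.
- have ck x : {for x, continuous k}.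
    apply: cvgM; first exact: cvg_cst.
    apply: cvgD; first apply: cvgD.
    + by apply: cvgM; [exact: coord1|exact: cvg_cst].
    + by apply: cvgM; [exact: coord2|exact: cvg_cst].
    + by apply: cvgM; [exact: coord3|exact: cvg_cst].
  move=> x; apply: (@pair_cont _ _ _ (fun x : point => (x.1.1 - k x * a, x.1.2 - k x * b))
    (fun x : point => x.2 - k x * (c - 1))).
    apply: (@pair_cont _ _ _ (fun x : point => x.1.1 - k x * a) (fun x : point => x.1.2 - k x * b)).
      by apply: cvgB; [exact: coord1|apply: cvgM; [exact: ck|exact: cvg_cst]].
    by apply: cvgB; [exact: coord2|apply: cvgM; [exact: ck|exact: cvg_cst]].
  by apply: cvgB; [exact: coord3|apply: cvgM; [exact: ck|exact: cvg_cst]].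
- move=> [[x y] z]; rewrite {1}/h kh /h /= !mulNr !opprK !subrK.
  by [].
- have kP : k (a, b, c) = 1.
    rewrite /k /=; have -> : a * a + b * b + c * (c - 1) = (a ^+ 2 + b ^+ 2 + c ^+ 2) - c by ring.
    by rewrite sP.
  by rewrite /h kP /= !mul1r !subrr opprB addrC subrK.
- by rewrite /h /k /= !mul0r !addr0 mulr0 !mul0r subr0.
- move=> x y; pose t := k x - k y.
  have tE : t = l * ((x.1.1 - y.1.1) * a + (x.1.2 - y.1.2) * b + (x.2 - y.2) * (c - 1)).
    by rewrite /t /k; ring.
  have -> : dist2 (h x) (h y) = dist2 x y - 2 * t * ((x.1.1 - y.1.1) * a + (x.1.2 - y.1.2) * b + (x.2 - y.2) * (c - 1))
     + t * t * (a ^+ 2 + b ^+ 2 + (c - 1) ^+ 2) by rewrite /dist2 /h /= /t; ring.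
  set s := _ * a + _ + _ in tE *; rewrite uu tE.
  have -> : l * s * (l * s) * (2 * (1 - c)) = 2 * (l * s) * s * (l * (1 - c)) by ring.
  by rewrite l1 mulr1 subrK.
Qed.

Lemma sphere_dist2 x : sphere x <-> dist2 x (0, 0, 0) = 1.
Proof. by rewrite /Defs.sphere /dist2 /= !subr0. Qed.

Lemma dist2C x y : dist2 x y = dist2 y x.
Proof. by rewrite /dist2; ring. Qed.

Let s0 (w : plane) : R := w.1 ^+ 2 + w.2 ^+ 2.
Let iotaN (w : plane) : point := (2 * w.1 / (1 + s0 w), 2 * w.2 / (1 + s0 w), (s0 w - 1) / (1 + s0 w)).
Let sigN (x : point) : plane := (x.1.1 / (1 - x.2), x.1.2 / (1 - x.2)).

Let s1_gt0 w : 0 < 1 + s0 w.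
Proof. by rewrite ltr_wpDr// addr_ge0// sqr_ge0. Qed.

Let s1_neq0 w : 1 + s0 w != 0.
Proof. by rewrite gt_eqF. Qed.

Let x2_neq x : sphere x -> x <> N -> 1 - x.2 != 0.
Proof.
case: x => [[a b] c]; rewrite /Defs.sphere /= => sx xN; apply/eqP => /eqP.
rewrite subr_eq0 => /eqP c1; apply: xN; move: sx; rewrite -c1 expr1n => /eqP.
rewrite -subr_eq0 addrK paddr_eq0 ?sqr_ge0// !sqrf_eq0.
by move=> /andP[/eqP-> /eqP->].
Qed.

Let iotaN_cont : continuous iotaN.
Proof.
have c1 (w : plane) : {for w, continuous (fun w : plane => w.1)} by exact: cvg_fst.
have c2 (w : plane) : {for w, continuous (fun w : plane => w.2)} by exact: cvg_snd.
have cs (w : plane) : {for w, continuous s0}.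
  by apply: cvgD; [apply: (@continuous_comp _ _ _ fst (fun x : R => x ^+ 2))|
    apply: (@continuous_comp _ _ _ snd (fun x : R => x ^+ 2))]; rewrite //; exact: exprn_continuous.
have cV (w : plane) : {for w, continuous (fun w => (1 + s0 w)^-1)}.
  by apply: cvgV => //; apply: cvgD; [exact: cvg_cst|exact: cs].
move=> w; apply: (@pair_cont _ _ _ (fun w : plane => (2 * w.1 / (1 + s0 w), 2 * w.2 / (1 + s0 w)))
    (fun w : plane => (s0 w - 1) / (1 + s0 w))).
  apply: (@pair_cont _ _ _ (fun w : plane => 2 * w.1 / (1 + s0 w)) (fun w : plane => 2 * w.2 / (1 + s0 w))).
    by apply: cvgM; [apply: cvgM; [exact: cvg_cst|exact: c1]|exact: cV].
  by apply: cvgM; [apply: cvgM; [exact: cvg_cst|exact: c2]|exact: cV].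
by apply: cvgM; [apply: cvgB; [exact: cs|exact: cvg_cst]|exact: cV].
Qed.

Let iotaN_sphere w : sphere (iotaN w) /\ iotaN w <> N.
Proof.
have n := s1_neq0 w; split.
  rewrite /Defs.sphere /= /s0; field; exact: n.
move=> E; have : (s0 w - 1) / (1 + s0 w) = 1 by have := congr1 snd E.
by move=> /(canRL (divfK n)); lra.
Qed.

Let sigN_K w : sigN (iotaN w) = w.
Proof.
have n := s1_neq0 w; rewrite /sigN /iotaN /=.
have -> : 1 - (s0 w - 1) / (1 + s0 w) = 2 / (1 + s0 w) by field.
by case: w n => x y n; congr (_, _) => /=; field; rewrite n.
Qed.

Let sigN_s x : sphere x -> x <> N -> s0 (sigN x) = (1 + x.2) / (1 - x.2).
Proof.
move=> sx xN; have n := x2_neq sx xN; rewrite /s0 /sigN /=.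
rewrite !expr_div_n -mulrDl.
have -> : x.1.1 ^+ 2 + x.1.2 ^+ 2 = (1 + x.2) * (1 - x.2).
  move: sx; rewrite /Defs.sphere /= => sx.
  have -> : x.1.1 ^+ 2 + x.1.2 ^+ 2 = 1 - x.2 ^+ 2 by rewrite -sx addrK.
  by ring.
by field.
Qed.

Let iotaN_K x : sphere x -> x <> N -> iotaN (sigN x) = x.
Proof.
move=> sx xN; have n := x2_neq sx xN; rewrite /iotaN sigN_s// /sigN /=.
have n2 : 1 - x.2 + (1 + x.2) != 0 by rewrite (_ : 1 - x.2 + (1 + x.2) = 2)//; ring.
by case: x sx xN n n2 => [[a b] c] /= sx xN n n2; congr (_, _, _); field; rewrite n.
Qed.

Let sigN_cont x : sphere x -> x <> N -> {for x, continuous sigN}.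
Proof.
move=> sx xN; have n := x2_neq sx xN.
have cV : {for x, continuous (fun x : point => (1 - x.2)^-1)}.
  by apply: cvgV => //; apply: cvgB; [exact: cvg_cst|exact: coord3].
apply: (@pair_cont _ _ _ (fun x : point => x.1.1 / (1 - x.2)) (fun x : point => x.1.2 / (1 - x.2))).
  by apply: cvgM; [exact: coord1|exact: cV].
by apply: cvgM; [exact: coord2|exact: cV].
Qed.

Let sigN_dist x : sphere x -> x <> N -> dist2 x N * (1 + s0 (sigN x)) = 4.
Proof.
move=> sx xN; have n := x2_neq sx xN; rewrite sigN_s//.
have -> : dist2 x N = 2 * (1 - x.2).
  rewrite /dist2 /= !subr0; move: sx; rewrite /Defs.sphere /= => sx.
  have -> : x.1.1 ^+ 2 + x.1.2 ^+ 2 = 1 - x.2 ^+ 2 by rewrite -sx addrK.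
  by ring.
by field.
Qed.

(* The last clause says how fast [sg] leaves every bounded set near [P]. *)
Definition chart (P : point) (sg : point -> plane) (io : plane -> point) := [/\ continuous io,
  forall w, sphere (io w) /\ io w <> P, forall w, sg (io w) = w,
  forall x, sphere x -> x <> P -> {for x, continuous sg} /\ io (sg x) = x
  & forall x, sphere x -> x <> P -> dist2 x P * (1 + (nrm (sg x)) ^+ 2) = 4].

Lemma chart_exists P : sphere P -> exists sg io, chart P sg io.
Proof.
move=> sP; have [h [ch hh hP h0 hd]] := reflection sP.
have hN : h N = P by rewrite -hP hh.
have hs x : sphere x -> sphere (h x) by move=> /sphere_dist2 h1; apply/sphere_dist2; rewrite -[X in dist2 _ X]h0 hd.
have hx x : x <> P -> h x <> N by move=> xP E; apply: xP; rewrite -(hh x) E.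
have s0E w : s0 w = nrm w ^+ 2.
  have dE : dot w w = s0 w by rewrite /dot /s0 !expr2.
  by rewrite /nrm dE sqr_sqrtr// addr_ge0// sqr_ge0.
exists (sigN \o h), (h \o iotaN); split.
- by move=> w; apply: continuous_comp; [exact: iotaN_cont|exact: ch].
- move=> w; have [h1 h2] := iotaN_sphere w; split; first exact: hs.
  by move=> /= E; apply: h2; rewrite -(hh (iotaN w)) E.
- by move=> w /=; rewrite hh sigN_K.
- move=> x sx xP; split; last by rewrite /= iotaN_K ?hh//; [exact: hs|exact: hx].
  by apply: continuous_comp; [exact: ch|apply: sigN_cont; [exact: hs|exact: hx]].
- move=> x sx xP; rewrite -s0E /= -(hd x) hP; apply: sigN_dist; [exact: hs|exact: hx].
Qed.

Section ChartFacts.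
Variables (P : point) (sg : point -> plane) (io : plane -> point).
Hypothesis ch : chart P sg io.

(** By the last clause of [chart], [nrm w > 2 / d] puts [io w] at Euclidean distance less than [d]
    from [P], hence into a ball that misses [Y]. *)
Lemma chart_far (Y : set point) : closed Y -> ~ Y P -> exists2 M : R, 0 <= M &
  forall w, M < nrm w -> ~ Y (io w).
Proof.
move=> cY nY; have : nbhs P (~` Y) by apply: open_nbhs_nbhs; split => //; exact: closed_openC.
move=> /nbhs_ballP[d /= d0 hd]; exists (2 / d); first by rewrite divr_ge0// ltW.
move=> w wM; apply: hd; have [_ h2 h3 _ h5] := ch; have [sw wP] := h2 w.
have := h5 _ sw wP; rewrite h3 => E.
have dw : 2 < nrm w * d by rewrite -ltr_pdivrMr.
have n0 : 0 < nrm w by apply: le_lt_trans wM; rewrite divr_ge0// ltW.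
have D0 : 0 <= dist2 (io w) P by rewrite !addr_ge0// sqr_ge0.
have lt : dist2 (io w) P < d ^+ 2.
  rewrite ltNge; apply/negP => h.
  have h6 : d ^+ 2 * (1 + nrm w ^+ 2) <= 4 by rewrite -E ler_pM2r// ltr_wpDr// sqr_ge0.
  have h7 : 2 ^+ 2 < (nrm w * d) ^+ 2 by rewrite ltr_pXn2r// nnegrE// ltW// mulr_gt0.
  have h8 : 0 < d ^+ 2 by rewrite exprn_gt0.
  by move: h6 h7; rewrite exprMn mulrDr mulr1 (mulrC (nrm w ^+ 2)) => h6 h7; lra.
have co (x : R) : x ^+ 2 < d ^+ 2 -> `|x| < d.
  by move=> h; rewrite -(@ltr_pXn2r _ 2)// ?nnegrE ?(ltW d0)// real_normK ?num_real.
have sq (x : R) := sqr_ge0 x.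
move: lt; rewrite dist2C /dist2 => lt; apply/pointballE; split; apply: co; apply: le_lt_trans lt.
- by rewrite -addrA lerDl addr_ge0.
- by rewrite addrAC lerDr addr_ge0.
- by rewrite lerDr addr_ge0.
Qed.

(** A point in the ball of radius [d] has squared distance less than [3 * d ^+ 2]. With [d] the
    inverse of [1 + |M|], a projection of norm at most [M] would make the product in the last clause
    of [chart] at most 3 instead of 4. *)
Lemma chart_near (M : R) : exists2 d : R, 0 < d &
  forall x, sphere x -> x <> P -> ball P d x -> M < nrm (sg x).
Proof.
pose d := (1 + `|M|)^-1; have d0 : 0 < d by rewrite invr_gt0 ltr_wpDr.
have dM : d * (1 + `|M|) = 1 by rewrite mulVf// gt_eqF// ltr_wpDr.
exists d => // x sx xP /pointballE[h1 h2 h3].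
have [_ _ _ _ /(_ x sx xP) E] := ch.
have co (y : R) : `|y| < d -> y ^+ 2 < d ^+ 2.
  by move=> h; rewrite -(real_normK (num_real y)) ltr_pXn2r// nnegrE// ltW.
have lt : dist2 P x < 3 * d ^+ 2.
  have := co _ h1; have := co _ h2; have := co _ h3; rewrite /dist2; lra.
rewrite ltNge; apply/negP => h; rewrite dist2C in E.
have n0 : 0 <= nrm (sg x) by exact: sqrtr_ge0.
have D0 : 0 <= dist2 P x by rewrite !addr_ge0// sqr_ge0.
have MM := ler_norm M.
have h4 : nrm (sg x) ^+ 2 <= `|M| ^+ 2 by rewrite ler_pXn2r// ?nnegrE//; exact: le_trans h MM.
have h5 : d ^+ 2 * (1 + `|M| ^+ 2) <= 1.
  by rewrite -[leRHS](expr1n _ 2) -dM exprMn ler_pM2l ?exprn_gt0// sqrrD expr1n mul1r; have := normr_ge0 M; lra.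
have h6 : dist2 P x * (1 + nrm (sg x) ^+ 2) <= 3 * d ^+ 2 * (1 + `|M| ^+ 2).
  by apply: ler_pM => //; [rewrite addr_ge0// sqr_ge0|exact: ltW|rewrite lerD2l].
by move: h6; rewrite E -mulrA => h6; lra.
Qed.

Lemma chart_preimage_closed (Y : set point) : closed Y -> closed (io @^-1` Y).
Proof. by move=> cY; apply: preimage_closed => // w _; have [h _ _ _ _] := ch; exact: h. Qed.

End ChartFacts.
End Chart.

(** * Paths and connected components *)

Section Topology.
Variable R : realType.

(** Arcs and accesses are continuous only within the unit interval; composing with the clamp makes
    them continuous on the line, the form in which all paths are handled. *)
Lemma within_clamp (T : topologicalType) (g : R -> T) :
  {within @I01 R, continuous g} -> continuous (g \o clamp 0 1).
Proof.
move=> /subspace_continuousP h t; have c := h _ (clamp01_in t).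
have k : clamp 0 1 s @[s --> t] --> within (@I01 R) (nbhs (clamp 0 1 t)).
  move=> A nA; have : nbhs t [set s | I01 (clamp 0 1 s) -> A (clamp 0 1 s)].
    exact: (@clamp_continuous R 0 1 t _ nA).
  by apply: filterS => s; apply; exact: clamp01_in.
exact: cvg_comp k c.
Qed.

Lemma component_path (T : topologicalType) (F : set T) (x : T) (c : R -> T) :
  continuous c -> (forall t, 0 <= t <= 1 -> F (c t)) ->
  connected_component F x (c 0) -> connected_component F x (c 1).
Proof.
move=> cc cF c0; apply: connected_component_trans c0 _.
apply: (@connected_component_max _ F (c @` [set t | 0 <= t <= 1])).
- by exists 0 => //=; rewrite lexx ler01.
- by move=> _ [t t01 <-]; exact: cF.
- apply: connected_continuous_connected; first exact: itv01_connected.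
  exact: continuous_subspaceT.
- by exists 1 => //=; rewrite lexx ler01.
Qed.

Lemma path_split (T : topologicalType) (A B : set T) (c : R -> T) :
  continuous c -> closed A -> closed B -> A `&` B = set0 -> A (c 0) -> B (c 1) ->
  (forall t, 0 <= t <= 1 -> A (c t) \/ B (c t)) -> False.
Proof.
move=> cc cA cB AB A0 B1 cov.
suff : ~ connected [set t : R | 0 <= t <= 1] by apply; exact: itv01_connected.
apply/connectedPn.
pose E (b : bool) := [set t : R | 0 <= t <= 1] `&` (if b then c @^-1` A else c @^-1` B).
have cl (b : bool) : closed (E b).
  apply: closedI; first by apply: compact_closed; [exact: Rhausdorff|exact: itv01_compact].
  by case: b; apply: preimage_closed => // t _; exact: cc.
exists E; split.
- by case; [exists 0|exists 1]; rewrite /E /= lexx ler01.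
- by apply/seteqP; split => t; rewrite /E /=; [move=> h; case: (cov t h); [right|left]|move=> [[]|[]]].
- have E0 : E false `&` E true = set0.
    apply/seteqP; split => // t [[_ Bt] [_ At]].
    by have : (A `&` B) (c t) by []; rewrite AB.
  by split; rewrite -(closure_id _).1.
Qed.

End Topology.

(** * Cells of a drawing *)

Section Drawing.
Variables (R : realType) (G : multigraph) (D : gmap R G).
Local Notation plane := (R * R)%type.
Local Notation point := (R * R * R)%type.
Hypothesis hD : is_drawing D.
Hypothesis hc : connected_graph G.
Hypothesis hV : (1 < #|gV G|)%N.

Lemma arcc_cont e : continuous (arc D e \o clamp 0 1).
Proof. by have [_ _ /(_ e)[h _ _ _ _] _ _] := hD; exact: within_clamp. Qed.

Lemma arc_inj e s t : 0 <= s <= 1 -> 0 <= t <= 1 -> arc D e s = arc D e t -> s = t.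
Proof. by have [_ _ /(_ e)[_ h _ _ _] _ _] := hD => s01 t01; exact: h. Qed.

Lemma arc_sphere e t : 0 <= t <= 1 -> sphere (arc D e t).
Proof. by have [_ _ /(_ e)[_ _ h _ _] _ _] := hD => t01; apply: h; exists t. Qed.

Lemma arc_sub_closed e a b : closed ((arc D e \o clamp 0 1) @` [set t | a <= t <= b]).
Proof.
apply: compact_closed; first exact: norm_hausdorff.
by apply: segment_image_compact; exact: arcc_cont.
Qed.

Lemma edge_setE e : edge_set D e = (arc D e \o clamp 0 1) @` [set t | 0 <= t <= 1].
Proof.
by apply/seteqP; split => x [t t01 <-]; exists t => //=; rewrite clamp_id.
Qed.

Lemma edge_closed e : closed (edge_set D e).
Proof. by rewrite edge_setE; exact: arc_sub_closed. Qed.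

Lemma other_vertex (v : gV G) : exists u, u != v.
Proof.
have /card_gt0P[u] : (0 < #|predC1 v|)%N by rewrite cardC1; case: #|_| hV => // -[].
by exists u.
Qed.

Lemma incident_edge v : exists e : gE G, ((ends e).1 == v) || ((ends e).2 == v).
Proof.
have [u uv] := other_vertex v; have /connectP[[|w p] /= ] := hc v u.
  by move=> _ E; rewrite E eqxx in uv.
case/andP => /existsP[e /orP[] /eqP he] _ _; exists e; rewrite he /= eqxx ?orbT//.
Qed.

(** Connectedness and the presence of a second vertex give every vertex an incident edge, so its
    point already lies on an edge. *)
Lemma drawing_setE x : drawing_set D x <-> exists e, edge_set D e x.
Proof.
have [_ _ ha _ _] := hD; split; last by move=> [e h]; right; exists e.
case=> [[v _ <-]|[e _ h]]; last by exists e.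
have [e /orP[] /eqP he] := incident_edge v; exists e; have [_ _ _ h0 h1] := ha e.
  by exists 0; rewrite ?h0 ?he// /I01 /= lexx ler01.
by exists 1; rewrite ?h1 ?he// /I01 /= lexx ler01.
Qed.

Lemma drawing_closed : closed (drawing_set D).
Proof.
have -> : drawing_set D = \bigcup_(e in [set: gE G]) edge_set D e.
  apply/seteqP; split => x; first by move=> /drawing_setE[e h]; exists e.
  by move=> [e _ h]; apply/drawing_setE; exists e.
by apply: closed_bigcup => [|e _]; [exact: finite_finset|exact: edge_closed].
Qed.

Lemma other_edges_closed e : closed (\bigcup_(f in [set f | f != e]) edge_set D f).
Proof. by apply: closed_bigcup => [|f _]; [exact: finite_finset|exact: edge_closed]. Qed.

(** The points shared with other edges are finite in number, while the parameters [1 / (n + 2)] give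
    infinitely many points of [e]. *)
Lemma free_param e : exists t0, 0 < t0 < 1 /\ forall f, f != e -> ~ edge_set D f (arc D e t0).
Proof.
have [_ _ _ _ [fin _ _]] := hD.
apply: contrapT => N.
pose B := \bigcup_(f in [set f | f != e]) (edge_set D e `&` edge_set D f).
have fB : finite_set B.
  apply: bigcup_finite; first exact: finite_finset.
  by move=> f /= fe; apply: fin; rewrite eq_sym.
pose t (n : nat) : R := n.+2%:R^-1.
have t01 n : 0 < t n < 1 by rewrite invr_gt0 ltr0n /= invf_lt1 ?ltr1n// ltr0n.
have tB n : B (arc D e (t n)).
  apply: contrapT => nB; apply: N; exists (t n); split => // f fe h; apply: nB.
  exists f => //; split => //; exists (t n) => //.
  by have /andP[h0 h1] := t01 n; rewrite /I01 /= !ltW.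
have tI n : 0 <= t n <= 1 by have /andP[h0 h1] := t01 n; rewrite !ltW.
apply: infinite_nat; have -> : [set: nat] = (arc D e \o t) @^-1` B.
  by apply/seteqP; split => n _ //; exact: tB.
apply: finite_preimage => // m n _ _ /= /(arc_inj (tI m) (tI n)) /invr_inj /eqP.
by rewrite eqr_nat => /eqP[].
Qed.

(** Project from a point [x] that lies on [e] alone: far out in the plane only [e] is present. If
    the drawing covered the sphere, a far path between two points of [e] on either side of [x] would
    be covered by the two halves of [e], whose preimages are closed and disjoint because their
    common point [x] is missing. *)
Lemma free_point : exists P, free_set D P.
Proof.
have [v _] : exists v : gV G, true by have /card_gt0P[v _] := ltnW hV; exists v.
have [e _] := incident_edge v; have [t0 [t01 ht]] := free_param e.
have t01' : 0 <= t0 <= 1 by case/andP: t01 => h0 h1; rewrite !ltW.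
set x := arc D e t0 in ht; have sx : sphere x by exact: arc_sphere.
have [sg [io ch]] := chart_exists sx.
apply: contrapT => N.
have cov y : sphere y -> drawing_set D y.
  by move=> sy; apply: contrapT => ny; apply: N; exists y.
have nx : ~ (\bigcup_(f in [set f | f != e]) edge_set D f) x by move=> [f fe]; exact: ht.
have [M M0 hM] := chart_far ch (@other_edges_closed e) nx.
have [d d0 hd] := chart_near ch M.
have [ioc io_s sgK ioK _] := ch.
pose a := arc D e \o clamp 0 1.
have near_t0 : nbhs t0 (a @^-1` ball x d).
  by apply: arcc_cont; rewrite /= clamp_id//; exact: nbhsx_ballx.
move: near_t0 => /nbhs_ballP[r /= r0 hr].
have pt s : `|t0 - s| < r -> 0 <= s <= 1 -> s != t0 ->
    M < nrm (sg (arc D e s)) /\ io (sg (arc D e s)) = arc D e s.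
  move=> sr s01 st; have sP : arc D e s <> x.
    by move=> /(arc_inj s01 t01') E; rewrite E eqxx in st.
  have ss := arc_sphere e s01; split; last by have [] := ioK _ ss sP.
  by apply: hd => //; have := hr s sr; rewrite /a /= clamp_id.
have /andP[t00 t11] := t01.
pose m := Num.min r (Num.min t0 (1 - t0)) / 2.
have m0 : 0 < m by rewrite divr_gt0// !lt_min r0 t00 subr_gt0.
have [mr mt mt'] : [/\ m < r, m < t0 & m < 1 - t0].
  have : m < Num.min r (Num.min t0 (1 - t0)) by rewrite ltr_pdivrMr// mulr2n mulrDr mulr1 ltrDl !lt_min r0 t00 subr_gt0.
  by rewrite !lt_min => /andP[-> /andP[-> ->]].
have [n1 i1] := pt (t0 - m) ltac:(rewrite opprB addrC subrK gtr0_norm//) ltac:(lra) ltac:(apply/eqP; lra).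
have [n2 i2] := pt (t0 + m) ltac:(rewrite opprD addNKr normrN gtr0_norm//) ltac:(lra) ltac:(apply/eqP; lra).
have [g [cg g0 g1 gM]] := far_path M0 n1 n2.
pose A := io @^-1` (a @` [set t | 0 <= t <= t0]); pose B := io @^-1` (a @` [set t | t0 <= t <= 1]).
apply: (@path_split _ _ A B g cg).
- by apply: (chart_preimage_closed ch); exact: arc_sub_closed.
- by apply: (chart_preimage_closed ch); exact: arc_sub_closed.
- apply/seteqP; split => // w [[s /= s01 sw] [t /= t1 tw]].
  have [_ iox] := io_s w; apply: iox; rewrite -sw /x; congr (arc D e _).
  have E : clamp 0 1 s = clamp 0 1 t by apply: (@arc_inj e) => //; [exact: clamp01_in|exact: clamp01_in|exact: etrans sw (esym tw)].
  case/andP: s01 => s1 s2; case/andP: t1 => t1 t2; move: E.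
  by rewrite !clamp_id; first (by move=> E; lra); apply/andP; split; lra.
- by rewrite g0; exists (t0 - m); [rewrite /=; lra|rewrite /a /= clamp_id ?i1//; lra].
- by rewrite g1; exists (t0 + m); [rewrite /=; lra|rewrite /a /= clamp_id ?i2//; lra].
move=> t tt; have := cov (io (g t)) (io_s _).1.
move=> /drawing_setE[f fw]; have [fe|fe] := eqVneq f e; last first.
  by exfalso; apply: (hM _ (gM t tt)); exists f.
move: fw; rewrite fe => -[s /andP[s0 s1] sw].
have [st|st] := leP s t0; [left|right]; exists s => //=; rewrite ?s0 ?s1 ?(ltW st)//.
  by rewrite /a /= clamp_id ?s0.
by rewrite /a /= clamp_id ?s0.
Qed.

Section Projected.
Variables (P : point) (sg : point -> plane) (io : plane -> point).
Hypothesis fP : free_set D P.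
Hypothesis ch : chart P sg io.

Definition parc e : R -> plane := sg \o (arc D e \o clamp 0 1).
Definition pvert v : plane := sg (pos D v).

Lemma free_chart x : drawing_set D x -> sphere x -> {for x, continuous sg} /\ io (sg x) = x.
Proof.
move=> dx sx; have [_ _ _ h _] := ch; apply: h => // E.
by have [_] := fP; apply; rewrite -E.
Qed.

Lemma arc_drawing e t : 0 <= t <= 1 -> drawing_set D (arc D e t).
Proof. by move=> t01; apply/drawing_setE; exists e; exists t. Qed.

Lemma io_parc e t : io (parc e t) = arc D e (clamp 0 1 t).
Proof.
have c := clamp01_in t.
by have [] := free_chart (arc_drawing e c) (arc_sphere e c).
Qed.

Lemma parc_cont e : continuous (parc e).
Proof.
move=> t; have c := clamp01_in t; apply: continuous_comp; first exact: arcc_cont.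
by have [] := free_chart (arc_drawing e c) (arc_sphere e c).
Qed.

Lemma parc_inj e s t : 0 <= s <= 1 -> 0 <= t <= 1 -> parc e s = parc e t -> s = t.
Proof.
move=> s01 t01 /(congr1 io); rewrite !io_parc !clamp_id//; exact: arc_inj.
Qed.

Lemma parc0 e : parc e 0 = pvert (ends e).1.
Proof. by have [_ _ /(_ e)[_ _ _ h _] _ _] := hD; rewrite /parc /= clamp01_l// h. Qed.

Lemma parc1 e : parc e 1 = pvert (ends e).2.
Proof. by have [_ _ /(_ e)[_ _ _ _ h] _ _] := hD; rewrite /parc /= clamp01_r// h. Qed.

Lemma trk_parc e w : trk (parc e) w <-> edge_set D e (io w).
Proof.
split; first by move=> [t t01 <-]; rewrite io_parc clamp_id//; exists t.
move=> [t t01 E]; exists t => //; rewrite /parc /= clamp_id// E.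
by have [_ _ h _ _] := ch; rewrite h.
Qed.

Lemma arcs_parc w : arcs parc w <-> drawing_set D (io w).
Proof.
by split => [[e /trk_parc h]|/drawing_setE[e h]]; [apply/drawing_setE; exists e|exists e; apply/trk_parc].
Qed.

Lemma parc_free_pt e : exists t0, 0 < t0 < 1 /\ forall f, f != e -> ~ trk (parc f) (parc e t0).
Proof.
have [t0 [/andP[h0 h1] h]] := free_param e; exists t0; rewrite h0 h1; split => // f fe.
move=> /trk_parc; rewrite io_parc clamp_id; first exact: h.
by rewrite !ltW.
Qed.

Lemma io_free w : ~ arcs parc w -> free_set D (io w).
Proof.
move=> nw; split; first by have [_ /(_ w)[]] := ch.
by move=> h; apply: nw; apply/arcs_parc.
Qed.

(** The centre [P] of the projection is itself a free point. The winding is constant near infinity,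
    so it extends continuously to [P]; with values in the multiples of [tau] it is constant on
    components. *)
Lemma winding_cell (c : gE G -> int) : cycle (fun e => (ends e).1) (fun e => (ends e).2) c ->
  exists F : point -> R, (forall w, ~ arcs parc w -> F (io w) = winding parc (fun e => (c e)%:~R) w) /\
  forall x y, connected_component (free_set D) x y -> F x = F y.
Proof.
move=> cc; set W := winding parc _; have [ioc io_s sgK ioK _] := ch.
have [_ nP] := fP; have [M M0 hM] := chart_far ch drawing_closed nP.
have far w : M < nrm w -> ~ arcs parc w by move=> /hM h /arcs_parc.
have Wc w : ~ arcs parc w -> {for w, continuous W}.
  by apply: winding_cont; exact: parc_cont.
have We w : ~ arcs parc w -> eqm (W w) 0.
  move=> nw; apply: (@winding_cycle _ _ _ _ (fun e => (ends e).1) (fun e => (ends e).2) pvert) => //.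
  - exact: parc_cont.
  - exact: parc0.
  - exact: parc1.
pose w0 : plane := (M + 1, 0).
have w0M : M < nrm w0.
  by apply: lt_le_trans (nrm_ge1 w0); rewrite /= ger0_norm ?ltrDl// addr_ge0.
have Wfar w : M < nrm w -> W w = W w0.
  move=> wM; have [g [cg g0 g1 gM]] := far_path M0 wM w0M.
  rewrite -g0 -g1; apply: path_const => // t /gM/far h; split; [exact: Wc|exact: We].
pose F x := if x == P then W w0 else W (sg x).
have nsg x : free_set D x -> x <> P -> ~ arcs parc (sg x).
  by move=> [sx dx] xP /arcs_parc; have [_ ->] := ioK x sx xP.
exists F; split.
  by move=> w nw; rewrite /F; have [_ /eqP/negbTE ->] := io_s w; rewrite sgK.
move=> x y xy; have fx : free_set D x.
  apply: contrapT => nx; move: xy; rewrite connected_component_out//.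
apply: (@eqm_connected _ _ F (connected_component (free_set D) x)) => //.
- exact: component_connected.
- apply/subspace_continuousP => u /connected_component_sub fu.
  suff : F x @[x --> within (connected_component (free_set D) x) (nbhs u)] --> F u by [].
  have [uP|uP] := pselect (u = P).
    have [d d0 hd] := chart_near ch M.
    rewrite uP => A nA; have A0 : A (F P) by exact: nbhs_singleton.
    have : nbhs P [set y | connected_component (free_set D) x y -> A (F y)].
      apply: filterS (nbhsx_ballx P d d0) => y' By' /connected_component_sub [sy _].
      have [->//|yP] := eqVneq y' P; suff -> : F y' = F P by [].
      by rewrite /F (negbTE yP) eqxx; apply: Wfar; apply: hd => //; exact/eqP.
    by [].
  suff cF : {for u, continuous F} by exact: (cvg_within_filter _ cF).
  apply: (@near_cont _ _ (W \o sg)).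
    have : nbhs u (~` [set P]).
      apply: open_nbhs_nbhs; split => //; apply: closed_openC.
      by apply: compact_closed; [exact: norm_hausdorff|exact: compact_set1].
    by apply: filterS => y' /= /eqP/negbTE yP; rewrite /F yP.
  have [su _] := fu; have [csg _] := ioK u su uP.
  by apply: continuous_comp => //; apply: Wc; exact: nsg.
- move=> u /connected_component_sub fu; rewrite /F; case: eqP => [_|uP].
    by apply: We; exact: far.
  by apply: We; exact: nsg.
- exact: connected_component_refl.
Qed.

(** Cells are added one at a time. If the cells found so far were all of them, every cycle would
    have its winding determined by one representative per cell, too few classes for [few_classes];
    the first cell is that of [P]. *)
Lemma many_cells N : (N + #|gV G| <= #|gE G| + 2)%N ->
  exists C : 'I_N -> set point, injective C /\ forall i, is_cell D (C i).
Proof.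
elim: N => [|N IH] hN; first by exists (fun=> set0); split => [[]|[]].
have [|C [iC hC]] := IH; first by apply: leq_trans hN; rewrite leq_add2r.
have [[C' [hC' nC']]|none] := pselect (exists C', is_cell D C' /\ forall i, C i <> C').
  exists (fun i => oapp C C' (unlift ord_max i)); split.
    move=> i j; case: unliftP => [i' ->|->]; case: unliftP => [j' ->|->] //=.
    + by move=> /iC ->.
    + by move=> /nC'.
    + by move=> /esym/nC'.
  by move=> i; case: (unliftP ord_max i) => [i' _|_] /=.
have cover x : free_set D x -> exists i, C i = connected_component (free_set D) x.
  move=> fx; apply: contrapT => nx; apply: none; exists (connected_component (free_set D) x).
  by split; [exists x|move=> i Ci; apply: nx; exists i].
exfalso; case: N C iC hC hN cover {IH none} => [|l] C iC hC hN cover.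
  by have [[]] := cover P fP.
have /choice[x hx] := hC.
have /choice[F hF] : forall c, exists F : point -> R,
    cycle (fun e => (ends e).1) (fun e => (ends e).2) c ->
    (forall w, ~ arcs parc w -> F (io w) = winding parc (fun e => (c e)%:~R) w) /\
    forall x y, connected_component (free_set D) x y -> F x = F y.
  move=> c; have [cc|cc] := pselect (cycle (fun e => (ends e).1) (fun e => (ends e).2) c).
    by have [F hF] := winding_cell cc; exists F.
  by exists (fun=> 0) => /cc.
have [v0 _] : exists v : gV G, true by have /card_gt0P[v _] := ltnW hV; exists v.
apply: (@few_classes _ _ _ _ (fun e => (ends e).1) (fun e => (ends e).2)
  parc_cont parc_inj parc_free_pt l (fun c i => F c (x i)) v0).
  by move: hN; clear; lia.
move=> w nw; have [i hi] := cover (io w) (io_free nw).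
exists i => c cc; have [h1 h2] := hF c cc; rewrite -h1//; symmetry; apply: h2.
have [_ hxi] := hx i; rewrite -hxi hi; apply: connected_component_refl; exact: io_free.
Qed.

End Projected.
End Drawing.

(** * Incidences at a vertex *)

Section Homotopies.
Variables (R : realType) (G : multigraph) (D : gmap R G).
Local Notation plane := (R * R)%type.
Local Notation point := (R * R * R)%type.

(* [equiv_access] with a homotopy that is continuous on the whole plane. *)
Definition total_equiv (C : set point) (v : gV G) (g1 g2 : R -> point) := exists H : R * R -> point,
  [/\ continuous H, forall s, 0 <= s <= 1 -> H (s, 1) = pos D v,
    forall s t, 0 <= s <= 1 -> 0 <= t < 1 -> C (H (s, t)),
    forall t, 0 <= t <= 1 -> H (0, t) = g1 t & forall t, 0 <= t <= 1 -> H (1, t) = g2 t].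

Lemma total_equiv_access C v g1 g2 : total_equiv C v g1 g2 -> equiv_access D C v g1 g2.
Proof. by move=> [H [cH h1 h2 h3 h4]]; exists H; split => //; exact: continuous_subspaceT. Qed.

Lemma total_equiv_ext C v g1 g2 k1 k2 : total_equiv C v g1 g2 ->
  (forall t, 0 <= t <= 1 -> g1 t = k1 t) -> (forall t, 0 <= t <= 1 -> g2 t = k2 t) ->
  total_equiv C v k1 k2.
Proof.
move=> [H [cH h1 h2 h3 h4]] e1 e2; exists H; split => // t t01; first by rewrite h3// e1.
by rewrite h4// e2.
Qed.

Lemma total_equiv_sym C v g1 g2 : total_equiv C v g1 g2 -> total_equiv C v g2 g1.
Proof.
move=> [H [cH h1 h2 h3 h4]].
have c01 (s : R) : 0 <= s <= 1 -> 0 <= 1 - s <= 1 by move=> /andP[? ?]; apply/andP; split; lra.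
exists (fun x => H (1 - x.1, x.2)); split => /=.
- move=> x; apply: (@continuous_comp _ _ _ (fun x : R * R => (1 - x.1, x.2)) H); last exact: cH.
  apply: (@pair_cont _ _ _ (fun x : R * R => 1 - x.1) snd); last exact: cvg_snd.
  by apply: cvgB; [exact: cvg_cst|exact: cvg_fst].
- by move=> s /c01/h1.
- by move=> s t /c01 s01; exact: h2.
- by move=> t t01; rewrite subr0 h4.
- by move=> t t01; rewrite subrr h3.
Qed.

Lemma total_equiv_trans C v g1 g2 g3 : total_equiv C v g1 g2 -> total_equiv C v g2 g3 ->
  total_equiv C v g1 g3.
Proof.
move=> [H [cH h1 h2 h3 h4]] [K [cK k1 k2 k3 k4]].
pose L (x : R * R) : point := H (clamp 0 1 (2 * x.1), x.2) + (K (clamp 0 1 (2 * x.1 - 1), x.2) - K (0, x.2)).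
have L1 s t : s <= 2^-1 -> L (s, t) = H (clamp 0 1 (2 * s), t).
  by move=> hs; rewrite /L /= (@clamp01_l _ (2 * s - 1)) ?subrr ?addr0//; lra.
have L2 s t : 2^-1 <= s -> 0 <= t <= 1 -> L (s, t) = K (clamp 0 1 (2 * s - 1), t).
  move=> hs t01; rewrite /L /= (@clamp01_r _ (2 * s)); last by lra.
  by rewrite h4// k3// addrC subrK.
have LP (Q : point -> Prop) s t : 0 <= t <= 1 -> (forall r, 0 <= r <= 1 -> Q (H (r, t))) ->
    (forall r, 0 <= r <= 1 -> Q (K (r, t))) -> Q (L (s, t)).
  move=> t01 q1 q2; have [hs|hs] := leP s 2^-1; first by rewrite L1//; apply: q1; exact: clamp01_in.
  by rewrite (L2 s t (ltW hs) t01); apply: q2; exact: clamp01_in.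
exists L; split.
- have cl (b : R) (x : R * R) : {for x, continuous (fun x : R * R => (clamp 0 1 (2 * x.1 - b), x.2))}.
    apply: (@pair_cont _ _ _ (fun x : R * R => clamp 0 1 (2 * x.1 - b)) snd); last exact: cvg_snd.
    apply: (@continuous_comp _ _ _ (fun x : R * R => 2 * x.1 - b) (clamp 0 1)); last exact: clamp_continuous.
    by apply: cvgB; [apply: cvgM; [exact: cvg_cst|exact: cvg_fst]|exact: cvg_cst].
  move=> x; apply: cvgD.
    apply: (@continuous_comp _ _ _ (fun x : R * R => (clamp 0 1 (2 * x.1), x.2)) H); last exact: cH.
    have := cl 0 x; have -> : (fun x : R * R => (clamp 0 1 (2 * x.1 - 0), x.2)) =
      (fun x : R * R => (clamp 0 1 (2 * x.1), x.2)) by apply/funext => y; rewrite subr0.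
    exact.
  apply: cvgB.
    by apply: (@continuous_comp _ _ _ (fun x : R * R => (clamp 0 1 (2 * x.1 - 1), x.2)) K); [exact: cl|exact: cK].
  apply: (@continuous_comp _ _ _ (fun x : R * R => (0, x.2)) K); last exact: cK.
  by apply: (@pair_cont _ _ _ (fun=> 0) snd); [exact: cvg_cst|exact: cvg_snd].
- move=> s _; apply: (LP (fun y => y = pos D v)); rewrite ?lexx ?ler01//.
- move=> s t _ t01; apply: (LP C) => [|r r01|r r01]; [|exact: h2|exact: k2].
  by case/andP: t01 => -> /ltW ->.
- by move=> t t01; rewrite L1 ?invr_ge0// mulr0 clamp01_l// h3.
- by move=> t t01; rewrite L2//; [rewrite mulr1 clamp01_r ?k4//; lra|lra].
Qed.

(** The starting point slides along the access itself up to time [a], so accesses can be compared by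
    their tails. *)
Lemma truncation_equiv C v (g : R -> point) a : continuous g -> g 1 = pos D v ->
  (forall t, 0 <= t < 1 -> C (g t)) -> 0 <= a < 1 ->
  total_equiv C v g (fun t => g (a + (1 - a) * t)).
Proof.
move=> cg g1 gC /andP[a0 a1]; exists (fun x => g (x.1 * a + (1 - x.1 * a) * x.2)); split => /=.
- move=> x; apply: (@continuous_comp _ _ _ (fun x : R * R => x.1 * a + (1 - x.1 * a) * x.2) g);
    last exact: cg.
  have c1 : {for x, continuous (fun x : R * R => x.1 * a)} by apply: cvgM; [exact: cvg_fst|exact: cvg_cst].
  by apply: cvgD; [exact: c1|apply: cvgM; [apply: cvgB; [exact: cvg_cst|exact: c1]|exact: cvg_snd]].
- by move=> s _; rewrite mulr1 addrC subrK.
- move=> s t /andP[s0 s1] /andP[t0 t1]; apply: gC.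
  have sa : 0 <= s * a <= a by rewrite mulr_ge0// ler_piMl.
  by case/andP: sa => ? ?; apply/andP; split; nra.
- by move=> t _; rewrite mul0r subr0 add0r mul1r.
- by move=> t _; rewrite mul1r.
Qed.

End Homotopies.

Section Finite.
Variable R : realType.

Lemma finite_lower_bound (T : finType) (f : T -> R) : (forall i, 0 < f i) ->
  exists2 r, 0 < r & forall i, r <= f i.
Proof.
move=> f0; suff [r r0 h] : exists2 r, 0 < r & forall i, i \in enum T -> r <= f i.
  by exists r => // i; apply: h; rewrite mem_enum.
elim: (enum T) => [|i s [r r0 h]]; first by exists 1.
exists (Num.min (f i) r); first by rewrite lt_min f0.
move=> j; rewrite inE => /orP[/eqP->|/h js]; first by rewrite ge_min lexx.
by rewrite ge_min js orbT.
Qed.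

Lemma left_nbhs (A : set R) : nbhs (1 : R) A -> exists s, 0 <= s < 1 /\ forall t, s <= t <= 1 -> A t.
Proof.
move=> /nbhs_ballP[d /= d0 hd]; exists (1 - Num.min 1 (d / 2)).
have m0 : 0 < Num.min 1 (d / 2) by rewrite lt_min ltr01 divr_gt0.
have m1 : Num.min 1 (d / 2) <= 1 by rewrite ge_min lexx.
have m2 : Num.min 1 (d / 2) <= d / 2 by rewrite ge_min lexx orbT.
split; first by apply/andP; split; lra.
by move=> t /andP[t0 t1]; apply: hd; rewrite /ball /= ger0_norm; lra.
Qed.

End Finite.

(** * At most as many inequivalent accesses at a vertex as its degree *)

Section VertexDegree.
Variables (R : realType) (G : multigraph) (D : gmap R G).
Local Notation plane := (R * R)%type.
Local Notation point := (R * R * R)%type.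
Hypothesis hD : is_drawing D.
Hypothesis hc : connected_graph G.
Hypothesis hV : (1 < #|gV G|)%N.
Variables (P : point) (sg : point -> plane) (io : plane -> point).
Hypothesis fP : free_set D P.
Hypothesis ch : chart P sg io.
Local Notation pa := (parc D sg).
Local Notation pv := (pvert D sg).
Local Notation K := (arcs pa).
Variable v : gV G.

Lemma pos_sphere u : sphere (pos D u).
Proof. by have [h _ _ _ _] := hD. Qed.

Lemma pos_drawing u : drawing_set D (pos D u).
Proof. by left; exists u. Qed.

Lemma io_pvert u : io (pv u) = pos D u.
Proof. by have [] := free_chart fP ch (pos_drawing u) (pos_sphere u). Qed.

Lemma pvert_inj u w : pv u = pv w -> u = w.
Proof. by move=> /(congr1 io); rewrite !io_pvert; have [_ h _ _ _] := hD => /h. Qed.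

Lemma K_closed : closed K.
Proof. exact: arcs_closed (parc_cont hD hc hV fP ch). Qed.

Lemma joined_arc e s t : 0 <= s <= 1 -> 0 <= t <= 1 -> joined K (pa e s) (pa e t).
Proof.
move=> /andP[s0 s1] /andP[t0 t1]; apply: joined_path; first exact: (parc_cont hD hc hV fP ch).
move=> u /andP[h1 h2]; exists e; exists u => //; apply/andP; split.
  by apply: le_trans h1; rewrite le_min s0.
by apply: le_trans h2 _; rewrite ge_max s1.
Qed.

Lemma joined_vertices u w : joined K (pv u) (pv w).
Proof.
have /connectP[p] := hc u w; elim: p u => [|y p IH] u /=.
  move=> _ ->; have [e /orP he] := incident_edge hc hV u.
  have h0 : 0 <= (0 : R) <= 1 by rewrite lexx ler01.
  have h1 : 0 <= (1 : R) <= 1 by rewrite lexx ler01.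
  case: he => /eqP <-; first by rewrite -(parc0 hD); exact: joined_arc.
  by rewrite -(parc1 hD); exact: joined_arc.
case/andP => /existsP[e he] /IH h /h; apply: joined_trans.
have h0 : 0 <= (0 : R) <= 1 by rewrite lexx ler01.
have h1 : 0 <= (1 : R) <= 1 by rewrite lexx ler01.
have := joined_arc e h0 h1; rewrite (parc0 hD) (parc1 hD).
by case/orP: he => /eqP -> //= /joined_sym.
Qed.

Lemma joined_vertex w u : K w -> joined K w (pv u).
Proof.
move=> [e [t t01 <-]]; apply: joined_trans (joined_vertices (ends e).1 u).
by rewrite -(parc0 hD); apply: joined_arc => //; rewrite lexx ler01.
Qed.

Definition incident (e : gE G) := ((ends e).1 == v) || ((ends e).2 == v).

Lemma parc_vertex e t u : 0 <= t <= 1 -> pa e t = pv u ->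
  (t = 0 /\ u = (ends e).1) \/ (t = 1 /\ u = (ends e).2).
Proof.
move=> t01 E; have [t0|t0] := eqVneq t 0.
  by left; split => //; apply: pvert_inj; rewrite -E t0 (parc0 hD).
have [t1|t1] := eqVneq t 1.
  by right; split => //; apply: pvert_inj; rewrite -E t1 (parc1 hD).
exfalso; have [_ _ _ h _] := hD; apply: (h e u); exists t.
  by case/andP: t01 => h0 h1; rewrite /I01o /= !lt_neqAle h0 h1 t1 eq_sym t0.
by rewrite -io_pvert -E (io_parc hD hc hV fP ch) clamp_id.
Qed.

Section Accesses.
Variables (T : finType) (C : T -> set point) (g : T -> R -> point).
Hypothesis C_cell : forall a, is_cell D (C a).
Hypothesis g_access : forall a, access D (C a) v (g a).
Hypothesis g_neq : forall a b, a != b -> C a = C b -> ~ equiv_access D (C a) v (g a) (g b).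

Let gc a := g a \o clamp 0 1.

Lemma gc_cont a : continuous (gc a).
Proof. by have [h _ _] := g_access a; exact: within_clamp. Qed.

Lemma gc1 a : gc a 1 = pos D v.
Proof. by have [_ h _] := g_access a; rewrite /gc /= clamp01_r. Qed.

Lemma gcC a t : 0 <= t < 1 -> C a (gc a t).
Proof.
move=> t01; have [_ _ h] := g_access a; rewrite /gc /= clamp_id; first exact: h.
by case/andP: t01 => -> /ltW.
Qed.

Lemma cell_free a x : C a x -> free_set D x.
Proof. by have [y [_ ->]] := C_cell a => /connected_component_sub. Qed.

Lemma gc_sphere a t : 0 <= t <= 1 -> sphere (gc a t).
Proof.
move=> /andP[t0]; rewrite le_eqVlt => /orP[/eqP->|t1]; first by rewrite gc1; exact: pos_sphere.
by have [] := @cell_free a (gc a t); [apply: gcC; rewrite t0|].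
Qed.

Lemma cell_joined a b x y : C a (io x) -> C b (io y) -> joined (~` K) x y -> C a = C b.
Proof.
have [xa [_ ->]] := C_cell a; have [xb [_ ->]] := C_cell b => ca cb [c [cc c0 c1 cK]].
rewrite (same_connected_component ca) (same_connected_component cb) -c0 -c1.
apply: same_connected_component.
apply: (@component_path _ _ _ _ (io \o c)).
- by move=> t; apply: continuous_comp; [exact: cc|have [h _ _ _ _] := ch; exact: h].
- by move=> t /cK; exact: (io_free hD hc hV fP ch).
- apply: connected_component_refl; apply: (io_free hD hc hV fP ch); apply: cK.
  by rewrite lexx ler01.
Qed.

Section Tails.
Variables (r0 a0 : R).
Hypothesis r00 : 0 < r0.
Hypothesis a01 : 0 <= a0 < 1.
Hypothesis tails : forall a t, a0 <= t <= 1 -> gc a t <> P /\ ball (pv v) r0 (sg (gc a t)).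
Hypothesis exit_vertex : exists u, ~ ball (pv v) r0 (pv u).

Definition tail a (t : R) : plane := sg (gc a (a0 + (1 - a0) * clamp 0 1 t)).

Let Or r := ball (pv v) r `\` K.

Lemma tail_param t : a0 <= a0 + (1 - a0) * clamp 0 1 t <= 1.
Proof. by have := a01; have := clamp01_in t => /andP[? ?] /andP[? ?]; apply/andP; split; nra. Qed.

Lemma tail_chart a t : {for gc a (a0 + (1 - a0) * clamp 0 1 t), continuous sg} /\
  io (tail a t) = gc a (a0 + (1 - a0) * clamp 0 1 t).
Proof.
have [_ _ _ h _] := ch; have u01 := tail_param t; have [nP _] := tails a u01.
apply: h => //; apply: gc_sphere; case/andP: u01 => h1 ->; case/andP: a01 => h2 _.
by rewrite (le_trans h2).
Qed.

Lemma tail_cont a : continuous (tail a).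
Proof.
move=> t; have [cs _] := tail_chart a t.
apply: (@continuous_comp _ _ _ (fun t : R => gc a (a0 + (1 - a0) * clamp 0 1 t)) sg) => //.
apply: (@continuous_comp _ _ _ (fun t : R => a0 + (1 - a0) * clamp 0 1 t) (gc a)); last exact: gc_cont.
by apply: cvgD; [exact: cvg_cst|apply: cvgM; [exact: cvg_cst|exact: clamp_continuous]].
Qed.

Lemma tail1 a : tail a 1 = pv v.
Proof. by rewrite /tail clamp01_r// mulr1 addrC subrK gc1. Qed.

Lemma tail_cell a t : 0 <= t < 1 -> C a (io (tail a t)).
Proof.
move=> /andP[t0 t1]; have [_ ->] := tail_chart a t; rewrite clamp_id ?t0 ?ltW//.
by apply: gcC; have /andP[? ?] := a01; apply/andP; split; nra.
Qed.

Lemma tail_in a t : 0 <= t < 1 -> Or r0 (tail a t).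
Proof.
move=> t01; split; first by have [_] := tails a (tail_param t).
move=> /(arcs_parc hD hc hV fP ch); have [_] := cell_free (tail_cell a t01); exact.
Qed.

Lemma exits r w : 0 < r <= r0 -> K w -> exists2 u, joined K w u & ~ ball (pv v) r u.
Proof.
move=> /andP[_ rr] Kw; have [u hu] := exit_vertex; exists (pv u); first exact: joined_vertex.
by move=> h; apply: hu; exact: le_ball h.
Qed.

(** If the tails could be joined in every disc that contains them, [access_homotopy] would make the
    two accesses equivalent. *)
Lemma separated_pair a b : a != b -> exists r s, [/\ 0 < r <= r0, 0 <= s < 1,
  forall t, s <= t <= 1 -> ball (pv v) r (tail a t) /\ ball (pv v) r (tail b t) &
  ~ joined (Or r) (tail a s) (tail b s)].
Proof.
move=> ab; apply: contrapT => N.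
have J r s : 0 < r <= r0 -> 0 <= s < 1 ->
    (forall t, s <= t <= 1 -> ball (pv v) r (tail a t) /\ ball (pv v) r (tail b t)) ->
    joined (Or r) (tail a s) (tail b s).
  by move=> r1 s1 h; apply: contrapT => nj; apply: N; exists r, s.
have h0 : 0 <= (0 : R) < 1 by rewrite lexx ltr01.
have rr : 0 < r0 <= r0 by rewrite r00 lexx.
have ball1 : ball (pv v) r0 (pv v) by exact: ballxx.
(* Inequivalence is assumed only for accesses from the same cell; joining the tails in the largest
   disc shows that the cells agree. *)
have Cab : C a = C b.
  apply: (@cell_joined a b (tail a 0) (tail b 0)); [exact: tail_cell|exact: tail_cell|].
  apply: (@joined_sub _ (Or r0)); first by move=> w [].
  apply: J => // t /andP[t0]; rewrite le_eqVlt => /orP[/eqP->|t1]; first by rewrite !tail1.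
  have t01 : 0 <= t < 1 by rewrite t0.
  by have [h1 _] := tail_in a t01; have [h2 _] := tail_in b t01.
apply: (g_neq ab Cab).
have [H [cH H1 HO H0 H01]] := @access_homotopy _ K (pv v) r0 K_closed r00 exits (tail a) (tail b)
  (@tail_cont a) (@tail_cont b) (tail1 a) (tail1 b) (@tail_in a) (@tail_in b) J.
have mid : total_equiv D (C a) v (io \o tail a) (io \o tail b).
  have [cio _ _ _ _] := ch; exists (io \o H); split => /=.
  - by move=> x; apply: continuous_comp; [exact: cH|exact: cio].
  - by move=> s _; rewrite H1 io_pvert.
  - move=> s t s01 t01; have [x [fx E]] := C_cell a; rewrite E.
    (* The point is connected to [H (0, t)], a point of the first access, by the path
       [u => H (s * u, t)] off the drawing, so it stays in the cell. *)
    rewrite -[s]mulr1; apply: (@component_path _ _ _ _ (fun u => io (H (s * u, t)))).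
    + move=> u; apply: (@continuous_comp _ _ _ (fun u : R => H (s * u, t)) io); last exact: cio.
      apply: (@continuous_comp _ _ _ (fun u : R => (s * u, t)) H); last exact: cH.
      apply: (@pair_cont _ _ _ (fun u : R => s * u) (fun=> t)); last exact: cvg_cst.
      by apply: cvgM; [exact: cvg_cst|exact: cvg_id].
    + by move=> u _; apply: (io_free hD hc hV fP ch); have [] := HO (s * u) t t01.
    + rewrite mulr0 H0; last by case/andP: t01 => -> /ltW.
      by rewrite -E; exact: tail_cell.
  - by move=> t t01; rewrite H0.
  - by move=> t t01; rewrite H01.
have trunc k : total_equiv D (C k) v (g k) (io \o tail k).
  apply: (@total_equiv_ext _ _ _ _ _ (gc k) (fun t => gc k (a0 + (1 - a0) * t))).
  - by apply: truncation_equiv => //; [exact: gc_cont|exact: gc1|exact: gcC].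
  - by move=> t t01; rewrite /gc /= clamp_id.
  - by move=> t t01 /=; have [_ ->] := tail_chart k t; rewrite clamp_id.
apply: total_equiv_access; apply: total_equiv_trans (trunc a) _.
apply: total_equiv_trans mid _; rewrite Cab; apply: total_equiv_sym; exact: trunc.
Qed.

(** There are finitely many pairs, so one radius and one time keep all of them separated; with more
    accesses than edges at [v] this contradicts [too_many_accesses]. *)
Lemma tails_le_degree : (#|T| <= #|[pred e | incident e]|)%N.
Proof.
rewrite leqNgt; apply/negP => big.
have /choice[rs hrs] : forall ab : T * T, exists rs : R * R, [/\ 0 < rs.1 <= r0, 0 <= rs.2 < 1 &
   ab.1 != ab.2 -> (forall t, rs.2 <= t <= 1 ->
     ball (pv v) rs.1 (tail ab.1 t) /\ ball (pv v) rs.1 (tail ab.2 t)) /\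
   ~ joined (Or rs.1) (tail ab.1 rs.2) (tail ab.2 rs.2)].
  move=> [a b] /=; have [->|ab] := eqVneq a b.
    (* A pair of equal indices carries no condition; these values only keep the bounds valid. *)
    by exists (r0, 0); rewrite /= r00 !lexx ltr01.
  by have [r [s [h1 h2 h3 h4]]] := separated_pair ab; exists (r, s); split.
have [r r_gt0 hr] : exists2 r, 0 < r & forall ab, r <= (rs ab).1.
  by apply: finite_lower_bound => ab; have [/andP[]] := hrs ab.
have [s [s01 hs]] : exists s, 0 <= s < 1 /\ forall t, s <= t <= 1 ->
    (forall a, ball (pv v) r (tail a t)) /\ (forall ab, (rs ab).2 <= t).
  apply: left_nbhs; apply: filterI.
    apply: (@filter_forall _ _ (fun a => [set t | ball (pv v) r (tail a t)]) _ (nbhs_filter _)) => a.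
    by apply: tail_cont; rewrite tail1; exact: nbhsx_ballx.
  apply: (@filter_forall _ _ (fun ab => [set t | (rs ab).2 <= t]) _ (nbhs_filter _)) => ab.
  have [_ /andP[_ h] _] := hrs ab.
  have : nbhs (1 : R) [set t | (rs ab).2 < t] by apply: open_nbhs_nbhs; split; [exact: open_gt|].
  by apply: filterS => t /ltW.
have [s0 s1] := andP s01.
pose J := {e : gE G | incident e}.
pose d := #|{: J}|.
have dE : d = #|[pred e | incident e]| by rewrite /d card_sig.
have d0 : (0 < d)%N.
  by rewrite dE; apply/card_gt0P; have [e he] := incident_edge hc hV v; exists e.
rewrite -dE in big.
pose f (i : 'I_d.+1) : T := enum_val (widen_ord big i).
have fI : injective f.
  by move=> i j /enum_val_inj /(congr1 val) /= h; apply: val_inj.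
(* Every incident edge is oriented away from [v]; since there are no loops, exactly one of its ends
   is [v]. *)
pose ej (j : J) (t : R) := if (ends (val j)).1 == v then pa (val j) t else pa (val j) (1 - t).
pose p (i : 'I_d.+1) (t : R) := tail (f i) (s + (1 - s) * t).
have cpa e : continuous (pa e) by exact: (parc_cont hD hc hV fP ch).
have c01 (t : R) : 0 <= t <= 1 -> 0 <= 1 - t <= 1 by move=> /andP[? ?]; apply/andP; split; lra.
have h0 : 0 <= (0 : R) <= 1 by rewrite lexx ler01.
have h1 : 0 <= (1 : R) <= 1 by rewrite lexx ler01.
have ejE j t : 0 <= t <= 1 -> exists2 u, 0 <= u <= 1 & ej j t = pa (val j) u.
  by move=> t01; rewrite /ej; case: ifP => _; [exists t|exists (1 - t) => //; exact: c01].
apply: (@too_many_accesses _ K (pv v) r J ej d p) => //.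
- exact: K_closed.
- by have [] := joined_in (joined_vertices v v).
- move=> j; have [E|/negbTE E] := boolP ((ends (val j)).1 == v).
    have -> : ej j = pa (val j) by apply/funext => u; rewrite /ej E.
    exact: cpa.
  have -> : ej j = (fun u : R => pa (val j) (1 - u)) by apply/funext => u; rewrite /ej E.
  move=> t; apply: (@continuous_comp _ _ _ (fun t : R => 1 - t) (pa (val j))); last exact: cpa.
  by apply: cvgB; [exact: cvg_cst|exact: cvg_id].
- move=> j; rewrite /ej; have := valP j; rewrite /incident; case: ifP => [/eqP E _|_ /= /eqP E].
    by rewrite (parc0 hD) E.
  by rewrite subr0 (parc1 hD) E.
- by move=> j t /(ejE j)[u u01 ->]; exists (val j); exists u.
- move=> j t /andP[t0 t1]; have t01 : 0 <= t <= 1 by rewrite ltW.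
  have nl := noloop (val j); rewrite /ej; case: eqP => [E|E] h.
    have [[h2 _]|[_ h2]] := parc_vertex t01 h; first by rewrite h2 ltxx in t0.
    by rewrite E h2 eqxx in nl.
  have [[_ h2]|[h2 _]] := parc_vertex (c01 _ t01) h; first by apply: E.
  by move: t0; rewrite ltNge; have -> : t <= 0 by lra.
- exists (\bigcup_(e in [set e | ~~ incident e]) trk (pa e)); split.
  + by apply: closed_bigcup => [|e _]; [exact: finite_finset|exact: trk_closed].
  + move=> [e /= ne [t t01 /(parc_vertex t01)]]; rewrite /incident in ne.
    by move=> [[_ E]|[_ E]]; rewrite E eqxx ?orbT in ne.
  + move=> w [e ew]; have [ie|ne] := boolP (incident e); last by apply: Or32; exists e.
    apply: Or33; exists (exist _ e ie); case: ew => t t01 tw.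
    have [E|E] := eqVneq (ends e).1 v; [exists t|exists (1 - t)]; rewrite /ej /=.
      by rewrite E eqxx.
    by rewrite (negbTE E) subKr; split => //; exact: c01.
- move=> i t; apply: (@continuous_comp _ _ _ (fun t : R => s + (1 - s) * t) (tail (f i)));
    last exact: tail_cont.
  by apply: cvgD; [exact: cvg_cst|apply: cvgM; [exact: cvg_cst|exact: cvg_id]].
- by move=> i; rewrite /p mulr1 addrC subrK tail1.
- move=> i t /andP[t0 t1]; have q : s <= s + (1 - s) * t < 1 by apply/andP; split; nra.
  have /andP[q1 q2] := q; split; first by have [h _] := hs _ (introT andP (conj q1 (ltW q2))); exact: h.
  by have [] := @tail_in (f i) (s + (1 - s) * t); [rewrite q2 (le_trans s0)|].
move=> i j ij; rewrite /p mulr0 addr0 => Jij.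
have fij : f i != f j by rewrite (inj_eq fI).
have [/andP[rs0 _] /andP[u0 u1] /(_ fij)[/= htl]] := hrs (f i, f j); apply.
set r' := (rs _).1 in rs0 htl *; set u := (rs _).2 in u0 u1 htl *.
have us : u <= s by have [_] := hs s (introT andP (conj (lexx s) (ltW s1))); exact.
(* From [u] to [s] both tails stay in the larger disc, so a join at time [s] in the common small
   disc would give one at time [u], where the pair is known to be separated. *)
have seg_in k : (forall t, u <= t <= 1 -> ball (pv v) r' (tail k t)) -> joined (Or r') (tail k u) (tail k s).
  move=> hk; apply: joined_path; first exact: tail_cont.
  move=> t; rewrite (min_l us) (max_r us) => /andP[ut ts].
  have t1 : t < 1 by exact: le_lt_trans s1.
  split; first by apply: hk; rewrite ut ltW.
  by have [] := @tail_in k t; [rewrite t1 (le_trans u0)|].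
apply: joined_trans (seg_in (f i) (fun t ht => (htl t ht).1)) _.
apply: joined_trans (joined_sym (seg_in (f j) (fun t ht => (htl t ht).2))).
apply: joined_sub Jij => w [bw nw]; split => //; apply: le_ball bw; exact: hr.
Qed.

End Tails.

(** The disc is chosen so small that it misses another vertex, to which the drawing can escape, and
    the tails are taken so late that they avoid the centre of projection and stay in the disc. *)
Lemma accesses_le_degree : (#|T| <= #|[pred e | incident e]|)%N.
Proof.
have [u uv] := other_vertex hV v.
have nu : ~ [set pv u] (pv v) by move=> /pvert_inj E; rewrite E eqxx in uv.
have cu : closed [set pv u] by apply: plane_compact_closed; exact: compact_set1.
have [r0 r00 hr0] := closed_dist cu nu.
have [a0 [a01 ha0]] : exists a0, 0 <= a0 < 1 /\ forall t, a0 <= t <= 1 -> forall a,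
    gc a t <> P /\ ball (pv v) r0 (sg (gc a t)).
  apply: left_nbhs.
  apply: (@filter_forall _ _ (fun a => [set t | gc a t <> P /\ ball (pv v) r0 (sg (gc a t))]) _ (nbhs_filter _)) => a.
  have [cs _] := free_chart fP ch (pos_drawing v) (pos_sphere v).
  apply: filterI.
    have : nbhs (1 : R) (gc a @^-1` ~` [set P]).
      apply: gc_cont; rewrite gc1; apply: open_nbhs_nbhs; split.
        apply: closed_openC; apply: compact_closed; first exact: norm_hausdorff.
        exact: compact_set1.
      by move=> /= E; have [_] := fP; apply; rewrite -E; exact: pos_drawing.
    by [].
  have : {for (1 : R), continuous (sg \o gc a)}.
    by apply: continuous_comp; [exact: gc_cont|rewrite gc1].
  by move=> c; apply: c; rewrite /= gc1; exact: nbhsx_ballx.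
apply: (@tails_le_degree r0 a0) => //.
  by move=> a t /ha0/(_ a).
by exists u => h; apply: (hr0 _ h).
Qed.

End Accesses.
End VertexDegree.

(** * Double counting of incidences *)

Lemma sum_degrees (G : multigraph) :
  (\sum_(v : gV G) #|[pred e | incident v e]| = 2 * #|gE G|)%N.
Proof.
under eq_bigr do rewrite -sum1_card big_mkcond.
rewrite exchange_big /=; under eq_bigr => e _.
  rewrite (bigD1 (ends e).1)//= (bigD1 (ends e).2) /=; last by rewrite eq_sym noloop.
  rewrite !inE /incident !eqxx orbT big1; last first.
    by move=> v /andP[h1 h2]; rewrite !inE (eq_sym _ v) (negbTE h1) eq_sym (negbTE h2).
  over.
by rewrite sum_nat_const mulnC.
Qed.

(** The subtraction is truncated. When [m + 2 < n] the hypothesis says nothing, but then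
    [m <= n - 2] and the factor [k / (k - 2)] is at least 1. *)
Lemma edge_count (k n m : nat) : (3 <= k)%N -> (3 <= n)%N ->
  (k * (m + 2 - n) <= 2 * m)%N ->
  (m%:R : rat) <= k%:R / (k%:R - 2) * (n%:R - 2).
Proof.
move=> k3 n3 h.
have k2 : 0 < k%:R - 2 :> rat by rewrite subr_gt0 ltr_nat.
rewrite mulrAC ler_pdivlMr// mulrBr.
have [mn|mn] := leqP n (m + 2).
  have : (k * (m + 2 - n))%:R <= (2 * m)%:R :> rat by rewrite ler_nat.
  rewrite !natrM natrB// natrD; lra.
have : (m + 2)%:R <= n%:R :> rat by rewrite ler_nat ltnW.
have m0 : 0 <= m%:R :> rat by [].
have : 0 <= k%:R :> rat by [].
by rewrite natrD; nra.
Qed.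

Lemma sum_fibers (T V : finType) (f : T -> V) : (\sum_v #|[pred x | f x == v]| = #|T|)%N.
Proof.
under eq_bigr do rewrite -sum1_card big_mkcond.
rewrite exchange_big /= -sum1_card; apply: eq_bigr => x _.
by rewrite (bigD1 (f x))//= inE eqxx big1// => v; rewrite inE eq_sym => /negbTE ->.
Qed.

(** The pairs of a cell and an index below [k] are sorted by the vertex at which their access ends;
    each fibre is bounded by the degree, and the degrees add up to twice the number of edges. *)
Lemma incidence_count (k : nat) (R : realType) (G : multigraph) (D : gmap R G) :
  kplus_real_face_drawing k D -> connected_graph G -> (1 < #|gV G|)%N ->
  (k * (#|gE G| + 2 - #|gV G|) <= 2 * #|gE G|)%N.
Proof.
move=> [hD faces] hc hV; have [P fP] := free_point hD hc hV.
have [sg [io ch]] := chart_exists fP.1.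
set N := (_ - _)%N; have [N0|N0] := posnP N; first by rewrite N0 muln0.
have [|C [iC hC]] := @many_cells _ _ _ hD hc hV _ _ _ fP ch N.
  by rewrite /N subnK// ltnW// -subn_gt0.
have /choice[a ha] : forall i, exists a : 'I_k -> gV G * (R -> R * R * R),
    (forall j, access D (C i) (a j).1 (a j).2) /\ (forall j j', j != j' ->
     ~ ((a j).1 = (a j').1 /\ equiv_access D (C i) (a j).1 (a j).2 (a j').2)).
  by move=> i; exact: faces.
pose f (x : 'I_N * 'I_k) := (a x.1 x.2).1.
have -> : (k * N = \sum_v #|[pred x | f x == v]|)%N.
  by rewrite sum_fibers card_prod !card_ord mulnC.
rewrite -sum_degrees; apply: leq_sum => v _.
pose T := {x | f x == v}.
have := @accesses_le_degree _ _ _ hD hc hV _ _ _ fP ch v T (fun x => C (val x).1)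
  (fun x => (a (val x).1 (val x).2).2).
rewrite card_sig; apply.
- by move=> x; exact: hC.
- move=> x; have vx := eqP (valP x); have := (ha (val x).1).1 (val x).2.
  by rewrite -/(f (val x)) vx.
(* Equal cells have equal indices because [C] is injective, so only two incidences of the same cell
   are ever compared. *)
- move=> x y xy /iC E; have vx := eqP (valP x); have vy := eqP (valP y); move=> h.
  have [_ h2] := ha (val x).1; apply: (h2 (val x).2 (val y).2).
    apply: contra xy => /eqP E2; apply/eqP/val_inj.
    by rewrite [val x]surjective_pairing [val y]surjective_pairing E E2.
  rewrite -/(f (val x)) vx; move: vy h; rewrite /f -E => -> h; split => //.
Qed.

Theorem theorem30 (k n : nat) (G : multigraph) :
  (3 <= k)%N -> (3 <= n)%N -> #|gV G| = n -> connected_graph G ->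
  kplus_real_face_graph k G ->
  (#|gE G|%:R : rat) <= k%:R / (k%:R - 2) * (n%:R - 2).
Proof.
move=> k3 n3 Gn hc [R [D hD]]; apply: edge_count => //.
by rewrite -Gn; apply: (incidence_count hD) => //; rewrite Gn ltnW.
Qed.
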